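(* Let $f(x,y)=y^{n}+a_{1}(x)y^{n-1}+\cdots+a_{n}(x)\in\mathbb{C}[x,y]$, $n\geqslant 1$, with $\deg a_i\leqslant i$ for $i=1,\dots,n$. Let $Q(x,\lambda,u):=\operatorname{Res}_{y}(f(x,y)-\lambda,f_{y}^{\prime}(x,y)-u)$ (which is a nonzero polynomial) be written as $$Q(x,\lambda,u)=Q_{0}(\lambda,u)x^{N}+\cdots+Q_{N}(\lambda,u),\qquad Q_{0}\neq0,$$ and put $S_\lambda:=f^{-1}(\lambda)$ for $\lambda\in\mathbb{C}$. The functions $\mathbb{C}\ni\lambda\mapsto\mathcal{L}_{\infty,\lambda}(f)$ and $\mathbb{C}\ni\lambda\mapsto\mathcal{L}_{\infty}(\nabla f|S_{\lambda})$ are identical except at a finite set of points $\lambda_{0}$, at which $\mathcal{L}_{\infty,\lambda_{0}}(f)<\mathcal{L}_{\infty}(\nabla f|S_{\lambda_{0}})$. For $\lambda_0\in\mathbb{C}$ this strict inequality holds if and only if either $\mathcal{L}_{\infty,\lambda_{0}}(f)\in(-\infty,-1)$, or $\mathcal{L}_{\infty,\lambda_{0}}(f)>0$ and $$\max_{1\leqslant i\leqslant N}\frac{\deg_{u}Q_{i}(\lambda,u)}{i}>\max_{1\leqslant i\leqslant N}\frac{\deg_{u}Q_{i}(\lambda_{0},u)}{i}.$$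
   Context: Here $f_y'=\partial f/\partial y$, $\nabla f=(f_x',f_y')$; $\operatorname{Res}_y$ is the resultant with respect to $y$, with $\lambda,u$ treated as new variables. $\deg_u Q_i(\lambda,u)$ is the degree in $u$ of $Q_i$ as a polynomial in $(\lambda,u)$, while $\deg_u Q_i(\lambda_0,u)$ is the degree of the one-variable polynomial obtained by setting $\lambda=\lambda_0$ ($\deg 0=-\infty$). For a polynomial mapping $F:\mathbb{C}^{2}\to\mathbb{C}^{m}$ and an unbounded set $S\subset\mathbb{C}^{2}$ let $N(F|S):=\{\nu\in\mathbb{R}:\exists A,B>0\ \forall z\in S\ (|z|>B\Rightarrow|F(z)|\geqslant A|z|^{\nu})\}$, where $|\cdot|$ is the maximum norm; $\mathcal{L}_\infty(F|S):=\sup N(F|S)$ if $N(F|S)\neq\emptyset$ and $-\infty$ otherwise. A function meromorphic at infinity is given by a Laurent series $\sum_{m=k}^{-\infty}c_mt^m$, $k\in\mathbb{Z}$, convergent in a punctured neighbourhood of $\infty\in\overline{\mathbb{C}}$; its degree $\deg$ is the largest $m$ with $c_m\ne0$, $\deg 0:=-\infty$; for a tuple of such functions, $\deg$ is the maximum of the degrees of the components. For $\lambda\in\mathbb{C}$, $$\mathcal{L}_{\infty,\lambda}(f):=\inf_{\Phi}\frac{\deg(\nabla f\circ\Phi)}{\deg\Phi},$$ the infimum taken over all pairs $\Phi=(\varphi_1,\varphi_2)$ of functions meromorphic at infinity with $\deg\Phi>0$ and $\deg((f-\lambda)\circ\Phi)<0$. *)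

(* Defs.v *)
From HB Require Import structures.
From mathcomp Require Export all_boot all_order all_algebra.
From mathcomp Require Export all_classical all_reals all_analysis.
From mathcomp Require Export complex.

Set Implicit Arguments.
Unset Strict Implicit.
Unset Printing Implicit Defensive.

Import Order.TTheory GRing.Theory Num.Theory.
Import numFieldNormedType.Exports.

Local Open Scope classical_set_scope.
Local Open Scope ring_scope.

(* The complex field is R[i] for an arbitrary R : realType.  The generic norm
   `|z| takes its values in R[i]; cmod is the same modulus with values in R. *)
Definition cmod (R : realType) (z : R[i]) : R := ComplexField.Normc.normc z.

(* An element of {poly {poly A}} is read as an element of A[x][y]: the outer
   variable is y and the inner one is x. *)
Definition eval2 (A : comNzRingType) (f : {poly {poly A}}) (z : A * A) : A :=
  f.[(z.2)%:P].[z.1].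

Definition dx (A : comNzRingType) (f : {poly {poly A}}) : {poly {poly A}} :=
  map_poly (@deriv A) f.

Definition dy (A : comNzRingType) (f : {poly {poly A}}) : {poly {poly A}} :=
  f^`().

Definition grad (A : comNzRingType) (f : {poly {poly A}}) (z : A * A) : A * A :=
  (eval2 (dx f) z, eval2 (dy f) z).

Definition fibre (A : comNzRingType) (f : {poly {poly A}}) (l : A) :
  set (A * A) := [set z | eval2 f z = l].

Section Lojasiewicz.
Variable R : realType.
Local Notation C := R[i].

Definition maxnorm (z : C * C) : R := Num.max (cmod z.1) (cmod z.2).

Definition Nexp (F : C * C -> C * C) (S : set (C * C)) : set R :=
  [set nu | exists A B : R, [/\ 0 < A, 0 < B &
    forall z, S z -> B < maxnorm z -> A * (maxnorm z `^ nu) <= maxnorm (F z)]].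

(* The supremum in \bar R of the empty set is -oo. *)
Definition loj_on (F : C * C -> C * C) (S : set (C * C)) : \bar R :=
  ereal_sup [set nu%:E | nu in Nexp F S].

(* c m is the coefficient of t^m; only the germ of h at infinity matters. *)
Definition laurent_at_infty (h : C -> C) (c : int -> C) : Prop :=
  exists k : int, (forall m : int, k < m -> c m = 0) /\
  exists2 r : R, 0 < r & forall t : C, r < cmod t ->
    cmod (\sum_(j < n) c (k - j%:Z) * t ^ (k - j%:Z) - h t) @[n --> \oo]
      --> (0 : R).

Definition meromorphic_at_infty (h : C -> C) : Prop :=
  exists c : int -> C, laurent_at_infty h c.

(* The expansion of h is unique, so this is the largest m with c m != 0, and it
   is -oo if h vanishes near infinity. *)
Definition deg_infty (h : C -> C) : \bar R :=
  ereal_sup [set (m%:~R : R)%:E | m in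
    [set m : int | exists2 c : int -> C, laurent_at_infty h c & c m != 0]].

Definition deg_infty2 (Phi : C -> C * C) : \bar R :=
  Order.max (deg_infty (fun t => (Phi t).1)) (deg_infty (fun t => (Phi t).2)).

Definition loj_fibre_curve (f : {poly {poly C}}) (l : C) (Phi : C -> C * C) :
    Prop :=
  [/\ meromorphic_at_infty (fun t => (Phi t).1),
      meromorphic_at_infty (fun t => (Phi t).2),
      (0 < deg_infty2 Phi)%E &
      (deg_infty (fun t => (eval2 f (Phi t) - l)%R) < 0)%E].

Definition loj_at (f : {poly {poly C}}) (l : C) : \bar R :=
  ereal_inf [set (deg_infty2 (fun t => grad f (Phi t)) / deg_infty2 Phi)%E
            | Phi in loj_fibre_curve f l].

(* The degree of a polynomial in its (outer) variable, with deg 0 = -oo. *)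
Definition pdeg (A : nzRingType) (p : {poly A}) : \bar R :=
  if p == 0 then -oo%E else ((size p).-1%:R : R)%:E.

(* An element of {poly {poly C}} also encodes one of C[lambda][u], with outer
   variable u and inner variable lambda; the coefficients of f are
   embedded into C[lambda][u]. *)
Definition embC : C -> {poly {poly C}} := fun a => a%:P%:P.

Definition lambdaV : {poly {poly C}} := ('X : {poly C})%:P.

Definition uV : {poly {poly C}} := 'X.

Definition lift_f (f : {poly {poly C}}) : {poly {poly {poly {poly C}}}} :=
  map_poly (map_poly embC) f.

(* Res_y (f - lambda, f'_y - u) in C[lambda][u][x] *)
Definition Qres (f : {poly {poly C}}) : {poly {poly {poly C}}} :=
  resultant (lift_f f - lambdaV%:P%:P) (lift_f (dy f) - uV%:P%:P).

Definition Qdeg (f : {poly {poly C}}) : nat := (size (Qres f)).-1.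

(* Q = Q_0 x^N + ... + Q_N *)
Definition Qcoef (f : {poly {poly C}}) (i : nat) : {poly {poly C}} :=
  (Qres f)`_(Qdeg f - i).

(* Q_i(l, u) as a polynomial in u *)
Definition at_lambda (l : C) (q : {poly {poly C}}) : {poly C} :=
  map_poly (fun p : {poly C} => p.[l]) q.

(* max_{1 <= i <= N} deg_u Q_i(lambda, u) / i, equal to -oo when N = 0 *)
Definition slope (f : {poly {poly C}}) : \bar R :=
  \big[Order.max/-oo%E]_(1 <= i < (Qdeg f).+1)
    (pdeg (Qcoef f i) / (i%:R : R)%:E)%E.

(* the same maximum for the specializations Q_i(l, u) *)
Definition slope_at (f : {poly {poly C}}) (l : C) : \bar R :=
  \big[Order.max/-oo%E]_(1 <= i < (Qdeg f).+1)
    (pdeg (at_lambda l (Qcoef f i)) / (i%:R : R)%:E)%E.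

End Lojasiewicz.

(* Main.v *)
(* The exponents are compared through finitely many curves.  A truncated
   Newton-Puiseux factorization of f - l provides branches x = t^D, y = y_i(t),
   with y_i a Laurent polynomial, along which f - l is as small as we like and
   such that every point of the fibre is as close as we like to a branch.  The
   branches compete in the definition of the exponent near the fibre and compute
   the exponent on the fibre, whence the inequality <= between the two.

   Call l critical (at infinity) if f(x, c) - l is not bounded away from 0 at
   the critical points c of f(x, .) as x tends to infinity.

   - A branch of f'_y = 0 whose values f tend to l has f'_y negligible, and
     differentiating f - l along it bounds f'_x: for l critical, the exponent near
     the fibre is < -1.  There are finitely many such branches and each determines
     at most one critical l.
   - If l is not critical, a mean value inequality towards the nearest critical
     point shows that near a point where f - l is small there is a point of the
     fibre with comparable f'_y; as f'_x = isO(f'_y) on the fibre, the exponents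
     agree.
   - If the exponent near the fibre is finite and < -1, a branch attaining it
     could be replaced by a branch of f'_y = 0 passing near it with a smaller
     exponent, so the exponent on the fibre is larger.  If it is -oo, then so is
     the exponent on the fibre: f - l is controlled by its derivative along a
     curve, so that a curve with very small gradient is very close to the fibre.

   The last alternative in the theorem never occurs.  If the exponent d near the
   fibre is positive then l is not critical, the roots u of Q(x, lambda, u) are of
   order at least |x|^d uniformly for lambda near l, and Q(x, lambda, 0) has the
   same order as Q(x, l, 0), so both maxima of slopes are equal to 1/d. *)
Require Import Defs.
From mathcomp Require Import ring lra zify.
Import Order.TTheory GRing.Theory Num.Theory.
Import numFieldNormedType.Exports.
Local Open Scope classical_set_scope.
Local Open Scope ring_scope.
Set Implicit Arguments.
Unset Strict Implicit.
Unset Printing Implicit Defensive.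

(** * Approximate Newton-Puiseux factorization *)

(** Everything is done with finite precision, so no convergent Puiseux series is needed: Hensel's
    lemma and the Newton polygon are used modulo a power of s = 1/x, and the remainder is estimated.
    The price is an order of choices. The ramification D is known only once the precision is fixed,
    so precision is measured in x: errors are O(|x|^-K), that is O(|t|^-(K D)) for x = t^D. K is
    chosen first, from the target exponent and from Lipschitz exponents that do not depend on the
    branches.

    Two devices recur. The competing curves are arbitrary meromorphic pairs, but only Laurent
    polynomials are differentiated, where this is algebraic; other curves are truncated first.
    Points of the fibre or critical points over a curve are chosen pointwise and need have no
    expansion; for them only the one-sided bounds [isO] and [isOmega] are used. For meromorphic
    functions the orders are integers, so the failure of one bound gives the other with a definite
    gap. *)

Lemma eq0_horner0_divX (F : fieldType) (P : {poly {poly F}}) :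
  map_poly (horner_eval 0) P = 0 -> exists Q, P = 'X%:P * Q.
Proof.
move=> P0; exists (map_poly (fun p : {poly F} => p %/ 'X) P).
apply/polyP=> i; rewrite coefCM coef_map_id0 ?div0p //.
rewrite mulrC divpK // -['X]subr0 -polyC0 dvdp_XsubCl rootE.
by have /eqP := congr1 (fun p : {poly F} => p`_i) P0; rewrite coef_map coef0.
Qed.

(** The size bounds on both cofactors let the Hensel corrections leave the leading terms alone.
    Reducing [z * e] modulo [a] bounds [u]; the bound on [v] then follows by counting degrees. *)
Lemma coprimep_solve (F : fieldType) (a b e : {poly F}) :
  coprimep a b -> a != 0 -> b != 0 -> (size e < (size a + size b).-1)%N ->
  exists u v, [/\ e = a * v + b * u, (size u < size a)%N & (size v < size b)%N].
Proof.
move=> /Bezout_eq1_coprimepP [[w z] /= wz] a0 b0 se.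
pose u := (z * e) %% a.
have /dvdpP [v Hv] : a %| e - b * u.
  have -> : e - b * u = a * (w * e + b * ((z * e) %/ a)).
    have -> : u = z * e - (z * e) %/ a * a by rewrite {1}(divp_eq (z * e) a) addrC addKr.
    by rewrite -{1}[e]mul1r -wz; ring.
  exact: dvdp_mulr.
exists u, v; split; first by rewrite [a * v]mulrC -Hv subrK.
  by rewrite ltn_modp.
have [->|v0] := eqVneq v 0; first by rewrite size_poly0 size_poly_gt0.
have : (size (e - b * u)%R <= maxn (size e) (size (b * u)%R))%N.
  by apply: leq_trans (size_polyD _ _) _; rewrite size_polyN.
rewrite Hv size_mul // => H.
have su : (size u < size a)%N by rewrite ltn_modp.
have := size_polyMleq b u.
move: a0 b0; rewrite -!size_poly_gt0; move: H su se.
move: (size _) (size _) (size _) (size _) (size _) (size _) => *; lia.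
Qed.

Lemma hensel_approx (F : fieldType) (P : {poly {poly F}}) (a b : {poly F})
    (k : nat) :
  P \is monic -> a \is monic -> b \is monic -> coprimep a b ->
  map_poly (horner_eval 0) P = a * b ->
  exists A B E, [/\ A \is monic, B \is monic, size A = size a,
     size B = size b & P = A * B + ('X^k)%:P * E].
Proof.
move=> Pm am bm cab P0.
(* The induction starts from the given factorization at 0, so it carries precision k+1 together with
   the reductions of both factors. *)
suff [A [B [E [H1 H2 H3 [H4 H5 H6] H7]]]] : exists A B E,
  [/\ A \is monic, B \is monic, size A = size a,
    [/\ size B = size b, map_poly (horner_eval 0) A = a
      & map_poly (horner_eval 0) B = b] & P = A * B + ('X^(k.+1))%:P * E].
  exists A, B, ('X%:P * E); split=> //.
  by rewrite H7 exprSr polyCM mulrA.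
have a0 := monic_neq0 am; have b0 := monic_neq0 bm.
have sP : size P = (size a + size b).-1.
  rewrite -size_mul // -P0 size_map_poly_id0 // (eqP Pm) /horner_eval hornerC.
  exact: oner_neq0.
(* Monic polynomials of equal size cancel at the top, so the remainder has smaller degree and is
   within reach of [coprimep_solve]. *)
have XE (n : nat) (A B E : {poly {poly F}}) :
   A \is monic -> B \is monic -> size A = size a -> size B = size b ->
   P = A * B + ('X^n)%:P * E -> (size E < size P)%N.
  move=> Am Bm sA sB HP.
  have sAB : size (A * B) = size P.
    by rewrite size_mul ?monic_neq0 // sA sB.
  have P_gt0 : (0 < size P)%N by rewrite size_poly_gt0 monic_neq0.
  have -> : size E = size (P - A * B).
    by rewrite HP addrC addKr size_Cmul // expf_neq0 // polyX_eq0.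
  rewrite -(ltn_predK P_gt0) ltnS; apply/leq_sizeP => j Hj.
  rewrite coefB; have [Hj2|Hj2] := leqP (size P) j.
    by rewrite !nth_default ?subrr // sAB.
  have -> : j = (size P).-1 by lia.
  have -> : P`_(size P).-1 = 1 by exact: (eqP Pm).
  have : A * B \is monic by rewrite monicMr.
  by rewrite monicE /lead_coef sAB => /eqP ->; rewrite subrr.
have for_large_lift (p : {poly F}) : map_poly (horner_eval 0) (map_poly polyC p) = p.
  by apply/polyP => i; rewrite !coef_map /= /horner_eval hornerC.
elim: k => [|k [A [B [E [Am Bm sA [sB evA evB] HP]]]]].
  have : map_poly (horner_eval 0) (P - map_poly polyC a * map_poly polyC b) = 0.
    by rewrite rmorphB rmorphM /= !for_large_lift P0 subrr.
  case/eq0_horner0_divX => E HE.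
  exists (map_poly polyC a), (map_poly polyC b), E; split.
  - exact: monic_map.
  - exact: monic_map.
  - by rewrite size_map_polyC.
  - by split; rewrite ?size_map_polyC ?for_large_lift.
  - by rewrite expr1 -HE addrC subrK.
have sE := XE _ _ _ _ Am Bm sA sB HP.
have [|u [v [He su sv]]] := @coprimep_solve F a b
    (map_poly (horner_eval 0) E) cab a0 b0.
  by rewrite -sP; apply: leq_ltn_trans sE; exact: size_poly.
(* This is the new error, divided by X^(k+1), once X^(k+1) u is added to A and X^(k+1) v to B. At 0
   the linear part cancels by the choice of u and v, and the quadratic part carries a spare factor
   X. *)
have : map_poly (horner_eval 0) (E - A * map_poly polyC v - B * map_poly polyC u
   - 'X%:P * ('X^k%:P * map_poly polyC u * map_poly polyC v)) = 0.
  rewrite !rmorphB !rmorphM /= evA evB !for_large_lift He.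
  rewrite [map_poly _ 'X%:P]map_polyC /= /horner_eval hornerX mul0r subr0.
  ring.
case/eq0_horner0_divX => E' HE'.
pose c : {poly {poly F}} := ('X^(k.+1))%:P.
have c0 : 'X^(k.+1) != 0 :> {poly F} by rewrite expf_neq0 // polyX_eq0.
have szA : (size (c * map_poly polyC u)%R < size A)%N.
  by rewrite /c size_Cmul // size_map_polyC sA.
have szB : (size (c * map_poly polyC v)%R < size B)%N.
  by rewrite /c size_Cmul // size_map_polyC sB.
have evc : map_poly (horner_eval 0) c = 0.
  by rewrite /c map_polyC /= /horner_eval hornerXn expr0n /= polyC0.
exists (A + c * map_poly polyC u), (B + c * map_poly polyC v), E'; split.
- by rewrite monicE lead_coefDl //; exact: Am.
- by rewrite monicE lead_coefDl //; exact: Bm.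
- by rewrite size_polyDl.
- by split; rewrite ?size_polyDl // !rmorphD rmorphM /= evc mul0r addr0.
rewrite HP -/c.
have -> : E = 'X%:P * E' + A * map_poly polyC v + B * map_poly polyC u
   + 'X%:P * ('X^k%:P * map_poly polyC u * map_poly polyC v).
  by rewrite -HE'; ring.
have -> : ('X^(k.+2))%:P = c * 'X%:P :> {poly {poly F}} by rewrite /c -polyCM -exprSr.
have -> : c = 'X^k%:P * 'X%:P :> {poly {poly F}} by rewrite /c -polyCM -exprSr.
ring.
Qed.

Definition ramify (F : fieldType) (D : nat) (P : {poly {poly F}}) :=
  map_poly (comp_poly 'X^D) P.

(** The error X^(K D) in the ramified variable stands for x^K, so K keeps its meaning whatever D
    turns out to be. *)
Definition approx_split (F : fieldType) (K : nat) (P : {poly {poly F}}) :=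
  exists D (q : seq {poly F}) E,
    [/\ (0 < D)%N, (size q).+1 = size P &
      ramify D P = \prod_(c <- q) ('X - c%:P) + ('X^(K * D))%:P * E].

Lemma ramifyM (F : fieldType) D (P Q : {poly {poly F}}) :
  ramify D (P * Q) = ramify D P * ramify D Q.
Proof. exact: rmorphM. Qed.
Lemma ramifyD (F : fieldType) D (P Q : {poly {poly F}}) :
  ramify D (P + Q) = ramify D P + ramify D Q.
Proof. exact: rmorphD. Qed.
Lemma ramifyC (F : fieldType) D (c : {poly F}) :
  ramify D c%:P = (c \Po 'X^D)%:P.
Proof. by rewrite /ramify map_polyC. Qed.
Lemma ramifyX (F : fieldType) D : ramify D 'X = 'X :> {poly {poly F}}.
Proof. exact: map_polyX. Qed.
Lemma comp_Xn_Xn (F : fieldType) D k : 'X^k \Po 'X^D = 'X^(D * k) :> {poly F}.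
Proof. by rewrite comp_Xn_poly exprM. Qed.
Lemma ramify_exp (F : fieldType) D (P : {poly {poly F}}) k :
  ramify D (P ^+ k) = ramify D P ^+ k.
Proof. exact: rmorphXn. Qed.
Lemma ramify_comp (F : fieldType) D (P Q : {poly {poly F}}) :
  ramify D (P \Po Q) = ramify D P \Po ramify D Q.
Proof. exact: map_comp_poly. Qed.
Lemma ramify_ramify (F : fieldType) D e (P : {poly {poly F}}) :
  ramify D (ramify e P) = ramify (e * D) P.
Proof.
apply/polyP => i; rewrite !coef_map /= -comp_polyA comp_Xn_Xn.
by rewrite mulnC.
Qed.
Lemma ramify_prod (F : fieldType) D (q : seq {poly F}) :
  ramify D (\prod_(c <- q) ('X - c%:P)) =
  \prod_(c <- map (comp_poly 'X^D) q) ('X - c%:P).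
Proof.
rewrite big_map /ramify rmorph_prod /=; apply: eq_bigr => c _.
by rewrite rmorphB /= map_polyX map_polyC.
Qed.

Lemma size_ramify (F : fieldType) e (P : {poly {poly F}}) :
  (0 < e)%N -> size (ramify e P) = size P.
Proof.
move=> e_gt0; rewrite /ramify size_map_inj_poly ?comp_poly0 //.
apply: raddf_inj => p p0; have := size_comp_poly p 'X^e.
rewrite p0 size_poly0 size_polyXn => /esym/eqP.
rewrite muln_eq0 [e.+1.-1 == 0%N]eqn0Ngt e_gt0 orbF => /eqP s1.
have sp : (size p <= 1)%N by move: s1; case: (size p) => // n /= ->.
by move: p0 => /=; rewrite (size1_polyC sp) comp_polyC.
Qed.

Lemma approx_splitM (F : fieldType) K (P Q : {poly {poly F}}) :
  approx_split K P -> approx_split K Q -> approx_split K (P * Q).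
Proof.
move=> [D1 [q1 [E1 [D1_gt0 s1 H1]]]] [D2 [q2 [E2 [D2_gt0 s2 H2]]]].
exists (D1 * D2)%N.
exists (map (comp_poly 'X^D2) q1 ++ map (comp_poly 'X^D1) q2).
set A1 := \prod_(c <- map (comp_poly 'X^D2) q1) ('X - c%:P).
set A2 := \prod_(c <- map (comp_poly 'X^D1) q2) ('X - c%:P).
set X := ('X^(K * (D1 * D2)))%:P : {poly {poly F}}.
exists (A1 * ramify D1 E2 + A2 * ramify D2 E1 + X * ramify D2 E1 * ramify D1 E2).
have H1' : ramify (D1 * D2) P = A1 + X * ramify D2 E1.
  rewrite -ramify_ramify H1 ramifyD ramifyM ramify_prod ramifyC comp_Xn_Xn.
  by rewrite /X; congr (_ + ('X^_)%:P * _); lia.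
have H2' : ramify (D1 * D2) Q = A2 + X * ramify D1 E2.
  rewrite mulnC -ramify_ramify H2 ramifyD ramifyM ramify_prod ramifyC.
  by rewrite comp_Xn_Xn /X; congr (_ + ('X^_)%:P * _); lia.
split.
- by rewrite muln_gt0 D1_gt0.
- rewrite size_cat !size_map size_mul -?size_poly_gt0 -?s1 -?s2 //.
  by rewrite addSn addnS.
- by rewrite ramifyM H1' H2' big_cat /= -/A1 -/A2; ring.
Qed.

Lemma approx_split_add (F : fieldType) K (P E : {poly {poly F}}) :
  size (P + 'X^K%:P * E) = size P ->
  approx_split K P -> approx_split K (P + 'X^K%:P * E).
Proof.
move=> sP [D [q [E1 [D0 s1 H1]]]]; exists D, q, (E1 + ramify D E); split=> //.
  by rewrite sP.
by rewrite ramifyD H1 ramifyM ramifyC comp_Xn_Xn [(K * D)%N]mulnC; ring.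
Qed.

Lemma approx_split_shift (F : fieldType) K (c : {poly F}) (P : {poly {poly F}}) :
  approx_split K (P \Po ('X + c%:P)) -> approx_split K P.
Proof.
move=> [D [q [E [D_gt0 sq HP]]]].
pose c' : {poly F} := c \Po 'X^D.
exists D, (map (fun p => p + c') q), (E \Po ('X - c'%:P)); split=> //.
  by rewrite size_map sq size_comp_poly2 // size_XaddC.
have HPc : ramify D (P \Po ('X + c%:P)) = ramify D P \Po ('X + c'%:P).
  by rewrite /ramify map_comp_poly rmorphD /= map_polyX map_polyC.
have -> : ramify D P = ramify D P \Po ('X + c'%:P) \Po ('X - c'%:P).
  by rewrite -comp_polyA comp_polyD comp_polyX comp_polyC subrK comp_polyXr.
rewrite -HPc HP comp_polyD comp_polyM comp_polyC; congr (_ + _).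
rewrite big_map rmorph_prod /=; apply: eq_bigr => a _.
by rewrite comp_polyB comp_polyX comp_polyC polyCD opprD addrA addrAC.
Qed.

Lemma approx_split_ramify (F : fieldType) K e (P : {poly {poly F}}) :
  (0 < e)%N -> approx_split (K * e) (ramify e P) -> approx_split K P.
Proof.
move=> e_gt0 [D [q [E [D_gt0 sq HP]]]].
exists (e * D)%N, q, E; split; first by rewrite muln_gt0 e_gt0.
  by rewrite sq size_ramify.
by rewrite -ramify_ramify HP mulnA.
Qed.

Lemma approx_split_scale (F : fieldType) K p (P Q : {poly {poly F}}) :
  size P = size Q ->
  P \Po ('X^p%:P * 'X) = ('X^p%:P) ^+ (size P).-1 * Q ->
  approx_split K Q -> approx_split K P.
Proof.
move=> sPQ HPQ [D [q [E [D_gt0 sq HQ]]]].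
pose c : {poly F} := 'X^(D * p).
have c0 : c != 0 by rewrite expf_neq0 // polyX_eq0.
have Pq : (size P).-1 = size q by rewrite sPQ -sq.
have HP : ramify D P \Po (c%:P * 'X) = c%:P ^+ size q * ramify D Q.
  have := congr1 (ramify D) HPQ.
  by rewrite ramify_comp !ramifyM ramify_exp ramifyX ramifyC comp_Xn_Xn Pq.
(* The roots of P are c times those of Q, so the error must be homogenized by powers of c. The
   exponents are nonnegative because, by [sE], the error has degree at most that of Q. *)
pose E' : {poly {poly F}} := \poly_(i < (size q).+1) (E`_i * c ^+ (size q - i)).
have sE : (size E <= (size q).+1)%N.
  have X0 : 'X^(K * D) != 0 :> {poly F} by rewrite expf_neq0 // polyX_eq0.
  have -> : size E = size ('X^(K * D)%:P * E) by rewrite size_Cmul.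
  have -> : 'X^(K * D)%:P * E = ramify D Q - \prod_(c <- q) ('X - c%:P).
    by rewrite HQ addrC addKr.
  apply: leq_trans (size_polyD _ _) _; rewrite size_polyN size_prod_XsubC.
  by rewrite size_ramify // -sq maxnn.
have HE' : E' \Po (c%:P * 'X) = c%:P ^+ size q * E.
  have -> : E = \poly_(i < (size q).+1) E`_i.
    apply/polyP => i; rewrite coef_poly; case: ltnP => // Hi.
    by rewrite nth_default // (leq_trans sE).
  rewrite /E' !poly_def linear_sum /= mulr_sumr; apply: eq_bigr => i _.
  rewrite comp_polyZ comp_Xn_poly exprMn -!mul_polyC polyCM !polyC_exp.
  have Hq : (i <= size q)%N by rewrite -ltnS.
  have -> : 'X%:P ^+ (D * p) ^+ size q
     = 'X%:P ^+ (D * p) ^+ (size q - i) * 'X%:P ^+ (D * p) ^+ i :> {poly {poly F}}.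
    by rewrite -exprD subnK.
  ring.
exists D, (map (fun a => c * a) q), E'; split=> //.
  by rewrite size_map sq sPQ.
have cX : size (c%:P * 'X) = 2%N by rewrite size_Cmul // size_polyX.
(* Substituting c y for y is injective, so the identity may be checked after it. *)
apply/eqP; rewrite -subr_eq0 -(comp_poly2_eq0 _ (q := c%:P * 'X)) ?cX //.
rewrite comp_polyB comp_polyD comp_polyM comp_polyC HP HE' HQ subr_eq0.
apply/eqP; rewrite mulrDr mulrCA; congr (_ + _).
have -> : c%:P ^+ size q = \prod_(a <- q) c%:P.
  by rewrite big_const_seq count_predT iter_mulr_1.
rewrite big_map rmorph_prod /= -big_split /=.
apply: eq_bigr => a _.
by rewrite comp_polyB comp_polyX comp_polyC mulrBr polyCM.
Qed.

Lemma coef_XaddC_exp (F : comNzRingType) (c : F) n j :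
  (('X + c%:P) ^+ n)`_j = c ^+ (n - j) *+ 'C(n, j).
Proof.
rewrite addrC exprDn.
rewrite (eq_bigr (fun i : 'I_n.+1 => (c ^+ (n - i) *+ 'C(n, i)) *: 'X^i)); last first.
  by move=> i _; rewrite -polyC_exp mul_polyC scalerMnl.
rewrite -(poly_def n.+1 (fun i => c ^+ (n - i) *+ 'C(n, i))) coef_poly.
by case: ltnP => // Hj; rewrite bin_small.
Qed.

Lemma coef_comp_CX (F : comNzRingType) (c : F) (p : {poly F}) i :
  (p \Po (c%:P * 'X))`_i = c ^+ i * p`_i.
Proof.
rewrite comp_polyE.
rewrite (eq_bigr (fun i : 'I_(size p) => (c ^+ i * p`_i) *: 'X^i)); last first.
  by move=> j _; rewrite exprMn -polyC_exp mul_polyC scalerA mulrC.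
rewrite -(poly_def (size p) (fun i => c ^+ i * p`_i)) coef_poly.
by case: ltnP => // Hi; rewrite nth_default ?mulr0.
Qed.

Lemma mup0_factor (F : fieldType) (p : {poly F}) : p != 0 ->
  exists2 p', p = 'X^(mup 0 p) * p' & p'.[0] != 0.
Proof.
move=> p0; have [p' pE] : exists p', p = p' * 'X^(mup 0 p).
  by apply/dvdpP; rewrite -['X]subr0 -polyC0 -mup_geq.
exists p'; first by rewrite mulrC.
apply: contraTneq (leqnn (mup 0 p)) => p'0; rewrite -ltnNge mup_geq //.
have : 'X %| p' by rewrite -['X]subr0 -polyC0 dvdp_XsubCl rootE p'0.
by case/dvdpP => r rE; rewrite subr0 exprS [X in _ %| X]pE rE -mulrA dvdp_mulIr.
Qed.

(* After the Tschirnhaus shift the subleading coefficient vanishes, so the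
   initial form reached by rescaling is not a pure power of a linear form and
   splits into coprime factors of smaller degree. *)
Lemma approx_puiseux (F : closedFieldType) (hF : [pchar F] =i pred0) K
    (P : {poly {poly F}}) :
  P \is monic -> approx_split K P.
Proof.
have [m] := ubnP (size P); elim: m P K => // m IH P K sPm Pm.
have [s1|s1] := leqP (size P) 1.
  have -> : P = 1.
    have := size1_polyC s1 => PE; move: Pm; rewrite PE monicE lead_coefC.
    by move=> /eqP ->.
  exists 1%N, [::], 0; split=> //; first by rewrite size_poly1.
  by rewrite big_nil mulr0 addr0 /ramify rmorph1.
have [n sP] : exists n, size P = n.+2.
  by case: (size P) s1 => // -[//|n] _; exists n.
have n0 k : k.+1%:R != 0 :> F by rewrite ((pcharf0P _).1 hF).
pose c : {poly F} := - (n.+1%:R^-1) *: P`_n.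
apply: (@approx_split_shift _ _ c).
set Q := P \Po ('X + c%:P).
have sQ : size Q = n.+2 by rewrite size_comp_poly2 // size_XaddC.
have Pn : P`_n.+1 = 1 by have /eqP := Pm; rewrite lead_coefE sP.
have Qn : Q`_n.+1 = 1.
  rewrite coef_comp_poly sP big_ord_recr /= big1 ?add0r => [|i _]; last first.
    by rewrite coef_XaddC_exp bin_small ?mulr0.
  by rewrite coef_XaddC_exp binn subnn expr0 mulr1 Pn.
have Qn1 : Q`_n = 0.
  rewrite coef_comp_poly sP !big_ord_recr /= big1 ?add0r => [|i _]; last first.
    by rewrite coef_XaddC_exp bin_small ?mulr0.
  rewrite !coef_XaddC_exp binn subnn expr0 mulr1 subSnn expr1 binSn Pn mul1r.
  by rewrite /c -scaler_nat scalerA mulrN mulfV // scaleN1r addrN.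
have Qm : Q \is monic by rewrite monicE lead_coefE sQ Qn.
have [Q0|] := boolP [forall i : 'I_n.+1, Q`_i == 0].
  have -> : Q = 'X^(n.+1).
    apply/polyP => i; rewrite coefXn; have [->//|ni] := eqVneq i n.+1.
    have [Hi|Hi] := leqP i n; first by have /forallP/(_ (Ordinal (Hi : i < n.+1)%N))/eqP := Q0.
    by rewrite nth_default // sQ ltn_neqAle eq_sym ni.
  exists 1%N, (nseq n.+1 0), 0; split=> //; first by rewrite size_nseq size_polyXn.
  rewrite mulr0 addr0 ramify_exp ramifyX big_nseq subr0 iter_mulr_1 //.
rewrite negb_forall => /existsP [i1 Hi1].
pose o i := mup 0 Q`_i.
(* Slopes of the Newton polygon seen from the vertex y^(n+1). The least one is p / e, not
   necessarily in lowest terms, attained at [i0]. *)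
pose w (i : 'I_n.+1) : rat := (o i)%:R / (n.+1 - i)%:R.
case: (@arg_minP _ _ _ i1 (fun i : 'I_n.+1 => Q`_i != 0) w Hi1) => i0 Hi0 wmin.
pose e := (n.+1 - i0)%N; pose p := o i0.
have e_gt0 : (0 < e)%N by rewrite subn_gt0.
apply: (approx_split_ramify e_gt0).
have omin (i : 'I_n.+1) : Q`_i != 0 -> (p * (n.+1 - i) <= e * o i)%N.
  move=> /wmin; rewrite /w ler_pdivrMr ?ltr0n // mulrAC ler_pdivlMr ?ltr0n ?subn_gt0 //.
  by rewrite -!natrM ler_nat -/e -/p [(o i * e)%N]mulnC.
(* Coefficients after x -> x^e, y -> x^p y and division by x^(p (n+1)); minimality of the slope
   makes the division exact. *)
pose b i : {poly F} := (Q`_i \Po 'X^e) %/ 'X^(p * (n.+1 - i)).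
have bE i : (i <= n.+1)%N -> Q`_i \Po 'X^e = 'X^(p * (n.+1 - i)) * b i.
  rewrite mulrC /b leq_eqVlt => /orP [/eqP ->|Hi].
    by rewrite subnn muln0 expr0 divp1 mulr1.
  rewrite divpK //; have [->|Qi0] := eqVneq Q`_i 0; first by rewrite comp_poly0 dvdp0.
  have [r rE _] := mup0_factor Qi0.
  rewrite rE comp_polyM comp_Xn_Xn dvdp_mulr // dvdp_exp2l //.
  exact: (omin (Ordinal Hi)).
pose P1 : {poly {poly F}} := \poly_(i < n.+2) b i.
have bn : b n.+1 = 1 by have := bE _ (leqnn _); rewrite Qn subnn muln0 mul1r rmorph1.
have sP1 : size P1 = n.+2 by rewrite size_poly_eq // bn oner_neq0.
have P1m : P1 \is monic by rewrite monicE lead_coefE sP1 coef_poly ltnSn bn.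
apply: (@approx_split_scale _ _ p _ P1).
- by rewrite size_ramify // sQ.
- rewrite size_ramify // sQ; apply/polyP => i.
  rewrite coef_comp_CX -polyC_exp coefCM [(ramify e Q)`_i]coef_map [P1`_i]coef_poly /=.
  case: ltnP => [Hi|Hi]; last by rewrite nth_default ?comp_poly0 ?mulr0 ?sQ.
  rewrite bE // mulrA -!exprM -exprD -mulnDr subnKC //.
pose P0 := map_poly (horner_eval 0) P1.
have P0E i : (i <= n.+1)%N -> P0`_i = (b i).[0].
  by move=> Hi; rewrite coef_map coef_poly ltnS Hi.
have P0n : P0`_n = 0.
  rewrite P0E //; have := bE n (leqnSn n); rewrite Qn1 comp_poly0 => /esym/eqP.
  by rewrite mulf_eq0 expf_eq0 polyX_eq0 andbF /= => /eqP ->; rewrite horner0.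
have P0i : P0`_i0 != 0.
  rewrite P0E; last exact: ltnW.
  have [r rE r0] := mup0_factor Hi0; have := bE i0 (ltnW (ltn_ord i0)).
  rewrite {1}rE comp_polyM comp_Xn_Xn -/(o i0) -/p -/e mulnC => /mulfI <-; last first.
    by rewrite expf_neq0 // polyX_eq0.
  by rewrite horner_comp hornerXn expr0n [e == 0%N]eqn0Ngt e_gt0.
have P0m : P0 \is monic by rewrite monic_map.
have sP0 : size P0 = n.+2 by rewrite size_map_poly_id0 // (eqP P1m) rmorph1 oner_neq0.
have /closed_rootP [a ra] : size P0 != 1%N by rewrite sP0.
have [k [B /implyP/(_ (monic_neq0 P0m)) Ba BE]] := multiplicity_XsubC P0 a.
have B0 : B != 0 by apply: contraNneq Ba => ->; rewrite root0.
have Bm : B \is monic by move: P0m; rewrite BE monicMr // monic_exp // monicXsubC.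
have k_gt0 : (0 < k)%N.
  by case: k BE => // BE; move: ra Ba; rewrite BE expr0 mulr1 => ->.
have sB : (size B + k = n.+2)%N.
  by rewrite -sP0 BE size_mul ?monic_neq0 ?monic_exp ?monicXsubC // size_exp_XsubC addnS.
(* Otherwise the initial form is (y - a)^(n+1). Its coefficient of y^n vanishes, so a = 0 in
   characteristic 0, against the nonzero coefficient at [i0]. *)
have sB2 : (1 < size B)%N.
  rewrite ltnNge; apply/negP => sB1.
  have B1 : B = 1.
    have := size1_polyC sB1 => BC; move: Bm; rewrite BC monicE lead_coefC.
    by move=> /eqP ->.
  have kE : k = n.+1 by move: sB; rewrite B1 size_poly1 add1n => -[].
  move: BE; rewrite B1 mul1r kE -['X - _]/('X + - a%:P) -polyCN => BE.
  move: P0n; rewrite BE coef_XaddC_exp subSnn expr1 binSn -mulr_natl => /eqP.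
  rewrite mulf_eq0 (negPf (n0 _)) oppr_eq0 /= => /eqP a0.
  move: P0i; rewrite BE a0 coef_XaddC_exp oppr0 expr0n subn_eq0 leqNgt ltn_ord.
  by rewrite mul0rn eqxx.
have [||||A [B' [E [Am B'm sA sB' P1E]]]] :=
  @hensel_approx _ P1 (('X - a%:P) ^+ k) B (K * e) P1m.
- by rewrite monic_exp // monicXsubC.
- exact: Bm.
- by rewrite coprimep_expl // coprimep_sym coprimep_XsubC.
- by rewrite mulrC -BE.
rewrite P1E; apply: approx_split_add.
  by rewrite -P1E sP1 size_mul ?monic_neq0 // sA sB' size_exp_XsubC addSn addnC sB.
move: sPm; rewrite sP => sPm.
apply: approx_splitM; apply: IH => //.
  rewrite sA size_exp_XsubC -ltnS; apply: leq_ltn_trans sPm.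
  by rewrite -sB -[k.+2]add2n leq_add2r.
by rewrite sB' -ltnS; apply: leq_ltn_trans sPm; rewrite -sB -addn1 leq_add2l.
Qed.

(** * Growth at infinity *)

Arguments cmod : simpl never.

Section Modulus.
Variable R : realType.
Local Notation C := R[i].
Implicit Types (x y z t : C).

Lemma cmod_normE z : `|z| = (cmod z)%:C%C.
Proof. by case: z => a b; rewrite normc_def. Qed.
Lemma cmodM x y : cmod (x * y) = cmod x * cmod y.
Proof. exact: ComplexField.Normc.normcM. Qed.
Lemma cmodD x y : cmod (x + y) <= cmod x + cmod y.
Proof. exact: le_normcD. Qed.
Lemma cmodN x : cmod (- x) = cmod x.
Proof. exact: normcN. Qed.
Lemma cmodV x : cmod x^-1 = (cmod x)^-1.
Proof. exact: ComplexField.Normc.normcV. Qed.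
Lemma cmod0 : cmod (0 : C) = 0.
Proof. exact: ComplexField.Normc.normc0. Qed.
Lemma cmod1 : cmod (1 : C) = 1.
Proof. exact: ComplexField.Normc.normc1. Qed.
Lemma cmod_ge0 x : 0 <= cmod x.
Proof. by case: x => a b; exact: sqrtr_ge0. Qed.
Lemma cmod_eq0 x : (cmod x == 0) = (x == 0).
Proof.
by apply/eqP/eqP => [/ComplexField.Normc.eq0_normc //|->]; exact: cmod0.
Qed.
Lemma cmod_gt0 x : (0 < cmod x) = (x != 0).
Proof. by rewrite lt_neqAle cmod_ge0 andbT eq_sym cmod_eq0. Qed.
Lemma cmodB x y : cmod (x - y) <= cmod x + cmod y.
Proof. by rewrite -[cmod y]cmodN; exact: cmodD. Qed.
Lemma cmod_dist x y : cmod (x - y) = cmod (y - x).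
Proof. by rewrite -cmodN opprB. Qed.
Lemma cmod_le_dist x y : cmod x <= cmod y + cmod (x - y).
Proof. by rewrite -{1}(subrK y x) addrC cmodD. Qed.
Lemma cmodX x n : cmod (x ^+ n) = cmod x ^+ n.
Proof. by elim: n => [|n IH]; rewrite ?expr0 ?cmod1 // !exprS cmodM IH. Qed.
Lemma cmod_exprz x (k : int) : cmod (x ^ k) = cmod x ^ k.
Proof.
case: k => n; first exact: cmodX.
by rewrite /exprz cmodV cmodX.
Qed.
Lemma cmod_natr n : cmod (n%:R : C) = n%:R.
Proof.
have /eqP := cmod_normE n%:R; rewrite normr_nat eq_complex /=.
by case/andP => /eqP <- _; rewrite -(rmorph_nat (@real_complex R)) .
Qed.
Lemma cmod_real (r : R) : cmod (r%:C)%C = `|r|.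
Proof. by rewrite /cmod /= expr0n /= addr0 sqrtr_sqr. Qed.
Lemma cmod_prod (I : Type) (s : seq I) (F : I -> C) :
  cmod (\prod_(i <- s) F i) = \prod_(i <- s) cmod (F i).
Proof.
by elim: s => [|i s IH]; rewrite ?big_nil ?cmod1 // !big_cons cmodM IH.
Qed.
Lemma cmod_sum (I : Type) (s : seq I) (P : pred I) (F : I -> C) :
  cmod (\sum_(i <- s | P i) F i) <= \sum_(i <- s | P i) cmod (F i).
Proof.
elim: s => [|i s IH]; rewrite ?big_nil ?cmod0 // !big_cons.
by case: ifP => // _; apply: le_trans (cmodD _ _) _; rewrite lerD2l.
Qed.

End Modulus.

Section Growth.
Variable R : realType.
Local Notation C := R[i].

Definition for_large (P : C -> Prop) := exists B : R, forall t, B < cmod t -> P t.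

Lemma for_large_mono (P Q : C -> Prop) : (forall t, P t -> Q t) -> for_large P -> for_large Q.
Proof. by move=> PQ [B HB]; exists B => t /HB /PQ. Qed.
Lemma for_large_and (P Q : C -> Prop) : for_large P -> for_large Q -> for_large (fun t => P t /\ Q t).
Proof.
move=> [B1 H1] [B2 H2]; exists (Num.max B1 B2) => t.
by rewrite gt_max => /andP [/H1 ? /H2].
Qed.
Lemma for_large_mono2 (P1 P2 Q : C -> Prop) :
  (forall t, P1 t -> P2 t -> Q t) -> for_large P1 -> for_large P2 -> for_large Q.
Proof. by move=> H H1 H2; apply: for_large_mono (for_large_and H1 H2) => t []; exact: H. Qed.
Lemma for_large_true (P : C -> Prop) : (forall t, P t) -> for_large P.
Proof. by exists 0. Qed.
Lemma for_large_gt (B : R) : for_large (fun t => B < cmod t).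
Proof. by exists B. Qed.
(** Merges the constants obtained branch by branch into one constant for all branches. *)
Lemma for_large_seq_min (I : eqType) (s : seq I) (P : I -> R -> C -> Prop) :
  (forall i a b t, 0 < b -> b <= a -> P i a t -> P i b t) ->
  (forall i, i \in s -> exists2 a : R, 0 < a & for_large (P i a)) ->
  exists2 a : R, 0 < a & for_large (fun t => forall i, i \in s -> P i a t).
Proof.
move=> mono; elim: s => [|i s IH] H; first by exists 1 => //; apply: for_large_true.
have [|a a0 Ha] := IH; first by move=> j Hj; apply: H; rewrite inE Hj orbT.
have [b b0 Hb] := H i (mem_head _ _).
have ab0 : 0 < Num.min a b by rewrite lt_min a0.
exists (Num.min a b) => //; apply: for_large_mono2 Ha Hb => t Ht1 Ht2 j.
rewrite inE => /orP [/eqP ->|/Ht1].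
  by apply: mono Ht2; rewrite ?ge_min ?lexx ?orbT.
by apply: mono; rewrite ?ge_min ?lexx.
Qed.

Lemma for_large_ex (P : C -> Prop) : for_large P -> exists t, P t.
Proof.
move=> [B HB]; exists ((`|B| + 1)%:C)%C; apply: HB; rewrite cmod_real.
by rewrite ger0_norm ?ltr_pwDr // ?ler_norm // addr_ge0.
Qed.
Lemma for_large_exp (D : nat) (P : C -> Prop) : (0 < D)%N -> for_large P -> for_large (fun t => P (t ^+ D)).
Proof.
move=> D0 [B HB]; apply: for_large_mono (for_large_gt (Num.max 1 B)) => t.
rewrite gt_max => /andP [t1 tB]; apply: HB; apply: lt_le_trans tB _.
by rewrite cmodX; apply: ler_eXnr => //; exact: ltW.
Qed.
(** Carries an estimate in the ramified variable t back to x: every x is a D-th power, and its root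
    is large when x is. *)
Lemma for_large_root (D : nat) (P : C -> Prop) : (0 < D)%N -> for_large P ->
  for_large (fun x => exists2 t, x = t ^+ D & P t).
Proof.
move=> D0 [B HB]; apply: for_large_mono (for_large_gt (Num.max 0 B ^+ D)) => x Hx.
exists (D.-root x)%C; first by rewrite rootCK.
apply: HB; rewrite ltNge; apply: contraTN Hx => tB; rewrite -leNgt.
rewrite -(rootCK D0 x) cmodX lerXn2r ?nnegrE ?cmod_ge0 ?le_max ?lexx //.
by rewrite tB orbT.
Qed.

Lemma cmod_powR_intz (t : C) (k : int) : cmod t `^ k%:~R = cmod (t ^ k).
Proof. by rewrite powR_intmul ?cmod_ge0 // cmod_exprz. Qed.

Lemma for_large_powR_lt (a b A c : R) : a < b -> 0 < c ->
  for_large (fun t => A * cmod t `^ a < c * cmod t `^ b).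
Proof.
move=> ab c0; have ba : 0 < b - a by rewrite subr_gt0.
pose M := `|A| / c.
apply: for_large_mono (for_large_gt (Num.max 1 (M `^ (b - a)^-1))) => t.
rewrite gt_max => /andP [t1 tM].
have t0 : 0 < cmod t by exact: lt_trans t1.
have -> : b = (b - a) + a by rewrite subrK.
rewrite powRD; last by apply/implyP => _; rewrite gt_eqF.
rewrite mulrA ltr_pM2r ?powR_gt0 //.
apply: le_lt_trans (ler_norm A) _; rewrite -ltr_pdivrMl // mulrC -/M.
have M0 : 0 <= M by rewrite divr_ge0 // ltW.
have -> : M = (M `^ (b - a)^-1) `^ (b - a).
  by rewrite -powRrM mulVf ?gt_eqF // powRr1.
by apply: gt0_ltr_powR; rewrite ?nnegrE ?powR_ge0 // ltW.
Qed.

(** The two one-sided bounds are kept apart, with real exponents, because they are also applied to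
    functions picked pointwise, which have no well-defined order. *)
Definition isO (h : C -> C) (a : R) :=
  exists A : R, for_large (fun t => cmod (h t) <= A * cmod t `^ a).
Definition isOmega (h : C -> C) (a : R) :=
  exists2 A : R, 0 < A & for_large (fun t => A * cmod t `^ a <= cmod (h t)).

Lemma isO_pos h a : isO h a ->
  exists2 A : R, 0 < A & for_large (fun t => cmod (h t) <= A * cmod t `^ a).
Proof.
move=> [A HA]; exists (Num.max 1 A); first by rewrite lt_max ltr01.
apply: for_large_mono HA => t H; apply: le_trans H _.
by rewrite ler_wpM2r ?powR_ge0 // le_max lexx orbT.
Qed.
Lemma isO_lt h a b c : isO h a -> a < b -> 0 < c ->
  for_large (fun t => cmod (h t) < c * cmod t `^ b).
Proof.
move=> [A HA] ab c0; apply: for_large_mono2 HA (for_large_powR_lt A ab c0) => t.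
exact: le_lt_trans.
Qed.
Lemma isO_small h a c : isO h a -> a < 0 -> 0 < c -> for_large (fun t => cmod (h t) < c).
Proof.
move=> Oh a0 c0; apply: for_large_mono (isO_lt Oh a0 c0) => t.
by rewrite powRr0 mulr1.
Qed.
Lemma isO_isOmega h a b : isO h a -> isOmega h b -> b <= a.
Proof.
move=> Oh [A A0 HA]; rewrite leNgt; apply/negP => ab.
have [t [H1 H2]] := for_large_ex (for_large_and HA (isO_lt Oh ab A0)).
by have := le_lt_trans H1 H2; rewrite ltxx.
Qed.
Lemma isO_ext h g a : (forall t, h t = g t) -> isO h a -> isO g a.
Proof. by move=> hg [A HA]; exists A; apply: for_large_mono HA => t; rewrite hg. Qed.
Lemma isO_evext h g a : for_large (fun t => h t = g t) -> isO h a -> isO g a.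
Proof. by move=> hg [A HA]; exists A; apply: for_large_mono2 hg HA => t ->. Qed.
Lemma isO_dom h g (A : R) a : for_large (fun t => cmod (g t) <= A * cmod (h t)) ->
  isO h a -> isO g a.
Proof.
move=> H /isO_pos [A1 A10 H1]; exists (Num.max 0 A * A1).
apply: for_large_mono2 H H1 => t H H1; apply: le_trans H _.
apply: (@le_trans _ _ (Num.max 0 A * cmod (h t))).
  by rewrite ler_wpM2r ?cmod_ge0 // le_max lexx orbT.
by rewrite -mulrA ler_wpM2l // le_max lexx.
Qed.
Lemma isO_le h a b : a <= b -> isO h a -> isO h b.
Proof.
move=> ab /isO_pos [A A0 HA]; exists A; apply: for_large_mono2 HA (for_large_gt 1) => t HA t1.
apply: le_trans HA _; rewrite ler_wpM2l ?(ltW A0) //.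
by apply: ler_powR => //; exact: ltW.
Qed.
Lemma isO_add h g a : isO h a -> isO g a -> isO (fun t => h t + g t) a.
Proof.
move=> [A HA] [B HB]; exists (A + B); apply: for_large_mono2 HA HB => t HA HB.
by apply: le_trans (cmodD _ _) _; rewrite mulrDl lerD.
Qed.
Lemma isO_opp h a : isO h a -> isO (fun t => - h t) a.
Proof. by move=> [A HA]; exists A; apply: for_large_mono HA => t; rewrite cmodN. Qed.
Lemma isO_sub h g a : isO h a -> isO g a -> isO (fun t => h t - g t) a.
Proof. by move=> Oh /isO_opp; exact: isO_add. Qed.
Lemma isO_mul h g a b : isO h a -> isO g b -> isO (fun t => h t * g t) (a + b).
Proof.
move=> /isO_pos [A A0 HA] /isO_pos [B B0 HB]; exists (A * B).
apply: for_large_mono2 (for_large_and HA HB) (for_large_gt 0) => t [H1 H2] t0.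
rewrite cmodM powRD; last by apply/implyP => _; rewrite gt_eqF.
by rewrite mulrACA ler_pM ?cmod_ge0.
Qed.
Lemma isO_cst (c : C) : isO (fun => c) 0.
Proof. by exists (cmod c); apply: for_large_true => t; rewrite powRr0 mulr1. Qed.
Lemma isO_0 a : isO (fun => 0) a.
Proof. by exists 0; apply: for_large_true => t; rewrite cmod0 mul0r. Qed.
Lemma isO_mulc (c : C) h a : isO h a -> isO (fun t => c * h t) a.
Proof. by move=> H; have := isO_mul (isO_cst c) H; rewrite add0r. Qed.
Lemma isO_exprz (k : int) : isO (fun t => t ^ k) k%:~R.
Proof. by exists 1; apply: for_large_true => t; rewrite cmod_powR_intz mul1r. Qed.
Lemma isOmega_exprz (k : int) : isOmega (fun t => t ^ k) k%:~R.
Proof. by exists 1 => //; apply: for_large_true => t; rewrite cmod_powR_intz mul1r. Qed.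
Lemma isOmega_sub h g a b : isOmega h b -> isO g a -> a < b -> isOmega (fun t => h t - g t) b.
Proof.
move=> [A A0 HA] Og ab; exists (A / 2); first by rewrite divr_gt0.
apply: for_large_mono2 HA (isO_lt Og ab (divr_gt0 A0 (ltr0Sn _ 1))) => t H1 H2.
have := cmod_le_dist (h t) (g t).
move: H1 H2; set u := _ `^ _; rewrite (_ : A * u = A / 2 * u + A / 2 * u); last lra.
lra.
Qed.
Lemma isOmega_le h a b : a <= b -> isOmega h b -> isOmega h a.
Proof.
move=> ab [A A0 HA]; exists A => //; apply: for_large_mono2 HA (for_large_gt 1) => t HA t1.
apply: le_trans _ HA; rewrite ler_wpM2l ?(ltW A0) //.
by apply: ler_powR => //; exact: ltW.
Qed.
Lemma isOmega_evext h g a : for_large (fun t => h t = g t) -> isOmega h a -> isOmega g a.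
Proof. by move=> hg [A A0 HA]; exists A => //; apply: for_large_mono2 hg HA => t ->. Qed.

End Growth.

(** * Estimates for polynomials *)

Section PolyEstimates.
Variable R : realType.
Local Notation C := R[i].

Lemma maxnorm_lel (z : C * C) : cmod z.1 <= maxnorm z.
Proof. by rewrite le_max lexx. Qed.
Lemma maxnorm_ler (z : C * C) : cmod z.2 <= maxnorm z.
Proof. by rewrite le_max lexx orbT. Qed.
Lemma maxnorm_ge0 (z : C * C) : 0 <= maxnorm z.
Proof. exact: le_trans (cmod_ge0 _) (maxnorm_lel z). Qed.
Lemma maxnorm_le (z : C * C) (X : R) :
  (maxnorm z <= X) = (cmod z.1 <= X) && (cmod z.2 <= X).
Proof. by rewrite ge_max. Qed.

(** The size bound accompanies the Lipschitz bound because the difference of two products involves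
    the values of both factors. *)
Definition polybound (g : C * C -> C) := exists A : R, exists M : nat, 0 <= A /\
  forall (X : R) z w, 1 <= X -> maxnorm z <= X -> maxnorm w <= X ->
  cmod (g z) <= A * X ^+ M /\ cmod (g z - g w) <= A * X ^+ M * maxnorm (z - w).

Lemma polybound_cst c : polybound (fun => c).
Proof.
exists (cmod c), 0%N; split; first exact: cmod_ge0.
move=> X z w X1 _ _; rewrite expr0 mulr1 subrr cmod0; split=> //.
by rewrite mulr_ge0 ?cmod_ge0 ?maxnorm_ge0.
Qed.
Lemma polybound_fst : polybound (fun z => z.1).
Proof.
exists 1, 1%N; split=> // X z w X1 zX wX; rewrite mul1r expr1; split.
  exact: le_trans (maxnorm_lel z) zX.
apply: (@le_trans _ _ (1 * maxnorm (z - w))).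
  by rewrite mul1r -[z.1 - w.1]/((z - w).1) maxnorm_lel.
by rewrite ler_wpM2r ?maxnorm_ge0.
Qed.
Lemma polybound_snd : polybound (fun z => z.2).
Proof.
exists 1, 1%N; split=> // X z w X1 zX wX; rewrite mul1r expr1; split.
  exact: le_trans (maxnorm_ler z) zX.
apply: (@le_trans _ _ (1 * maxnorm (z - w))).
  by rewrite mul1r -[z.2 - w.2]/((z - w).2) maxnorm_ler.
by rewrite ler_wpM2r ?maxnorm_ge0.
Qed.
Lemma polyboundD g h : polybound g -> polybound h -> polybound (fun z => g z + h z).
Proof.
move=> [A [M [A0 HA]]] [B [N [B0 HB]]]; exists (A + B), (M + N)%N.
split=> [|X z w X1 zX wX]; first exact: addr_ge0.
have [g1 g2] := HA X z w X1 zX wX; have [h1 h2] := HB X z w X1 zX wX.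
have XM : X ^+ M <= X ^+ (M + N) by rewrite ler_weXn2l // leq_addr.
have XN : X ^+ N <= X ^+ (M + N) by rewrite ler_weXn2l // leq_addl.
have AX : A * X ^+ M <= A * X ^+ (M + N) by rewrite ler_wpM2l.
have BX : B * X ^+ N <= B * X ^+ (M + N) by rewrite ler_wpM2l.
split.
  apply: le_trans (cmodD _ _) _; rewrite mulrDl lerD //.
    exact: le_trans g1 AX.
  exact: le_trans h1 BX.
rewrite opprD addrACA; apply: le_trans (cmodD _ _) _; rewrite !mulrDl lerD //.
  by apply: le_trans g2 _; rewrite ler_wpM2r ?maxnorm_ge0.
by apply: le_trans h2 _; rewrite ler_wpM2r ?maxnorm_ge0.
Qed.
Lemma polyboundM g h : polybound g -> polybound h -> polybound (fun z => g z * h z).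
Proof.
move=> [A [M [A0 HA]]] [B [N [B0 HB]]]; exists (2 * A * B), (M + N)%N.
split=> [|X z w X1 zX wX]; first by rewrite !mulr_ge0.
have [g1 g2] := HA X z w X1 zX wX; have [h1 h2] := HB X z w X1 zX wX.
have [h3 _] := HB X w z X1 wX zX.
have X0 : 0 <= X by exact: le_trans X1.
have XA : 0 <= A * X ^+ M by rewrite mulr_ge0 ?exprn_ge0.
have XB : 0 <= B * X ^+ N by rewrite mulr_ge0 ?exprn_ge0.
have -> : 2 * A * B * X ^+ (M + N) = (A * X ^+ M) * (B * X ^+ N) *+ 2.
  by rewrite exprD; ring.
split.
  rewrite cmodM mulr2n; apply: le_trans (_ : (A * X ^+ M) * (B * X ^+ N) <= _).
    by rewrite ler_pM ?cmod_ge0.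
  by rewrite lerDl mulr_ge0.
have -> : g z * h z - g w * h w = g z * (h z - h w) + (g z - g w) * h w by ring.
apply: le_trans (cmodD _ _) _; rewrite !cmodM mulr2n mulrDl lerD //.
  by rewrite -mulrA ler_pM ?cmod_ge0.
by rewrite mulrAC ler_pM ?cmod_ge0.
Qed.

Lemma polybound_ext g h : (forall z, g z = h z) -> polybound g -> polybound h.
Proof.
move=> gh [A [M [A0 HA]]]; exists A, M; split=> // X z w X1 zX wX.
by rewrite -!gh; exact: HA.
Qed.

Lemma eval2C (A : comNzRingType) (p : {poly A}) z : eval2 p%:P z = p.[z.1].
Proof. by rewrite /eval2 hornerC. Qed.
Lemma eval2X (A : comNzRingType) (z : A * A) : eval2 'X z = z.2.
Proof. by rewrite /eval2 hornerX hornerC. Qed.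
Lemma eval2D (A : comNzRingType) (p q : {poly {poly A}}) z :
  eval2 (p + q) z = eval2 p z + eval2 q z.
Proof. by rewrite /eval2 !hornerD. Qed.
Lemma eval2N (A : comNzRingType) (p : {poly {poly A}}) z :
  eval2 (- p) z = - eval2 p z.
Proof. by rewrite /eval2 !hornerN. Qed.
Lemma eval2M (A : comNzRingType) (p q : {poly {poly A}}) z :
  eval2 (p * q) z = eval2 p z * eval2 q z.
Proof. by rewrite /eval2 !hornerM. Qed.

Definition at_x (A : comNzRingType) (x : A) (f : {poly {poly A}}) : {poly A} :=
  map_poly (horner_eval x) f.
Lemma eval2_at_x (A : comNzRingType) (f : {poly {poly A}}) z :
  eval2 f z = (at_x z.1 f).[z.2].
Proof.
have := @horner_map {poly A} A (horner_eval z.1) f (z.2)%:P.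
by rewrite /= {2}/horner_eval hornerC /eval2 => ->.
Qed.
Lemma at_x_dy (A : comNzRingType) (x : A) (f : {poly {poly A}}) :
  at_x x (dy f) = (at_x x f)^`().
Proof. by rewrite /at_x /dy deriv_map. Qed.

Lemma polybound_eval2 (f : {poly {poly C}}) : polybound (eval2 f).
Proof.
elim/poly_ind: f => [|f c IH].
  by apply: polybound_ext (polybound_cst 0) => z; rewrite /eval2 !horner0.
apply: (@polybound_ext (fun z => eval2 f z * z.2 + c.[z.1])) => [z|].
  by rewrite eval2D eval2M eval2X eval2C.
apply: polyboundD; first exact: polyboundM IH polybound_snd.
elim/poly_ind: c => [|p c IHp].
  by apply: polybound_ext (polybound_cst 0) => z; rewrite horner0.
apply: (@polybound_ext (fun z => p.[z.1] * z.1 + c)) => [z|].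
  by rewrite hornerMXaddC.
by apply: polyboundD (polybound_cst _); exact: polyboundM IHp polybound_fst.
Qed.

(** The l1 norm of the coefficients, through partial sums of every length so that no degree is
    mentioned. It replaces integration in the mean value inequality: q(1) - q(0) is the sum of the
    coefficients of positive index, each dominated by the corresponding one of q'. *)
Definition l1_le (p : {poly C}) (B : R) :=
  forall n, \sum_(i < n) cmod p`_i <= B.

Lemma l1_le1 : l1_le 1 1.
Proof.
case=> [|n]; rewrite ?big_ord0 // big_ord_recl big1 ?addr0 ?coef1 ?cmod1 // => i _.
by rewrite coef1 cmod0.
Qed.
Lemma l1_le_ge0 p B : l1_le p B -> 0 <= B.
Proof. by move/(_ 0%N); rewrite big_ord0. Qed.
Lemma l1_le_mul (a w : C) p B :
  l1_le p B -> l1_le ((a%:P + w%:P * 'X) * p) ((cmod a + cmod w) * B).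
Proof.
move=> pB n; have B0 := l1_le_ge0 pB.
apply: (@le_trans _ _ (\sum_(i < n) (cmod a * cmod p`_i +
   cmod w * (if (i : nat) is j.+1 then cmod p`_j else 0)))).
  apply: ler_sum => i _; rewrite mulrDl coefD coefCM -mulrA coefCM coefXM.
  apply: le_trans (cmodD _ _) _; rewrite !cmodM.
  by case: (i : nat) => [|j] /=; rewrite ?cmod0.
rewrite big_split /= -!mulr_sumr mulrDl lerD // ler_wpM2l ?cmod_ge0 //; first exact: pB.
case: n => [|n]; first by rewrite big_ord0.
by rewrite big_ord_recl /= add0r; exact: pB.
Qed.
Lemma l1_le_scale (c : C) p B : l1_le p B -> l1_le (c *: p) (cmod c * B).
Proof.
move=> pB n; under eq_bigr => i _ do rewrite coefZ cmodM.
by rewrite -mulr_sumr ler_wpM2l ?cmod_ge0.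
Qed.

Lemma l1_deriv_bound (q : {poly C}) B : l1_le q^`() B -> cmod (q.[1] - q.[0]) <= B.
Proof.
move=> qB; rewrite horner_coef0 horner_coef.
have [->|q0] := eqVneq q 0.
  by rewrite size_poly0 big_ord0 coef0 subrr cmod0; exact: l1_le_ge0 qB.
move: q0; rewrite -size_poly_gt0; case sq: (size q) => [//|m] _.
rewrite big_ord_recl expr1n mulr1 addrAC subrr add0r.
apply: le_trans (cmod_sum _ _ _) _; apply: le_trans (qB m).
apply: ler_sum => i _; rewrite expr1n mulr1 coef_deriv -mulr_natl cmodM cmod_natr.
by rewrite /bump /= ?add1n -[leLHS]mul1r ler_wpM2r ?cmod_ge0 // ler1n.
Qed.

(** On the segment y + wX the derivative is a product of linear factors (y - c) + wX, and the l1
    norm is submultiplicative on these. *)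
Lemma mean_value_bound (p : {poly C}) (k : C) (cs : seq C) (y w : C) :
  p^`() = k *: \prod_(c <- cs) ('X - c%:P) ->
  cmod (p.[y + w] - p.[y]) <=
  cmod k * cmod w * \prod_(c <- cs) (cmod (y - c) + cmod w).
Proof.
move=> p'E; pose q := p \Po (y%:P + w%:P * 'X).
have -> : p.[y + w] = q.[1] by rewrite horner_comp !hornerE.
have -> : p.[y] = q.[0] by rewrite horner_comp !hornerE.
apply: l1_deriv_bound.
rewrite deriv_comp p'E comp_polyZ derivD derivC add0r derivM derivC mul0r add0r.
rewrite derivX mulr1 -cmodM; set P := _ \Po _.
rewrite mulrC mul_polyC scalerA [w * k]mulrC.
apply: l1_le_scale; rewrite {}/P {}/q; elim: cs {p'E} => [|c cs IH].
  by rewrite !big_nil comp_polyC; exact: l1_le1.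
rewrite !big_cons comp_polyM comp_polyB comp_polyX comp_polyC.
have -> : y%:P + w%:P * 'X - c%:P = (y - c)%:P + w%:P * 'X by rewrite polyCB; ring.
exact: l1_le_mul.
Qed.

(** The logarithmic derivative is the sum of the 1 / (y - g), each of modulus at most 1 / r; this is
    the form without division. *)
Lemma deriv_prod_bound (gs : seq C) (y : C) (r : R) : 0 < r ->
  (forall g, g \in gs -> r <= cmod (y - g)) ->
  r * cmod (\prod_(g <- gs) ('X - g%:P))^`().[y] <=
  (size gs)%:R * cmod (\prod_(g <- gs) ('X - g%:P)).[y].
Proof.
move=> r0; elim: gs => [|g gs IH] H.
  by rewrite big_nil derivC horner0 cmod0 mulr0 mul0r.
rewrite big_cons derivM derivB derivX derivC subr0 mul1r hornerD !hornerM.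
rewrite hornerXsubC; set u := cmod (y - g); set q := \prod_(_ <- _) _.
have Hg : r <= u by apply: H; rewrite mem_head.
have {}IH : r * cmod q^`().[y] <= (size gs)%:R * cmod q.[y].
  by apply: IH => h Hh; apply: H; rewrite inE Hh orbT.
apply: le_trans (_ : r * (cmod q.[y] + u * cmod q^`().[y]) <= _).
  by rewrite ler_wpM2l ?(ltW r0) //; apply: le_trans (cmodD _ _) _; rewrite cmodM.
rewrite cmodM -/u /= mulrSr mulrDl mul1r mulrDr addrC lerD //.
  by rewrite mulrCA [leRHS]mulrCA ler_wpM2l ?cmod_ge0.
by rewrite ler_wpM2r ?cmod_ge0.
Qed.

Lemma horner_prod_XsubC (gs : seq C) (y : C) :
  (\prod_(g <- gs) ('X - g%:P)).[y] = \prod_(g <- gs) (y - g).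
Proof. by rewrite horner_prod; apply: eq_bigr => g _; rewrite hornerXsubC. Qed.

Lemma prod_cst_seq (I : Type) (s : seq I) (a : R) : \prod_(i <- s) a = a ^+ size s.
Proof. by rewrite big_const_seq count_predT iter_mulr_1. Qed.

Lemma seq_argmin (cs : seq C) (y : C) : cs != [::] ->
  exists2 c, c \in cs & forall c', c' \in cs -> cmod (y - c) <= cmod (y - c').
Proof.
elim: cs => // c [|d cs] IH _.
  by exists c; rewrite ?mem_head // => c'; rewrite inE => /eqP ->.
have [//|e e_in He] := IH _.
have [ce|ce] := leP (cmod (y - c)) (cmod (y - e)).
  exists c; rewrite ?mem_head // => c'; rewrite inE => /orP [/eqP -> //|/He].
  exact: le_trans.
exists e; first by rewrite inE e_in orbT.
by move=> c'; rewrite inE => /orP [/eqP ->|/He //]; exact: ltW.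
Qed.

Lemma monic_deriv_factor (p : {poly C}) n : p \is monic -> size p = n.+1 ->
  exists2 cs : seq C, (size cs).+1 = maxn 1 n &
    p^`() = n%:R *: \prod_(c <- cs) ('X - c%:P).
Proof.
move=> pm sp; case: n sp => [|n] sp.
  (* For n = 0 the derivative is 0 times the empty product, which is why the statement takes a
     maximum with 1. *)
  exists [::] => //; rewrite scale0r (size1_polyC (_ : size p <= 1)%N) ?derivC //.
  by rewrite sp.
have [cs csE] := closed_field_poly_normal p^`().
have n0 : n.+1%:R != 0 :> C by rewrite pnatr_eq0.
have pn : p^`()`_n = n.+1%:R.
  rewrite coef_deriv; have /eqP := pm; rewrite lead_coefE sp => ->.
  by [].
have sp' : size p^`() = n.+1.
  apply/eqP; rewrite eqn_leq; apply/andP; split.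
    by rewrite -ltnS -sp lt_size_deriv // monic_neq0.
  by rewrite ltnNge; apply: contra n0 => H; rewrite -pn nth_default.
have lc : lead_coef p^`() = n.+1%:R by rewrite lead_coefE sp' pn.
exists cs; last by rewrite -lc.
have := sp'; rewrite csE lc size_scale // size_prod_XsubC => ->.
by rewrite maxnE subn1 add1n.
Qed.

(** Moving from y to the nearest critical point at most doubles each distance |y - c'|, so the
    derivative on the way is at most 2^deg times its value at y. *)
Lemma mean_value_nearest (p : {poly C}) (k : C) (cs : seq C) (c y : C) :
  p^`() = k *: \prod_(c <- cs) ('X - c%:P) ->
  (forall c', c' \in cs -> cmod (y - c) <= cmod (y - c')) ->
  cmod (p.[c] - p.[y]) <= cmod (y - c) * 2 ^+ size cs * cmod p^`().[y].
Proof.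
move=> p'E cmin; have := mean_value_bound y (c - y) p'E.
rewrite [y + _]addrC subrK [cmod (c - y)]cmod_dist; move/le_trans; apply.
rewrite p'E hornerZ horner_prod_XsubC cmodM cmod_prod.
have -> : cmod (y - c) * 2 ^+ size cs * (cmod k * \prod_(c <- cs) cmod (y - c)) =
  cmod k * cmod (y - c) * (2 ^+ size cs * \prod_(c <- cs) cmod (y - c)) by ring.
rewrite ler_wpM2l ?mulr_ge0 ?cmod_ge0 //.
rewrite -prod_cst_seq -big_split /= !big_seq.
apply: ler_prod => c' c'_in; rewrite addr_ge0 ?cmod_ge0 //=.
by rewrite mulr_natl mulr2n lerD2l cmin.
Qed.

Lemma critical_near (p : {poly C}) n y : p \is monic -> size p = n.+3 ->
  exists c, [/\ root p^`() c, cmod (y - c) ^+ n.+1 <= cmod p^`().[y] &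
    cmod (p.[c] - p.[y]) <= cmod (y - c) * 2 ^+ n.+1 * cmod p^`().[y]].
Proof.
move=> pm sp; have [cs scs p'E] := monic_deriv_factor pm sp.
have {}scs : size cs = n.+1 by move: scs; rewrite maxnE subn1 add1n => -[].
have [|c c_in cmin] := @seq_argmin cs y; first by rewrite -size_eq0 scs.
exists c; split.
- by rewrite p'E rootZ ?pnatr_eq0 // root_prod_XsubC.
- rewrite p'E hornerZ horner_prod_XsubC cmodM cmod_prod cmod_natr.
  apply: (@le_trans _ _ (\prod_(c <- cs) cmod (y - c))).
    rewrite -scs -prod_cst_seq !big_seq.
    by apply: ler_prod => h Hh; rewrite cmod_ge0 cmin.
  by rewrite ler_peMl ?ler1n // prodr_ge0 // => i _; exact: cmod_ge0.
- by rewrite -scs; exact: mean_value_nearest p'E cmin.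
Qed.

(* If every critical value of p stays away from 0, then near the zero fibre the
   derivative is bounded below and comparable with its value at a nearby root:
   the mean value inequality towards the nearest critical point c bounds
   |y - c| |p'(y)| from below, so a root is much closer to y than c is. *)
Lemma noncritical_root (p : {poly C}) n (eps : R) y :
  p \is monic -> size p = n.+2 -> 0 < eps -> 
  (forall c, root p^`() c -> eps <= cmod p.[c]) ->
  cmod p.[y] <= eps / (8 * n.+1%:R * 2 ^+ n) ->
  Num.min 1 (eps / (2 * 2 ^+ n)) <= cmod p^`().[y] /\
  exists2 g, root p g & cmod p^`().[g] <= 2 ^+ n * cmod p^`().[y].
Proof.
move=> pm sp eps0 Hc Hy.
have [cs scs p'E] := monic_deriv_factor pm sp.
have {}scs : size cs = n by move: scs; rewrite maxnE subn1 add1n => -[].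
have p'y z : cmod p^`().[z] = n.+1%:R * \prod_(c <- cs) cmod (z - c).
  by rewrite p'E hornerZ horner_prod_XsubC cmodM cmod_natr cmod_prod.
have n1 : 1 <= n.+1%:R :> R by rewrite ler1n.
have e2 : 1 <= 2 ^+ n :> R by rewrite exprn_ege1 // ler1n.
have [c0|cs0] := eqVneq cs [::].
  rewrite !p'y c0 big_nil mulr1; split; first by rewrite ge_min n1.
  have /closed_rootP [g gp] : size p != 1%N by rewrite sp.
  by exists g => //; rewrite p'y c0 big_nil mulr1 ler_peMl // ler0n.
have [c c_in cmin] := seq_argmin y cs0; pose d := cmod (y - c).
have rc : root p^`() c by rewrite p'E rootZ ?pnatr_eq0 // root_prod_XsubC.
have n0 : 0 < n.+1%:R :> R by exact: lt_le_trans n1.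
have e0 : 0 < 2 ^+ n :> R by exact: lt_le_trans e2.
(* Hence p moves by at least eps / 2 between y and c, which is [Hd]. *)
have y_small : cmod p.[y] <= eps / 2.
  apply: le_trans Hy _; rewrite ler_pM2l // lef_pV2 ?posrE ?mulr_gt0 //.
  have := ler_pM _ _ n1 e2; rewrite mulr1 => /(_ ler01 ler01); nra.
have Hd : eps / 2 <= d * 2 ^+ n * cmod p^`().[y].
  have := mean_value_nearest p'E cmin; rewrite scs -/d => H.
  by have := cmod_le_dist p.[c] p.[y]; have := Hc _ rc; move: H y_small; lra.
have d_gt0 : 0 < d.
  rewrite lt_neqAle cmod_ge0 andbT eq_sym; apply: contraTneq Hd => ->.
  by rewrite !mul0r -ltNge divr_gt0.
split.
  (* If c is within distance 1, [Hd] bounds p'(y) from below; otherwise every factor of p'(y)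
     exceeds 1. *)
  have [d1|d1] := leP d 1.
    rewrite ge_min; apply/orP; right.
    rewrite invfM mulrA ler_pdivrMr //; apply: le_trans Hd _.
    by rewrite [leRHS]mulrC -mulrA ler_piMl ?mulr_ge0 ?cmod_ge0 // ltW.
  rewrite ge_min p'y; apply/orP; left; apply: mulr_ege1 => //.
  rewrite big_seq; elim/big_rec: _ => // c' u c'_in u1; apply: mulr_ege1 => //.
  by apply: le_trans (cmin _ c'_in); exact: ltW.
have [gs gsE] := closed_field_poly_normal p.
rewrite (eqP pm) scale1r in gsE.
have sgs : size gs = n.+1 by move: sp; rewrite gsE size_prod_XsubC => -[].
(* A root within d / 2 of y has |g - c'| <= 2 |y - c'| for every critical point c', which compares
   the derivatives factor by factor. *)
have [/hasP [g g_in Hg]|] := boolP (has (fun g => cmod (y - g) < d / 2) gs).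
  exists g; first by rewrite gsE root_prod_XsubC.
  rewrite !p'y mulrCA ler_wpM2l ?(ltW n0) //.
  rewrite -{1}scs -prod_cst_seq -big_split /= !big_seq.
  apply: ler_prod => c' c'_in; rewrite cmod_ge0 /=.
  have -> : g - c' = (y - c') - (y - g) by ring.
  apply: le_trans (cmodB _ _) _; have := cmin _ c'_in; rewrite -/d.
  by have := cmod_ge0 (y - c'); move: Hg; lra.
(* With all roots at distance at least d / 2, the logarithmic derivative bounds d |p'(y)| by a
   multiple of |p(y)|; the constant 8 makes this incompatible with [Hd]. *)
move=> /hasPn Hg; exfalso.
have d2 : 0 < d / 2 by rewrite divr_gt0.
have := @deriv_prod_bound gs y _ d2; rewrite -gsE sgs => H.
have {}H : d / 2 * cmod p^`().[y] <= n.+1%:R * cmod p.[y].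
  by apply: H => g /Hg; rewrite -leNgt.
move: Hy; rewrite ler_pdivlMr ?mulr_gt0 // => Hy.
move: Hd H Hy; set P := cmod p^`().[y]; set u := cmod p.[y].
set e := 2 ^+ n in e0 *; set N := n.+1%:R in n0 *.
move=> Hd H Hy.
have : d / 2 * P * e <= N * u * e by rewrite ler_wpM2r // ltW.
have e1 : u * (8 * N * e) = 8 * (N * u * e) by ring.
have e3 : d * e * P = 2 * (d / 2 * P * e) by field.
rewrite e1 in Hy; rewrite e3 in Hd; lra.
Qed.
End PolyEstimates.

(** * Functions meromorphic at infinity *)

Section Meromorphic.
Variable R : realType.
Local Notation C := R[i].

(** An expansion in 1/t given by geometric bounds on all remainders instead of convergence. The
    bounds yield orders at once and survive sums and products without limits. *)
Definition inv_series (g : C -> C) (a : nat -> C) := exists A rho : R,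
  [/\ 0 < A, 0 < rho & for_large (fun t => forall n,
    cmod (g t - \sum_(j < n) a j * t^-1 ^+ j) <= A * (rho / cmod t) ^+ n)].

Lemma inv_series_coef g a : inv_series g a ->
  exists2 A : R, 0 < A & exists2 rho : R, 0 < rho &
    (forall n, cmod (a n) <= A * rho ^+ n) /\
    for_large (fun t => forall n,
      cmod (g t - \sum_(j < n) a j * t^-1 ^+ j) <= A * (rho / cmod t) ^+ n).
Proof.
move=> [A [rho [A0 rho0 H]]].
have [t [Ht t1]] := for_large_ex (for_large_and H (for_large_gt 1)).
have t0 : 0 < cmod t by exact: lt_trans t1.
pose q := rho / cmod t; have q0 : 0 <= q by rewrite divr_ge0 ?ltW.
exists (A * (1 + q)); first by rewrite mulr_gt0 // ltr_pwDl.
exists rho => //; split=> [n|]; last first.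
  apply: for_large_mono2 H (for_large_gt 0) => u H1 u0 n; apply: le_trans (H1 n) _.
  rewrite ler_wpM2r ?exprn_ge0 ?divr_ge0 ?(ltW rho0) ?(ltW u0) //.
  by rewrite ler_peMr ?(ltW A0) // lerDl.
have := Ht n.+1; have := Ht n; rewrite big_ord_recr /=.
set S := \sum_(i < n) _; set u := a n * _ => H1 H2.
have Hu : cmod u <= A * q ^+ n + A * q ^+ n.+1.
  have -> : u = (g t - S) - (g t - (S + u)) by ring.
  by apply: le_trans (cmodB _ _) _; exact: lerD.
have ua : cmod (a n) = cmod u * cmod t ^+ n.
  rewrite /u cmodM cmodX cmodV -mulrA -exprMn mulVf ?expr1n ?mulr1 //.
  by rewrite gt_eqF.
rewrite ua; apply: le_trans (ler_wpM2r _ Hu) _; first by rewrite exprn_ge0 ?ltW.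
rewrite exprS; have -> : A * q ^+ n + A * (q * q ^+ n) = A * (1 + q) * q ^+ n by ring.
by rewrite -[leLHS]mulrA -exprMn divfK ?gt_eqF.
Qed.

Lemma le_geometric_le0 (x A q : R) : 0 <= q < 1 ->
  (forall n, x <= A * q ^+ n) -> x <= 0.
Proof.
move=> /andP [q0 q1] H.
have cv : A * q ^+ n @[n --> \oo] --> (0 : R).
  rewrite -[X in _ --> X](mulr0 A).
  by apply: cvgM; [exact: cvg_cst | apply: cvg_expr; rewrite ger0_norm].
have cx : (fun _ : nat => x) @ \oo --> x by exact: cvg_cst.
have := @ler_cvg_to _ _ _ _ (fun _ : nat => x) (fun n => A * q ^+ n) x 0 cx cv.
by apply; near=> n; exact: H.
Unshelve. all: by end_near.
Qed.

(** The first nonzero term dominates the remainder after it, which is one order smaller. If there is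
    no such term, the remainder bounds tend to 0 and g itself vanishes. *)
Lemma inv_series_lead g a : inv_series g a ->
  ((forall j, a j = 0) /\ for_large (fun t => g t = 0)) \/
  exists j0 : nat, [/\ a j0 != 0, (forall j, (j < j0)%N -> a j = 0),
    isO g (- j0%:R) & isOmega g (- j0%:R)].
Proof.
move=> [A [rho [A0 rho0 H]]].
have [a0|] := pselect (forall j, a j = 0).
  left; split=> //; apply: for_large_mono2 H (for_large_gt (2 * rho)) => t Ht t2.
  apply/eqP; rewrite -cmod_eq0 eq_le cmod_ge0 andbT.
  have t0 : 0 < cmod t by rewrite (lt_trans _ t2) // mulr_gt0.
  apply: (@le_geometric_le0 _ A (rho / cmod t)).
    by rewrite divr_ge0 ?ltW //= ltr_pdivrMr // mul1r; move: t2 rho0; lra.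
  by move=> n; have := Ht n; rewrite big1 ?subr0 // => i _; rewrite a0 mul0r.
move=> na; right.
have ex : exists j, a j != 0.
  apply: contrapT => nex; apply: na => j; apply/eqP; apply: contrapT => /negP aj.
  by apply: nex; exists j.
have [j0 aj0 j0min] := find_ex_minn ex.
exists j0.
have jz j : (j < j0)%N -> a j = 0.
  by move=> jj; apply/eqP; apply: contraTT jj => /j0min; rewrite -leqNgt.
have Oe : isO (fun t => g t - a j0 * t^-1 ^+ j0) (- j0.+1%:R).
  exists (A * rho ^+ j0.+1); apply: for_large_mono2 H (for_large_gt 0) => t Ht t0.
  have := Ht j0.+1; rewrite big_ord_recr big1 /= ?add0r => [|i _]; last first.
    by rewrite jz // mul0r.
  by rewrite powR_invn ?cmod_ge0 // exprMn mulrA !exprVn.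
have Oa : isO (fun t => a j0 * t^-1 ^+ j0) (- j0%:R).
  exists (cmod (a j0)); apply: for_large_true => t.
  by rewrite cmodM cmodX cmodV exprVn powR_invn ?cmod_ge0.
have Oma : isOmega (fun t => a j0 * t^-1 ^+ j0) (- j0%:R).
  exists (cmod (a j0)); first by rewrite cmod_gt0.
  apply: for_large_true => t.
  by rewrite cmodM cmodX cmodV exprVn powR_invn ?cmod_ge0.
have jj : - j0.+1%:R < - j0%:R :> R by rewrite ltrN2 ltr_nat.
split=> //.
- apply: isO_ext (isO_add Oa (isO_le (ltW jj) Oe)) => t.
  by rewrite addrC subrK.
- apply: isOmega_evext (isOmega_sub Oma (isO_opp Oe) jj).
  by apply: for_large_true => t; rewrite opprK addrC subrK.
Qed.

Lemma laurent_inv_series (h : C -> C) (c : int -> C) : laurent_at_infty h c ->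
  exists k : int, (forall m : int, k < m -> c m = 0) /\
  exists2 g, inv_series g (fun j => c (k - j%:Z)) & for_large (fun t => h t = t ^ k * g t).
Proof.
move=> [k [ck [r r0 Hr]]]; exists k; split=> //.
pose a j := c (k - j%:Z); pose g t := t ^ (- k) * h t.
have tk (t : C) n : t != 0 -> \sum_(j < n) c (k - j%:Z) * t ^ (k - j%:Z) =
    t ^ k * \sum_(j < n) a j * t^-1 ^+ j.
  move=> t0; rewrite mulr_sumr; apply: eq_bigr => j _.
  by rewrite expfzDr // mulrCA exprVn exprnN.
have hg (t : C) : t != 0 -> h t = t ^ k * g t.
  by move=> t0; rewrite /g mulrA -expfzDr // subrr expr0z mul1r.
exists g; last first.
  by apply: for_large_mono (for_large_gt 0) => t; rewrite cmod_gt0; exact: hg.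
have err (t : C) n : t != 0 -> cmod (\sum_(j < n) c (k - j%:Z) * t ^ (k - j%:Z) - h t)
    = cmod t ^ k * cmod (g t - \sum_(j < n) a j * t^-1 ^+ j).
  by move=> t0; rewrite tk // hg // -mulrBr cmodM cmod_exprz cmod_dist.
have cv (t : C) : r < cmod t ->
    cmod (g t - \sum_(j < n) a j * t^-1 ^+ j) @[n --> \oo] --> (0 : R).
  move=> tr; have t0 : t != 0 by rewrite -cmod_gt0 (lt_trans r0).
  have cM : cmod t ^ (- k) * cmod (\sum_(j < n) c (k - j%:Z) * t ^ (k - j%:Z) - h t)
      @[n --> \oo] --> cmod t ^ (- k) * (0 : R).
    by apply: cvgM; [exact: cvg_cst | exact: Hr].
  rewrite mulr0 in cM; apply: cvg_trans cM; apply: near_eq_cvg.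
  near=> n; rewrite err // mulrA -expfzDr ?cmod_eq0 // addNr expr0z mul1r //.
(* Convergence at this single point bounds the remainders there, hence the terms, hence the
   coefficients geometrically. *)
pose t0 : C := ((r + 1)%:C)%C; pose rho := r + 1.
have rho0 : 0 < rho by rewrite addr_gt0.
have t0E : cmod t0 = rho by rewrite cmod_real gtr0_norm.
have [M M0 HM] : exists2 M : R, 0 < M & forall n, cmod (g t0 - \sum_(j < n) a j * t0^-1 ^+ j) <= M.
  have : cmod (g t0 - \sum_(j < n) a j * t0^-1 ^+ j) @[n --> \oo] --> (0 : R).
    by apply: cv; rewrite t0E ltrDl.
  move=> /cvgP /cvg_seq_bounded [M [_ HM]]; exists (`|M| + 1).
    by rewrite ltr_wpDl.
  move=> n; have /(_ (ltr_pwDr ltr01 (ler_norm M)) n Logic.I) /= := HM (`|M| + 1).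
  by rewrite ger0_norm ?cmod_ge0.
have ab n : cmod (a n) <= 2 * M * rho ^+ n.
  have := HM n; have := HM n.+1; rewrite big_ord_recr /=.
  set S := \sum_(i < n) _; set u := a n * _ => H1 H2.
  have Hu : cmod u <= 2 * M.
    have -> : u = (g t0 - S) - (g t0 - (S + u)) by ring.
    by apply: le_trans (cmodB _ _) _; move: H1 H2; lra.
  have -> : cmod (a n) = cmod u * rho ^+ n.
    rewrite /u cmodM cmodX cmodV t0E -mulrA -exprMn mulVf ?expr1n ?mulr1 //.
    by rewrite gt_eqF.
  by rewrite ler_wpM2r // exprn_ge0 // ltW.
exists (4 * M), rho; split=> //; first by rewrite mulr_gt0.
apply: for_large_mono (for_large_gt (2 * rho)) => t t2 n.
have t_gt0 : 0 < cmod t by rewrite (lt_trans _ t2) // mulr_gt0.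
pose q := rho / cmod t; rewrite -/q.
have q0 : 0 <= q by rewrite divr_ge0 ?ltW.
have q2 : q <= 1 / 2 by rewrite /q ler_pdivrMr //; move: t2; lra.
(* For |t| > 2 rho the terms decrease at least like powers of 1/2. The partial sum of that geometric
   series is kept exactly so that the induction closes. *)
have tail m : cmod (\sum_(n <= j < n + m) a j * t^-1 ^+ j) <=
    4 * M * q ^+ n * (1 - (1 / 2) ^+ m).
  elim: m => [|m IH].
    by rewrite addn0 big_geq // cmod0 expr0 subrr mulr0.
  rewrite addnS big_nat_recr ?leq_addr //=.
  apply: le_trans (cmodD _ _) _.
  have H1 : cmod (a (n + m)%N * t^-1 ^+ (n + m)) <= 2 * M * q ^+ n * (1 / 2) ^+ m.
    rewrite cmodM cmodX cmodV.
    apply: le_trans (ler_wpM2r _ (ab _)) _; first by rewrite exprn_ge0 ?invr_ge0 ?cmod_ge0.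
    rewrite -[leLHS]mulrA -exprMn -/q exprD mulrA.
    rewrite ler_wpM2l ?mulr_ge0 ?exprn_ge0 ?(ltW M0) //.
    by rewrite lerXn2r ?nnegrE // divr_ge0.
  have -> : 4 * M * q ^+ n * (1 - (1 / 2) ^+ m.+1) =
    4 * M * q ^+ n * (1 - (1 / 2) ^+ m) + 2 * M * q ^+ n * (1 / 2) ^+ m.
    by rewrite exprS; field.
  exact: lerD.
have tail2 m : cmod (g t - \sum_(j < n) a j * t^-1 ^+ j) <=
   4 * M * q ^+ n + cmod (g t - \sum_(j < n + m) a j * t^-1 ^+ j).
  rewrite -!(big_mkord xpredT (fun j => a j * t^-1 ^+ j)).
  rewrite (@big_cat_nat _ _ _ n 0 (n + m)) ?leq_addr //=.
  set S := \sum_(0 <= _ < _) _; set T := \sum_(n <= _ < _) _.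
  have -> : g t - S = T + (g t - (S + T)) by ring.
  apply: le_trans (cmodD _ _) _; rewrite lerD2r; apply: le_trans (tail m) _.
  rewrite ler_piMr ?mulr_ge0 ?exprn_ge0 ?(ltW M0) // gerBl exprn_ge0 // divr_ge0 //.
have cvt := cv t (lt_trans _ t2).
have {}cvt : cmod (g t - \sum_(j < n) a j * t^-1 ^+ j) @[n --> \oo] --> (0 : R).
  by apply: cvt; rewrite /rho; move: r0; lra.
have cvr : 4 * M * q ^+ n + cmod (g t - \sum_(j < m) a j * t^-1 ^+ j)
    @[m --> \oo] --> 4 * M * q ^+ n + (0 : R).
  by apply: cvgD => //; exact: cvg_cst.
have cvl : (fun _ : nat => cmod (g t - \sum_(j < n) a j * t^-1 ^+ j)) @ \oo -->
    cmod (g t - \sum_(j < n) a j * t^-1 ^+ j) by exact: cvg_cst.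
have := @ler_cvg_to _ _ _ _ _ _ _ _ cvl cvr; rewrite addr0; apply.
near=> m; have nm : (n <= m)%N by near: m; exact: nbhs_infty_ge.
by rewrite -(subnKC nm); exact: tail2.
Unshelve. all: by end_near.
Qed.

End Meromorphic.

(** * Algebra of expansions at infinity, and the degree as an order of growth *)

Section MeromorphicAlgebra.
Variable R : realType.
Local Notation C := R[i].

(** The constants can be raised above prescribed ones. Applied to one series with (1, 1), then to
    another with the constants of the first, it gives both the same constants. *)
Lemma inv_series_const A0 rho0 (g : C -> C) a : inv_series g a ->
  exists A rho : R, [/\ A0 <= A, rho0 <= rho, 1 <= A, 1 <= rho &
    (forall n, cmod (a n) <= A * rho ^+ n) /\
    forall A' rho', A <= A' -> rho <= rho' -> for_large (fun t => forall n,
    cmod (g t - \sum_(j < n) a j * t^-1 ^+ j) <= A' * (rho' / cmod t) ^+ n)].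
Proof.
move=> /inv_series_coef [A A_gt0 [rho rho_gt0 [Ha H]]].
exists (Num.max (Num.max 1 A0) A), (Num.max (Num.max 1 rho0) rho).
rewrite !le_max !lexx !orbT /=; split=> //; split.
  move=> n; apply: le_trans (Ha n) _.
  apply: ler_pM; rewrite ?(ltW A_gt0) ?exprn_ge0 ?(ltW rho_gt0) //.
    by rewrite le_max lexx orbT.
  by rewrite lerXn2r ?nnegrE ?le_max ?(ltW rho_gt0) ?lexx ?orbT // ler01.
move=> A' rho'; rewrite !ge_max -!andbA => /and3P [_ _ AA'] /and3P [_ _ rr'].
apply: for_large_mono2 H (for_large_gt 0) => t Ht t0 n; apply: le_trans (Ht n) _.
have q0 : 0 <= rho / cmod t by rewrite divr_ge0 ?ltW.
apply: ler_pM; rewrite ?(ltW A_gt0) ?exprn_ge0 //.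
have qq : rho / cmod t <= rho' / cmod t by rewrite ler_pM2r ?invr_gt0.
by rewrite lerXn2r ?nnegrE // (le_trans q0).
Qed.

Lemma inv_series_cst (c : C) : inv_series (fun=> c) (fun j => if j is 0 then c else 0).
Proof.
exists (1 + cmod c), 1; split=> //; first by rewrite ltr_pwDl ?cmod_ge0.
apply: for_large_mono (for_large_gt 0) => t t0 [|n].
  by rewrite big_ord0 subr0 expr0 mulr1 lerDr.
rewrite big_ord_recl big1 /= => [|i _]; last by rewrite mul0r.
rewrite mulr1 addr0 subrr cmod0 mulr_ge0 ?addr_ge0 ?cmod_ge0 //.
by rewrite exprn_ge0 // divr_ge0 // ltW.
Qed.

Lemma inv_series_add (g h : C -> C) a b : inv_series g a -> inv_series h b ->
  inv_series (fun t => g t + h t) (fun j => a j + b j).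
Proof.
move=> /(inv_series_const 1 1) [A [rho [_ _ A1 rho1 [_ HA]]]].
move=> /(inv_series_const A rho) [B [rho' [AB rr B1 rho'1 [_ HB]]]].
exists (B + B), rho'; split; rewrite ?addr_gt0 ?(lt_le_trans ltr01) //.
apply: for_large_mono2 (HA B rho' AB rr) (HB B rho' (lexx _) (lexx _)) => t H1 H2 n.
have -> : g t + h t - \sum_(j < n) (a j + b j) * t^-1 ^+ j =
  (g t - \sum_(j < n) a j * t^-1 ^+ j) + (h t - \sum_(j < n) b j * t^-1 ^+ j).
  under eq_bigr => j _ do rewrite mulrDl.
  by rewrite big_split /=; ring.
by apply: le_trans (cmodD _ _) _; rewrite mulrDl lerD.
Qed.

Lemma inv_series_shift (g : C -> C) a l : inv_series g a ->
  inv_series (fun t => t^-1 ^+ l * g t) (fun j => if (j < l)%N then 0 else a (j - l)%N).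
Proof.
move=> /(inv_series_const 1 1) [A [rho [_ _ A1 rho1 [_ HA]]]].
exists A, rho; split; rewrite ?(lt_le_trans ltr01) //.
apply: for_large_mono2 (HA A rho (lexx _) (lexx _)) (for_large_gt 1) => t H1 t1 n.
have t0 : 0 < cmod t by exact: lt_trans t1.
have A0 : 0 <= A by exact: le_trans A1.
have s1 : (cmod t)^-1 <= 1 by rewrite invf_le1 // ltW.
have s0 : 0 <= (cmod t)^-1 by rewrite invr_ge0 ltW.
have sr : (cmod t)^-1 <= rho / cmod t by rewrite ler_peMl.
have q0 : 0 <= rho / cmod t by exact: le_trans sr.
have [ln|ln] := leqP n l.
  rewrite big1 ?subr0 => [|i _]; last by rewrite (leq_trans (ltn_ord i)) // mul0r.
  have := H1 0%N; rewrite big_ord0 subr0 expr0 mulr1 => H0.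
  rewrite cmodM cmodX cmodV mulrC; apply: ler_pM; rewrite ?cmod_ge0 ?exprn_ge0 //.
  apply: le_trans (_ : (cmod t)^-1 ^+ n <= _); first by rewrite ler_wiXn2l.
  by rewrite lerXn2r.
rewrite -(subnKC (ltnW ln)); set m := (n - l)%N.
rewrite big_split_ord /= big1 ?add0r => [|i _]; last by rewrite ltn_ord mul0r.
rewrite (_ : \sum_(i < m) _ = t^-1 ^+ l * \sum_(j < m) a j * t^-1 ^+ j); last first.
  rewrite mulr_sumr; apply: eq_bigr => i _.
  by rewrite ltnNge leq_addr /= addKn exprD mulrCA.
rewrite -mulrBr cmodM cmodX cmodV exprD mulrCA.
by apply: ler_pM; rewrite ?exprn_ge0 ?cmod_ge0 // lerXn2r.
Qed.

Lemma cauchy_prod_sum (a b : nat -> C) s n :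
  \sum_(l < n) (\sum_(i < l.+1) a i * b (l - i)%N) * s ^+ l =
  \sum_(i < n) a i * s ^+ i * \sum_(j < n - i) b j * s ^+ j.
Proof.
elim: n => [|n IH]; first by rewrite !big_ord0.
rewrite big_ord_recr /= IH mulr_suml [RHS]big_ord_recr /= subSnn big_ord1.
rewrite big_ord_recr /= addrA subnn; congr (_ + _); last by ring.
rewrite -big_split /=; apply: eq_bigr => i _.
rewrite subSn ?(ltnW (ltn_ord i)) // big_ord_recr /= mulrDr; congr (_ + _).
have -> : s ^+ n = s ^+ i * s ^+ (n - i) by rewrite -exprD subnKC // ltnW.
by ring.
Qed.

Lemma inv_series_mul (g h : C -> C) a b : inv_series g a -> inv_series h b ->
  inv_series (fun t => g t * h t) (fun l => \sum_(i < l.+1) a i * b (l - i)%N).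
Proof.
move=> /(inv_series_const 1 1) [A [rho [_ _ A1 rho1 [Ha HA]]]].
move=> /(inv_series_const A rho) [B [rho' [AB rr B1 rho'1 [_ HB]]]].
have B0 : 0 <= B by exact: le_trans B1.
have r0 : 0 < rho' by exact: lt_le_trans ltr01 _.
(* The remainder of the product splits into n+1 pieces, each of size q^n with q = rho' / |t|. The
   number of pieces is absorbed by 2^n, which doubles the radius. *)
exists (2 * (B * B)), (2 * rho'); split.
- by rewrite !mulr_gt0 // (lt_le_trans ltr01).
- by rewrite mulr_gt0.
apply: for_large_mono2 (for_large_and (HA B rho' AB rr) (HB B rho' (lexx _) (lexx _))) (for_large_gt 1)
  => t [H1 H2] t1 n.
have t0 : 0 < cmod t by exact: lt_trans t1.
pose q := rho' / cmod t; have -> : 2 * rho' / cmod t = 2 * q by rewrite /q mulrA.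
rewrite exprMn.
have q0 : 0 <= q by rewrite divr_ge0 ?ltW.
rewrite cauchy_prod_sum.
have -> : g t * h t - \sum_(i < n) a i * t^-1 ^+ i * (\sum_(j < n - i) b j * t^-1 ^+ j)
  = (g t - \sum_(i < n) a i * t^-1 ^+ i) * h t +
    \sum_(i < n) a i * t^-1 ^+ i * (h t - \sum_(j < n - i) b j * t^-1 ^+ j).
  under [X in _ = _ + X]eq_bigr => i _ do rewrite mulrBr.
  by rewrite sumrB -mulr_suml; ring.
have hB : cmod (h t) <= B by have := H2 0%N; rewrite big_ord0 subr0 expr0 mulr1.
have E1 : cmod ((g t - \sum_(i < n) a i * t^-1 ^+ i) * h t) <= B * q ^+ n * B.
  by rewrite cmodM; apply: ler_pM; rewrite ?cmod_ge0 //; exact: H1.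
have E2 : cmod (\sum_(i < n) a i * t^-1 ^+ i * (h t - \sum_(j < n - i) b j * t^-1 ^+ j))
   <= n%:R * (B * B * q ^+ n).
  apply: le_trans (cmod_sum _ _ _) _.
  apply: le_trans (_ : \sum_(i < n) B * B * q ^+ n <= _); last first.
    by rewrite sumr_const card_ord mulr_natl.
  apply: ler_sum => i _.
  have -> : B * B * q ^+ n = (B * q ^+ i) * (B * q ^+ (n - i)).
    have -> : q ^+ n = q ^+ i * q ^+ (n - i) by rewrite -exprD subnKC // ltnW.
    by ring.
  rewrite cmodM; apply: ler_pM; rewrite ?cmod_ge0 //.
  rewrite cmodM cmodX cmodV exprMn mulrA ler_wpM2r ?exprn_ge0 ?invr_ge0 ?cmod_ge0 //.
  apply: le_trans (Ha i) _; apply: ler_pM; rewrite ?(le_trans _ A1) ?exprn_ge0 //.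
    exact: le_trans rho1.
  by rewrite lerXn2r ?nnegrE ?(ltW r0) // (le_trans _ rho1).
apply: le_trans (cmodD _ _) _; apply: le_trans (lerD E1 E2) _.
have n2 : n%:R <= 2 ^+ n :> R by rewrite -natrX ler_nat ltnW // ltn_expl.
have n1 : 1 <= 2 ^+ n :> R by rewrite exprn_ege1 // ler1n.
have W0 : 0 <= B * B * q ^+ n by rewrite !mulr_ge0 ?exprn_ge0.
have := ler_wpM2r W0 n2; have := ler_wpM2r W0 n1.
have -> : B * q ^+ n * B = B * B * q ^+ n by ring.
have -> : 2 * (B * B) * (2 ^+ n * q ^+ n) = 2 * (2 ^+ n * (B * B * q ^+ n)) by ring.
lra.
Qed.

Definition mero (h : C -> C) := exists (k : int) a g,
  inv_series g a /\ for_large (fun t => h t = t ^ k * g t).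

Lemma mero_ext h g : (forall t, h t = g t) -> mero h -> mero g.
Proof.
move=> hg [k [a [u [Hu H]]]]; exists k, a, u; split=> //.
by apply: for_large_mono H => t; rewrite hg.
Qed.
Lemma mero_cst c : mero (fun=> c).
Proof.
exists 0; eexists; eexists; split; first exact: (inv_series_cst c).
by apply: for_large_true => t; rewrite expr0z mul1r.
Qed.
Lemma mero_exprz (k : int) : mero (fun t => t ^ k).
Proof.
exists k; eexists; eexists; split; first exact: (inv_series_cst 1).
by apply: for_large_true => t; rewrite mulr1.
Qed.
Lemma mero_mul h g : mero h -> mero g -> mero (fun t => h t * g t).
Proof.
move=> [k [a [u [Hu H]]]] [l [b [v [Hv H']]]]; exists (k + l); eexists; eexists.
split; first exact: (inv_series_mul Hu Hv).
apply: for_large_mono2 (for_large_and H H') (for_large_gt 0) => t [-> ->]; rewrite cmod_gt0 => t0.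
by rewrite expfzDr // mulrACA.
Qed.
(** Padding with zero coefficients lets two functions be written with the same power of t, as
    addition requires. *)
Lemma mero_raise h : mero h -> exists k0 : int, forall k, k0 <= k ->
  exists a g, inv_series g a /\ for_large (fun t => h t = t ^ k * g t).
Proof.
move=> [k0 [a [u [Hu H]]]]; exists k0 => k Hk.
have kE : k = k0 + `|k - k0|%N by rewrite gez0_abs ?subr_ge0 // addrCA subrr addr0.
eexists; eexists; split; first exact: (inv_series_shift `|k - k0|%N Hu).
apply: for_large_mono2 H (for_large_gt 0) => t -> ; rewrite cmod_gt0 => t0.
rewrite {1}kE expfzDr // -mulrA; congr (_ * _); rewrite mulrA -exprnP -exprMn.
by rewrite mulfV // expr1n mul1r.
Qed.
Lemma mero_add h g : mero h -> mero g -> mero (fun t => h t + g t).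
Proof.
move=> /mero_raise [k Hk] /mero_raise [l Hl].
have [|a [u [Hu H]]] := Hk (Num.max k l); first by rewrite le_max lexx.
have [|b [v [Hv H']]] := Hl (Num.max k l); first by rewrite le_max lexx orbT.
exists (Num.max k l); eexists; eexists; split; first exact: (inv_series_add Hu Hv).
by apply: for_large_mono2 H H' => t -> ->; rewrite mulrDr.
Qed.

Lemma mero_sub h g : mero h -> mero g -> mero (fun t => h t - g t).
Proof.
move=> Hh Hg; apply: mero_add => //.
by apply: mero_ext (mero_mul (mero_cst (-1)) Hg) => t; rewrite mulN1r.
Qed.

Lemma mero_horner (p : {poly C}) h : mero h -> mero (fun t => p.[h t]).
Proof.
move=> Hh; elim/poly_ind: p => [|p c IH].
  by apply: mero_ext (mero_cst 0) => t; rewrite horner0.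
apply: mero_ext (mero_add (mero_mul IH Hh) (mero_cst c)) => t.
by rewrite hornerMXaddC.
Qed.

Lemma mero_eval2 (f : {poly {poly C}}) (Phi : C -> C * C) :
  mero (fun t => (Phi t).1) -> mero (fun t => (Phi t).2) ->
  mero (fun t => eval2 f (Phi t)).
Proof.
move=> H1 H2; elim/poly_ind: f => [|f c IH].
  by apply: mero_ext (mero_cst 0) => t; rewrite /eval2 !horner0.
apply: mero_ext (mero_add (mero_mul IH H2) (mero_horner c H1)) => t.
by rewrite eval2D eval2M eval2X eval2C.
Qed.

Lemma mero_infty h : meromorphic_at_infty h <-> mero h.
Proof.
split=> [[c /laurent_inv_series [k [_ [g Hg H]]]]|].
  by exists k; eexists; exists g; split; first exact: Hg.
move=> [k [a [g [Hg H]]]].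
pose c (m : int) := if m <= k then a `|k - m|%N else 0.
exists c, k; split=> [m km|]; first by rewrite /c leNgt km.
have [A [rho [A0 rho0 [B HB]]]] := Hg; have [B' HB'] := H.
pose r := Num.max (Num.max 1 (2 * rho)) (Num.max B B').
exists r; first by rewrite !lt_max ltr01.
move=> t; rewrite !gt_max => /andP [/andP [t1 t2] /andP [/HB Ht /HB' ->]].
have t0 : 0 < cmod t by exact: lt_trans t1.
have tn0 : t != 0 by rewrite -cmod_gt0.
pose q := rho / cmod t.
have q0 : 0 <= q by rewrite divr_ge0 ?ltW.
have q1 : `|q| < 1 by rewrite ger0_norm // ltr_pdivrMr // mul1r; move: t2 rho0; lra.
have cE n : \sum_(j < n) c (k - j%:Z) * t ^ (k - j%:Z) =
    t ^ k * \sum_(j < n) a j * t^-1 ^+ j.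
  rewrite mulr_sumr; apply: eq_bigr => j _.
  rewrite /c gerBl // subKr absz_nat expfzDr // mulrCA exprVn exprnN //.
have cvr : cmod t ^ k * A * q ^+ n @[n --> \oo] --> (0 : R).
  rewrite -[X in _ --> X](mulr0 (cmod t ^ k * A)).
  by apply: cvgM; [exact: cvg_cst | exact: cvg_expr].
have cvl : (fun _ : nat => 0 : R) @ \oo --> (0 : R) by exact: cvg_cst.
refine (squeeze_cvgr _ cvl cvr).
near=> n; rewrite cmod_ge0 /= cE -mulrBr cmodM cmod_exprz cmod_dist -mulrA.
by rewrite ler_wpM2l ?exprz_ge0 ?cmod_ge0.
Unshelve. all: by end_near.
Qed.

Lemma laurent_lead (h : C -> C) c : laurent_at_infty h c ->
  ((forall m, c m = 0) /\ for_large (fun t => h t = 0)) \/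
  exists m : int, [/\ c m != 0, (forall m', m < m' -> c m' = 0),
     isO h m%:~R & isOmega h m%:~R].
Proof.
move=> /laurent_inv_series [k [ck [g Hg H]]].
have cE m : m <= k -> c m = c (k - `|k - m|%N%:Z).
  by move=> mk; rewrite gez0_abs ?subr_ge0 // subKr.
have [[a0 g0]|[j0 [aj0 amin Og Omg]]] := inv_series_lead Hg.
  left; split=> [m|]; last by apply: for_large_mono2 H g0 => t -> ->; rewrite mulr0.
  by have [mk|/ck //] := leP m k; rewrite cE.
right; exists (k - j0%:Z); split=> //.
- move=> m Hm; have [mk|/ck //] := leP m k; rewrite cE // amin //.
  by rewrite -ltz_nat gez0_abs ?subr_ge0 //; move: Hm; lia.
- have := isO_mul (isO_exprz R k) Og; rewrite -[- j0%:R]/(- (j0%:Z)%:~R) -rmorphB /=.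
  by apply: isO_evext; apply: for_large_mono H => t ->.
have [A A0 HA] := Omg; exists A => //.
apply: for_large_mono2 (for_large_and HA H) (for_large_gt 0) => t [H1 ->] t0.
rewrite cmodM rmorphB /= powRD; last by apply/implyP => _; rewrite gt_eqF.
by rewrite cmod_powR_intz mulrCA ler_wpM2l ?cmod_ge0.
Qed.

(** The leading exponent of any expansion of h is determined by the growth of h, so the supremum in
    [deg_infty] is that exponent. *)
Lemma mero_deg (h : C -> C) : mero h ->
  (for_large (fun t => h t = 0) /\ deg_infty h = -oo%E) \/
  exists m : int, [/\ deg_infty h = (m%:~R : R)%:E, isO h m%:~R & isOmega h m%:~R].
Proof.
move=> /mero_infty [c Hc].
have [[c0 h0]|[m [cm cmax Oh Omh]]] := laurent_lead Hc; [left|right].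
  split=> //; rewrite /deg_infty [X in [set _ | _ in X]](_ : _ = set0) ?image_set0 ?ereal_sup0 //.
  apply/seteqP; split=> // m /= [c' Hc' c'm].
  have [[c'0 _]|[m' [_ _ _ Omh]]] := laurent_lead Hc'; first by rewrite c'0 eqxx in c'm.
  have := isO_isOmega (isO_evext (for_large_mono (fun t E => esym E) h0) (isO_0 (m'%:~R - 1))) Omh; lra.
exists m; split=> //; apply/eqP; rewrite eq_le; apply/andP; split.
  apply: ge_ereal_sup => _ [m' [c' Hc' c'm] <-]; rewrite lee_fin.
  have [[c'0 _]|[m1 [_ Hm1 _ Omh1]]] := laurent_lead Hc'; first by rewrite c'0 eqxx in c'm.
  have := isO_isOmega Oh Omh1; rewrite !ler_int; apply: le_trans.
  by rewrite leNgt; apply: contra c'm => /Hm1 ->.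
by apply: ereal_sup_ubound; exists m => //; exists c.
Qed.

End MeromorphicAlgebra.

(** * Exponents along curves *)

Section LojCurves.
Variable R : realType.
Local Notation C := R[i].

(** Orders are integers, so an order not at most k is at least k + 1. *)
Lemma mero_dichotomy (h : C -> C) (k : int) : mero h ->
  isO h k%:~R \/ isOmega h (k + 1)%:~R.
Proof.
move=> /mero_deg [[h0 _]|[m [_ Oh Omh]]].
  by left; apply: isO_evext (isO_0 _); apply: for_large_mono h0 => t ->.
have [mk|km] := leP m k; first by left; apply: isO_le Oh; rewrite ler_int.
by right; apply: isOmega_le Omh; rewrite ler_int -ltzD1 ltrD2r.
Qed.

Lemma deg_infty_le (h : C -> C) (k : int) : mero h -> isO h k%:~R ->
  (deg_infty h <= (k%:~R : R)%:E)%E.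
Proof.
move=> /mero_deg [[_ ->]|[m [-> _ Omh]]] Oh; first exact: leNye.
by rewrite lee_fin; exact: isO_isOmega Oh Omh.
Qed.

Lemma isO_deg_infty (h : C -> C) (k : int) : mero h ->
  (deg_infty h <= (k%:~R : R)%:E)%E -> isO h k%:~R.
Proof.
move=> /mero_deg [[h0 _]|[m [-> Oh _]]].
  by move=> _; apply: isO_evext (isO_0 _); apply: for_large_mono h0 => t ->.
by rewrite lee_fin => mk; exact: isO_le mk Oh.
Qed.

Lemma deg_infty_lt0 (h : C -> C) : mero h ->
  (deg_infty h < 0)%E <-> isO h (-1).
Proof.
move=> Hh; split=> [h0|Oh].
  apply: (@isO_deg_infty h (-1)) => //.
  have [[_ ->]|[m [dm _ _]]] := mero_deg Hh; first exact: leNye.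
  move: h0; rewrite dm lte_fin lee_fin ltrz0 ler_int => m0.
  by rewrite -ltzD1 addNr.
apply: le_lt_trans (@deg_infty_le h (-1) Hh Oh) _.
by rewrite lte_fin ltrN10.
Qed.

Lemma deg_infty2P (phi1 phi2 : C -> C) : mero phi1 -> mero phi2 ->
  let d := deg_infty2 (fun t => (phi1 t, phi2 t)) in
  (d = -oo%E /\ for_large (fun t => phi1 t = 0 /\ phi2 t = 0)) \/
  exists m : int, [/\ d = (m%:~R : R)%:E, isO phi1 m%:~R, isO phi2 m%:~R &
    isOmega phi1 m%:~R \/ isOmega phi2 m%:~R].
Proof.
move=> H1 H2 d; rewrite /d /deg_infty2 /=.
have := mero_deg H1; have := mero_deg H2.
move=> [[z2 ->]|[m2 [-> O2 Om2]]] [[z1 ->]|[m1 [-> O1 Om1]]].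
- by left; rewrite maxxx; split=> //; exact: for_large_and.
- right; exists m1; split=> //.
    by apply: isO_evext (isO_0 _); apply: for_large_mono z2 => t ->.
  by left.
- right; exists m2; split=> //; first by rewrite max_r ?leNye.
    by apply: isO_evext (isO_0 _); apply: for_large_mono z1 => t ->.
  by right.
right; have [m12|m12] := leP m1 m2.
  exists m2; split=> //; first by rewrite max_r // lee_fin ler_int.
    by apply: isO_le O1; rewrite ler_int.
  by right.
exists m1; split=> //; first by rewrite max_l // lee_fin ler_int ltW.
  by apply: isO_le O2; rewrite ler_int ltW.
by left.
Qed.

(** The bound on [phi] makes the degree of the pair exactly D. By integrality, order at most -1 is
    the same as negative degree. *)
Definition puiseux_curve (f : {poly {poly C}}) (l : C) (D : nat) (phi : C -> C) :=
  [/\ (0 < D)%N, mero phi, isO phi D%:R & isO (fun t => eval2 f (t ^+ D, phi t) - l) (-1)].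

Lemma puiseux_curve_fibre f l D phi : puiseux_curve f l D phi ->
  loj_fibre_curve f l (fun t => (t ^+ D, phi t)) /\
  deg_infty2 (fun t => (t ^+ D, phi t)) = (D%:R : R)%:E.
Proof.
move=> [D0 Hphi Ophi Of].
have mD : mero (fun t : C => t ^+ D) := mero_exprz R D.
have dE : deg_infty2 (fun t => (t ^+ D, phi t)) = (D%:R : R)%:E.
  have [[_ H]|[m [-> O1 O2 Om12]]] := deg_infty2P mD Hphi.
    have [t [[/eqP tD _] t0]] := for_large_ex (for_large_and H (for_large_gt 0)).
    by move: tD t0; rewrite expf_eq0 D0 /= cmod_gt0 => ->.
  congr _%:E; apply/eqP; rewrite eq_le; apply/andP; split.
    case: Om12 => [Om1|Om2]; last exact: isO_isOmega Ophi Om2.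
    exact: isO_isOmega (isO_exprz R D) Om1.
  exact: isO_isOmega O1 (isOmega_exprz R D).
split=> //; split=> /=.
- by apply/mero_infty.
- by apply/mero_infty.
- by rewrite dE lte_fin ltr0n.
- apply/deg_infty_lt0 => //; apply: mero_sub (mero_cst l).
  by apply: mero_eval2.
Qed.

Lemma edivr_fin (x d : R) : 0 < d -> (x%:E / d%:E)%E = (x / d)%:E.
Proof. by move=> d0; rewrite inver gt_eqF. Qed.
Lemma edivr_Ny (d : R) : 0 < d -> (-oo / d%:E)%E = -oo%E.
Proof. by move=> d0; rewrite inver gt_eqF // mulNyr gtr0_sg ?invr_gt0 // mul1e. Qed.

Lemma loj_at_le f l D phi (m : R) : puiseux_curve f l D phi ->
  isO (fun t => eval2 (dx f) (t ^+ D, phi t)) m ->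
  isO (fun t => eval2 (dy f) (t ^+ D, phi t)) m ->
  (loj_at f l <= (m / D%:R : R)%:E)%E.
Proof.
move=> P Ox Oy; have [F dE] := puiseux_curve_fibre P.
have [D0 Hphi _ _] := P; have D0' : 0 < D%:R :> R by rewrite ltr0n.
have mD : mero (fun t : C => t ^+ D) := mero_exprz R D.
have L1 : (loj_at f l <= deg_infty2 (fun t => grad f (t ^+ D, phi t)%R) / (D%:R : R)%:E)%E.
  by apply: ereal_inf_lbound; eexists; [exact: F | rewrite dE].
apply: le_trans L1 _.
have gx : mero (fun t => eval2 (dx f) (t ^+ D, phi t)) by exact: mero_eval2.
have gy : mero (fun t => eval2 (dy f) (t ^+ D, phi t)) by exact: mero_eval2.
have := deg_infty2P gx gy; rewrite /= -[deg_infty2 _]/(deg_infty2 (fun t => grad f (t ^+ D, phi t))).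
move=> [[-> _]|[m' [-> O1 O2 Om12]]]; first by rewrite edivr_Ny // leNye.
rewrite edivr_fin // lee_fin ler_pM2r ?invr_gt0 //.
by case: Om12; exact: isO_isOmega.
Qed.

Lemma loj_at_ge f l D phi (e : R) : puiseux_curve f l D phi ->
  (e%:E <= loj_at f l)%E ->
  isOmega (fun t => eval2 (dx f) (t ^+ D, phi t)) (e * D%:R) \/
  isOmega (fun t => eval2 (dy f) (t ^+ D, phi t)) (e * D%:R).
Proof.
move=> P eL; have [F dE] := puiseux_curve_fibre P.
have [D0 Hphi _ _] := P; have D0' : 0 < D%:R :> R by rewrite ltr0n.
have mD : mero (fun t : C => t ^+ D) := mero_exprz R D.
have {}eL : (e%:E <= deg_infty2 (fun t => grad f (t ^+ D, phi t)%R) / (D%:R : R)%:E)%E.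
  apply: le_trans eL _; apply: ereal_inf_lbound; eexists; first exact: F.
  by rewrite dE.
have gx : mero (fun t => eval2 (dx f) (t ^+ D, phi t)) by exact: mero_eval2.
have gy : mero (fun t => eval2 (dy f) (t ^+ D, phi t)) by exact: mero_eval2.
have := deg_infty2P gx gy; rewrite /= -[deg_infty2 _]/(deg_infty2 (fun t => grad f (t ^+ D, phi t))).
move=> [[dd _]|[m' [dd O1 O2 Om12]]]; move: eL; rewrite dd.
  by rewrite edivr_Ny // leeNy_eq.
rewrite edivr_fin // lee_fin ler_pdivlMr // => eD.
by case: Om12 => /(isOmega_le eD); [left|right].
Qed.

Lemma loj_at_lower f l (al : R) :
  (forall (phi1 phi2 : C -> C) (m e : int), 0 < m -> mero phi1 -> mero phi2 ->
    isO phi1 m%:~R -> isO phi2 m%:~R -> isOmega phi1 m%:~R \/ isOmega phi2 m%:~R ->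
    isO (fun t => eval2 f (phi1 t, phi2 t) - l) (-1) ->
    isO (fun t => eval2 (dx f) (phi1 t, phi2 t)) e%:~R ->
    isO (fun t => eval2 (dy f) (phi1 t, phi2 t)) e%:~R -> al * m%:~R <= e%:~R) ->
  (al%:E <= loj_at f l)%E.
Proof.
move=> H; apply: le_ereal_inf_tmp => _ [Phi [P1 P2 P3 P4] <-].
pose phi1 t := (Phi t).1; pose phi2 t := (Phi t).2.
have m1 : mero phi1 by apply/mero_infty.
have m2 : mero phi2 by apply/mero_infty.
have PE : Phi = (fun t => (phi1 t, phi2 t)).
  by apply/funext => t; rewrite /phi1 /phi2; case: (Phi t).
rewrite PE in P3 P4 *.
have [[dN _]|[m [dm O1 O2 Om12]]] := deg_infty2P m1 m2.
  by move: P3; rewrite dN.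
move: P3; rewrite dm lte_fin ltr0z => m0.
have m0' : 0 < m%:~R :> R by rewrite ltr0z.
have Of : isO (fun t => eval2 f (phi1 t, phi2 t) - l) (-1).
  by apply/deg_infty_lt0 => //; apply: mero_sub (mero_cst l); exact: mero_eval2.
have gx : mero (fun t => eval2 (dx f) (phi1 t, phi2 t)) by exact: mero_eval2.
have gy : mero (fun t => eval2 (dy f) (phi1 t, phi2 t)) by exact: mero_eval2.
have := deg_infty2P gx gy; rewrite /= -[deg_infty2 _]/(deg_infty2 (fun t => grad f (phi1 t, phi2 t))).
move=> [[_ zz]|[e [-> Ox Oy _]]]; last first.
  by rewrite edivr_fin // lee_fin ler_pdivlMr //; exact: (H phi1 phi2).
(* If the gradient vanishes along the curve, every integer is an admissible bound for its order;
   this one contradicts the hypothesis. *)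
exfalso; pose e := Num.floor (al * m%:~R) - 1.
have : al * m%:~R <= e%:~R.
  apply: (H phi1 phi2) => //.
    by apply: isO_evext (isO_0 _); apply: for_large_mono zz => t [].
  by apply: isO_evext (isO_0 _); apply: for_large_mono zz => t [].
rewrite /e rmorphB /= => H1; have := floor_le (al * m%:~R); lra.
Qed.

(** Says that h is the Laurent polynomial p / t^k and h' its formal derivative, so that
    differentiating along a curve stays algebraic. *)
Definition Lderiv (h h' : C -> C) := exists (p : {poly C}) (k : nat),
  forall t, t != 0 ->
    h t = p.[t] / t ^+ k /\ h' t = (t * p^`().[t] - k%:R * p.[t]) / t ^+ k.+1.

Lemma Lderiv_ext h h' g g' : (forall t, t != 0 -> h t = g t) ->
  (forall t, t != 0 -> h' t = g' t) -> Lderiv h h' -> Lderiv g g'.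
Proof.
move=> hg hg' [p [k H]]; exists p, k => t t0.
by rewrite -hg // -hg' //; exact: H.
Qed.
Lemma Lderiv_cst c : Lderiv (fun=> c) (fun=> 0).
Proof.
exists c%:P, 0%N => t t0; rewrite derivC hornerC horner0 mulr0 mul0r subr0 mul0r.
by rewrite expr0 divr1.
Qed.
Lemma Lderiv_exp n : Lderiv (fun t => t ^+ n) (fun t => n%:R * t ^+ n.-1).
Proof.
exists 'X^n, 0%N => t t0; rewrite derivXn hornerMn !hornerXn mul0r subr0 expr1.
rewrite expr0 divr1; split=> //; case: n => [|n]; first by rewrite !mul0r mulr0n mulr0 mul0r.
by rewrite /= -mulr_natl mulrC; field.
Qed.
Lemma Lderiv_inv : Lderiv (fun t => t^-1) (fun t => - t^-1 ^+ 2).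
Proof.
exists 1, 1%N => t t0; rewrite derivC horner0 hornerC mulr0 mulr1 sub0r.
by split; [rewrite mul1r | rewrite exprVn mulN1r].
Qed.
Lemma Lderiv_add h h' g g' : Lderiv h h' -> Lderiv g g' ->
  Lderiv (fun t => h t + g t) (fun t => h' t + g' t).
Proof.
move=> [p [k H]] [q [l H']]; exists (p * 'X^l + q * 'X^k), (k + l)%N => t t0.
have [-> ->] := H t t0; have [-> ->] := H' t t0.
have D n : ('X^n)^`().[t] = n%:R * t ^+ n / t.
  rewrite derivXn hornerMn hornerXn -mulr_natl.
  by case: n => [|n]; rewrite ?mul0r // exprS /=; field.
rewrite derivD !derivM !(hornerD, hornerM) !D !hornerXn !exprS !exprD natrD.
have tk : t ^+ k != 0 by rewrite expf_neq0.
have tl : t ^+ l != 0 by rewrite expf_neq0.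
by move: (t ^+ k) (t ^+ l) tk tl => a b a0 b0; split; field; rewrite ?t0 ?a0 ?b0.
Qed.
Lemma Lderiv_mul h h' g g' : Lderiv h h' -> Lderiv g g' ->
  Lderiv (fun t => h t * g t) (fun t => h' t * g t + h t * g' t).
Proof.
move=> [p [k H]] [q [l H']]; exists (p * q), (k + l)%N => t t0.
have [-> ->] := H t t0; have [-> ->] := H' t t0.
rewrite derivM !(hornerD, hornerM) !exprS !exprD natrD.
have tk : t ^+ k != 0 by rewrite expf_neq0.
have tl : t ^+ l != 0 by rewrite expf_neq0.
by move: (t ^+ k) (t ^+ l) tk tl => a b a0 b0; split; field; rewrite ?t0 ?a0 ?b0.
Qed.

Lemma Lderiv_horner (p : {poly C}) h h' : Lderiv h h' ->
  Lderiv (fun t => p.[h t]) (fun t => p^`().[h t] * h' t).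
Proof.
move=> H; elim/poly_ind: p => [|p c IH].
  by apply: Lderiv_ext (Lderiv_cst 0) => t _; rewrite ?derivC !horner0 ?mul0r.
apply: Lderiv_ext (Lderiv_add (Lderiv_mul IH H) (Lderiv_cst c)) => t _.
  by rewrite hornerMXaddC.
by rewrite derivD derivM derivX derivC !(hornerD, hornerM, hornerX, hornerC); ring.
Qed.

Lemma dxMXaddC (f : {poly {poly C}}) c : dx (f * 'X + c%:P) = dx f * 'X + (c^`())%:P.
Proof.
apply/polyP => i; rewrite /dx coef_map_id0 ?deriv0 // !coefD !coefMX !coefC.
rewrite derivD coef_map_id0 ?deriv0 //.
by case: i => [|i] /=; rewrite ?derivC ?deriv0 ?coefE //.
Qed.

Lemma Lderiv_eval2 (f : {poly {poly C}}) a a' b b' : Lderiv a a' -> Lderiv b b' ->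
  Lderiv (fun t => eval2 f (a t, b t))
    (fun t => eval2 (dx f) (a t, b t) * a' t + eval2 (dy f) (a t, b t) * b' t).
Proof.
move=> Ha Hb; elim/poly_ind: f => [|f c IH].
  apply: Lderiv_ext (Lderiv_cst 0) => t _; rewrite /eval2 ?horner0 //.
  by rewrite /dx /dy map_poly0 deriv0 !horner0 !mul0r addr0.
apply: Lderiv_ext (Lderiv_add (Lderiv_mul IH Hb) (Lderiv_horner c Ha)) => t _.
  by rewrite eval2D eval2M eval2X eval2C.
rewrite dxMXaddC /dy derivD derivM derivX derivC addr0 mulr1 -/(dy f).
by rewrite !eval2D !eval2M eval2X !eval2C /=; ring.
Qed.

Lemma isO_poly (p : {poly C}) n : (size p <= n.+1)%N -> isO (fun t => p.[t]) n%:R.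
Proof.
move=> sp; apply: (@isO_ext _ (fun t => \sum_(i <- iota 0 n.+1) p`_i * t ^+ i)).
  move=> t; rewrite (horner_coef_wide _ sp) -(big_mkord xpredT (fun i => p`_i * t ^+ i)).
  by rewrite /index_iota subn0.
have Hi i : (i <= n)%N -> isO (fun t : C => p`_i * t ^+ i) n%:R.
  move=> Hi; apply: isO_mulc; apply: isO_le (isO_exprz R i).
  by rewrite ler_nat.
have : forall s : seq nat, (forall i, i \in s -> (i <= n)%N) ->
  isO (fun t => \sum_(i <- s) p`_i * t ^+ i) n%:R.
  elim=> [|i s IH] Hs; first by apply: isO_ext (isO_0 _) => t; rewrite big_nil.
  apply: isO_ext (isO_add (Hi i (Hs _ (mem_head _ _))) (IH _)) => [t|j Hj].
    by rewrite big_cons.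
  by apply: Hs; rewrite inE Hj orbT.
by apply=> i; rewrite mem_iota ltnS.
Qed.

Lemma isOmega_poly (p : {poly C}) n : size p = n.+1 -> isOmega (fun t => p.[t]) n%:R.
Proof.
move=> sp; have pn : p`_n != 0.
  by have := lead_coef_eq0 p; rewrite lead_coefE sp /= => ->; rewrite -size_poly_gt0 sp.
have Oml : isOmega (fun t => p`_n * t ^+ n) n%:R.
  exists (cmod p`_n); first by rewrite cmod_gt0.
  by apply: for_large_true => t; rewrite cmodM powR_mulrn ?cmod_ge0 // cmodX.
have pE t : p.[t] = p`_n * t ^+ n - - (\poly_(i < n) p`_i).[t].
  rewrite opprK horner_poly (horner_coef_wide t (leqnn _)) sp big_ord_recr /=.
  exact: addrC.
case: n sp pn Oml pE => [|n] sp pn Oml pE.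
  apply: isOmega_evext Oml; apply: for_large_true => t.
  by rewrite pE horner_poly big_ord0 oppr0 subr0.
apply: (@isOmega_evext _ (fun t => p`_n.+1 * t ^+ n.+1 - - (\poly_(i < n.+1) p`_i).[t])).
  by apply: for_large_true => t; rewrite -pE.
apply: (isOmega_sub Oml (isO_opp (isO_poly (size_poly _ _)))).
by rewrite ltr_nat.
Qed.

Lemma isO_div_exp (h : C -> C) a (k : nat) : isO h a -> isO (fun t => h t / t ^+ k) (a - k%:R).
Proof.
move=> H; have -> : a - k%:R = a + (- k%:Z)%:~R by rewrite rmorphN.
by apply: isO_ext (isO_mul H (isO_exprz R (- k%:Z))) => t; rewrite exprnN.
Qed.
Lemma isOmega_div_exp (h : C -> C) a (k : nat) : isOmega h a -> isOmega (fun t => h t / t ^+ k) (a - k%:R).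
Proof.
move=> [A A0 H]; exists A => //; apply: for_large_mono2 H (for_large_gt 0) => t H t0.
rewrite powRD; last by apply/implyP => _; rewrite gt_eqF.
rewrite cmodM cmodV cmodX powR_invn ?cmod_ge0 // mulrA.
by rewrite ler_wpM2r // invr_ge0 exprn_ge0 // ltW.
Qed.

Lemma Lderiv_lead (h h' : C -> C) : Lderiv h h' -> (for_large (fun t => h t = 0) /\ for_large (fun t => h' t = 0)) \/
  exists m : int, [/\ isOmega h m%:~R, isO h m%:~R, isO h' (m%:~R - 1) &
    m != 0 -> isOmega h' (m%:~R - 1)].
Proof.
move=> [p [k H]]; have [p0|p0] := eqVneq p 0.
  left; split; apply: for_large_mono (for_large_gt 0) => t; rewrite cmod_gt0 => /H [hE h'E].
    by rewrite hE p0 horner0 mul0r.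
  by rewrite h'E p0 deriv0 !horner0 !mulr0 subrr mul0r.
right; move: p0; rewrite -size_poly_gt0; case sp: (size p) => [//|n] _.
exists (n%:Z - k%:Z).
have He : for_large (fun t => p.[t] / t ^+ k = h t).
  by apply: for_large_mono (for_large_gt 0) => t; rewrite cmod_gt0 => /H [-> _].
(* The numerator of h'. Its i-th coefficient is (i - k) p_i, so the top one is lost only if the
   order n - k of h is 0. *)
pose r := 'X * p^`() - k%:R *: p.
have He' : for_large (fun t => r.[t] / t ^+ k.+1 = h' t).
  apply: for_large_mono (for_large_gt 0) => t; rewrite cmod_gt0 => /H [_ ->].
  by rewrite /r !(hornerD, hornerN, hornerM, hornerX, hornerZ).
have rcoef i : r`_i = (i%:R - k%:R) * p`_i.
  rewrite coefB coefXM coefZ coef_deriv mulrBl; congr (_ - _).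
  by case: i => [|i]; rewrite /= ?mul0r // mulr_natl.
have sr : (size r <= n.+1)%N.
  by apply/leq_sizeP => i Hi; rewrite rcoef nth_default ?mulr0 // sp.
have mE : ((n%:Z - k%:Z)%:~R : R) = n%:R - k%:R by rewrite rmorphB.
have mE1 : ((n%:Z - k%:Z)%:~R - 1 : R) = n%:R - k.+1%:R by rewrite mE mulrSr; ring.
split.
- by rewrite mE; apply: isOmega_evext He _; apply: isOmega_div_exp; exact: isOmega_poly.
- by rewrite mE; apply: isO_evext He _; apply: isO_div_exp; apply: isO_poly; rewrite sp.
- by rewrite mE1; apply: isO_evext He' _; apply: isO_div_exp; exact: isO_poly.
rewrite subr_eq0 => nk.
rewrite mE1; apply: isOmega_evext He' _; apply: isOmega_div_exp; apply: isOmega_poly.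
apply/eqP; rewrite eqn_leq sr /= ltnNge; apply/negP => sr'.
have : r`_n = 0 by rewrite nth_default.
rewrite rcoef => /eqP; rewrite mulf_eq0 subr_eq0 eqr_nat; move: nk; rewrite eqz_nat => /negPf -> /=.
by have := lead_coef_eq0 p; rewrite lead_coefE sp /= => ->; rewrite -size_poly_eq0 sp.
Qed.

Lemma isO_Lderiv (h h' : C -> C) a : Lderiv h h' -> isO h a -> isO h' (a - 1).
Proof.
move=> /Lderiv_lead [[_ z]|[m [Omh _ Oh' _]]] Oh.
  by apply: isO_evext (isO_0 _); apply: for_large_mono z => t ->.
by apply: isO_le Oh'; rewrite lerD2r; exact: isO_isOmega Oh Omh.
Qed.
(** Integration of orders: a negative order rules out a dominant constant term, the only one that
    differentiation would lose. *)
Lemma isO_Ld_inv (h h' : C -> C) a b : Lderiv h h' -> isO h b -> b < 0 -> isO h' a -> isO h (a + 1).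
Proof.
move=> /Lderiv_lead [[z _]|[m [Omh Oh _ Omh']]] Ohb b0 Oh'.
  by apply: isO_evext (isO_0 _); apply: for_large_mono z => t ->.
have mb : m%:~R <= b by exact: isO_isOmega Ohb Omh.
have m0 : m != 0 by rewrite -(intr_eq0 R) lt_eqF // (le_lt_trans mb).
have := isO_isOmega Oh' (Omh' m0) => H.
by apply: isO_le Oh; move: H; lra.
Qed.

End LojCurves.

(** * Branches of a curve at infinity *)

Section Branches.
Variable R : realType.
Local Notation C := R[i].

(** The class to which the construction of branches applies; it contains f - l and, up to a scalar,
    f_y. *)
Definition tdeg_monic (n : nat) (G : {poly {poly C}}) :=
  [/\ size G = n.+1, G`_n = 1 &
      forall i, (i <= n)%N -> (size (G`_i)%R <= (n - i).+1)%N].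

(* G in the coordinates s = 1 / x, Y = y / x, with the pole at s = 0 removed. *)
Definition at_infty (n : nat) (G : {poly {poly C}}) : {poly {poly C}} :=
  \poly_(i < n.+1) \poly_(j < (n - i).+1) (G`_i)`_(n - i - j).

Lemma horner_rev (p : {poly C}) m s : (size p <= m.+1)%N -> s != 0 ->
  (\poly_(j < m.+1) p`_(m - j)).[s] = s ^+ m * p.[s^-1].
Proof.
move=> sp s0; rewrite horner_poly (horner_coef_wide _ sp) mulr_sumr.
rewrite (reindex_inj rev_ord_inj) /=; apply: eq_bigr => i _.
have Hi : (i <= m)%N by rewrite -ltnS.
rewrite subSS subKn // mulrCA; congr (_ * _).
have -> : s ^+ m = s ^+ (m - i) * s ^+ i by rewrite -exprD subnK.
by rewrite -mulrA -exprMn mulfV // expr1n mulr1.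
Qed.

Lemma eval2_sum (G : {poly {poly C}}) m x y : (size G <= m)%N ->
  eval2 G (x, y) = \sum_(i < m) (G`_i).[x] * y ^+ i.
Proof.
move=> sG; rewrite /eval2 (horner_coef_wide _ sG) /= horner_sum.
by apply: eq_bigr => i _; rewrite hornerM horner_exp hornerC.
Qed.

Lemma eval2_at_infty n G s Y : tdeg_monic n G -> s != 0 ->
  eval2 (at_infty n G) (s, Y) = s ^+ n * eval2 G (s^-1, Y / s).
Proof.
move=> [sG Gn Gs] s0; rewrite (@eval2_sum _ n.+1) ?size_poly //.
rewrite (@eval2_sum G n.+1) ?sG // mulr_sumr; apply: eq_bigr => i _.
have Hi : (i <= n)%N by rewrite -ltnS.
rewrite coef_poly ltn_ord horner_rev ?Gs // expr_div_n.
have -> : s ^+ n = s ^+ (n - i) * s ^+ i by rewrite -exprD subnK.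
have si : s ^+ i != 0 by rewrite expf_neq0.
by field.
Qed.

Lemma at_infty_monic n G : tdeg_monic n G ->
  size (at_infty n G) = n.+1 /\ at_infty n G \is monic.
Proof.
move=> [sG Gn Gs]; have top : (at_infty n G)`_n = 1.
  rewrite coef_poly ltnSn subnn Gn; apply/polyP => -[|j].
    by rewrite coef_poly.
  by rewrite coef_poly ltnS ltn0 coef1.
have sz : size (at_infty n G) = n.+1.
  by apply: size_poly_eq; have := top; rewrite coef_poly ltnSn => ->; exact: oner_neq0.
by split=> //; rewrite monicE lead_coefE sz top.
Qed.

Lemma eval2_ramify D (P : {poly {poly C}}) s Y :
  eval2 (ramify D P) (s, Y) = eval2 P (s ^+ D, Y).
Proof.
rewrite (@eval2_sum _ (size P)) ?size_poly // (@eval2_sum P (size P)) //.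
apply: eq_bigr => i _; rewrite /ramify coef_map /= horner_comp hornerXn //.
Qed.

(** Returns from the chart at infinity: y = Y / s with s = t^-D, where Y = c(1/t). *)
Definition branch (D : nat) (c : {poly C}) (t : C) : C := t ^+ D * c.[t^-1].

Lemma pchar_complex : [pchar C] =i pred0.
Proof. exact: pchar_num. Qed.

Lemma branch_Lderiv D c : exists h', Lderiv (branch D c) h'.
Proof. by eexists; apply: Lderiv_mul (Lderiv_exp _ _) (Lderiv_horner c (Lderiv_inv R)). Qed.

Lemma mero_inv : mero (fun t : C => t^-1).
Proof. by apply: mero_ext (mero_exprz R (- 1)) => t; rewrite exprN1. Qed.

Lemma branch_mero D c : mero (branch D c).
Proof. by apply: mero_mul (mero_exprz R D) _; exact: mero_horner mero_inv. Qed.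

Lemma horner_bounded (c : {poly C}) : exists2 A : R, 0 < A & forall s, cmod s <= 1 -> cmod c.[s] <= A.
Proof.
exists (1 + \sum_(i < size c) cmod c`_i).
  by rewrite ltr_pwDl // sumr_ge0 // => i _; exact: cmod_ge0.
move=> s s1; rewrite horner_coef; apply: le_trans (cmod_sum _ _ _) _.
apply: le_trans (_ : \sum_(i < size c) cmod c`_i <= _); last by rewrite lerDr.
apply: ler_sum => i _; rewrite cmodM cmodX ler_piMr ?cmod_ge0 //.
by rewrite exprn_ile1 ?cmod_ge0.
Qed.

Lemma isO_branch D c : isO (branch D c) D%:R.
Proof.
have [A A0 HA] := horner_bounded c; exists A; apply: for_large_mono (for_large_gt 1) => t t1.
rewrite cmodM cmodX powR_mulrn ?cmod_ge0 // mulrC.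
rewrite ler_wpM2r ?exprn_ge0 ?cmod_ge0 // HA // cmodV invf_le1 ?ltW //.
exact: lt_trans t1.
Qed.

(** The remainder is controlled only for bounded Y = y / x, hence the restriction on y. *)
Lemma puiseux_approx n G (K : nat) : tdeg_monic n G ->
  exists D (q : seq {poly C}), [/\ (0 < D)%N, size q = n &
   forall M : R, exists2 A : R, 0 < A & for_large (fun t => forall y,
     cmod y <= M * cmod t `^ D%:R ->
     cmod (eval2 G (t ^+ D, y) - \prod_(c <- q) (y - branch D c t))
       <= A * cmod t `^ (- (K * D)%:R))].
Proof.
move=> HG; have [sI Im] := at_infty_monic HG.
(* Returning from the chart multiplies by x^n, which costs n orders of precision. *)
have [D [q [E [D0 sq HE]]]] := approx_puiseux pchar_complex (K + n) Im.
exists D, q; split=> //; first by move: sq; rewrite sI => -[].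
have {}sq : size q = n by move: sq; rewrite sI => -[].
have key t Y : t != 0 -> eval2 G (t ^+ D, t ^+ D * Y) =
    \prod_(c <- q) (t ^+ D * Y - branch D c t) +
    t^-1 ^+ (K * D) * eval2 E (t^-1, Y).
  move=> t0; have tD : t ^+ D != 0 by rewrite expf_neq0.
  have := congr1 (fun P => eval2 P (t^-1, Y)) HE.
  rewrite /= eval2_ramify eval2D eval2M eval2C /= hornerXn [t^-1 ^+ D]exprVn.
  rewrite (eval2_at_infty _ HG) ?invr_eq0 // !invrK [Y * _]mulrC => H.
  have -> : eval2 G (t ^+ D, t ^+ D * Y) =
    (t ^+ D) ^+ n * (((t ^+ D)^-1) ^+ n * eval2 G (t ^+ D, t ^+ D * Y)).
    by rewrite mulrA -exprMn mulfV // expr1n mul1r.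
  rewrite H mulrDr; congr (_ + _).
    rewrite -{1}sq -(iter_mulr_1) -(count_predT q) -big_const_seq.
    rewrite (_ : eval2 _ _ = \prod_(c <- q) (Y - c.[t^-1])).
      by rewrite -big_split /=; apply: eq_bigr => c _; rewrite /branch mulrBr.
    rewrite /eval2 horner_prod -[_.[_]]/(horner_eval t^-1 _) rmorph_prod.
    by apply: eq_bigr => c _; rewrite /= hornerXsubC /horner_eval hornerD hornerN hornerC.
  rewrite mulrA; congr (_ * _).
  rewrite mulnDl exprD mulrCA [(n * D)%N]mulnC [t^-1 ^+ (D * n)]exprM exprVn -exprMn.
  by rewrite mulfV // expr1n mulr1.
move=> M; have [A [N [A0 HA]]] := polybound_eval2 E.
pose X := Num.max 1 M.
have X1 : 1 <= X by rewrite le_max lexx.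
exists (A * X ^+ N + 1); first by rewrite ltr_pwDr // mulr_ge0 ?exprn_ge0 // (le_trans _ X1).
apply: for_large_mono (for_large_gt 1) => t t1 y yM.
have t_gt0 : 0 < cmod t by exact: lt_trans t1.
have t0 : t != 0 by rewrite -cmod_gt0.
have tD : t ^+ D != 0 by rewrite expf_neq0.
have yE : y = t ^+ D * (y / t ^+ D) by rewrite mulrCA mulfV ?mulr1.
rewrite {1 2}yE key // addrC addKr cmodM powR_invn ?cmod_ge0 // mulrC.
rewrite cmodX cmodV exprVn ler_wpM2r ?invr_ge0 ?exprn_ge0 ?cmod_ge0 //.
have [||H _] := HA X (t^-1, y / t ^+ D) (t^-1, y / t ^+ D) X1; last first.
- by apply: le_trans H _; rewrite lerDl.
- rewrite maxnorm_le /= cmodV; apply/andP; split.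
    by apply: le_trans X1; rewrite invf_le1 // ltW.
  rewrite cmodM cmodV cmodX ler_pdivrMr ?exprn_gt0 // -powR_mulrn ?cmod_ge0 //.
  by apply: le_trans yM _; rewrite ler_wpM2r ?powR_ge0 // le_max lexx orbT.
rewrite maxnorm_le /= cmodV; apply/andP; split.
  by apply: le_trans X1; rewrite invf_le1 // ltW.
rewrite cmodM cmodV cmodX ler_pdivrMr ?exprn_gt0 // -powR_mulrn ?cmod_ge0 //.
by apply: le_trans yM _; rewrite ler_wpM2r ?powR_ge0 // le_max lexx orbT.
Qed.

(** Cauchy's bound: the coefficient of y^i grows at most like |x|^(n-i), so for larger y the term
    y^n would outweigh the others. *)
Lemma root_bound n G : (0 < n)%N -> tdeg_monic n G ->
  exists2 M : R, 1 <= M & forall x y, cmod (eval2 G (x, y)) <= 1 ->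
    cmod y <= M * Num.max 1 (cmod x).
Proof.
move=> n0 [sG Gn Gs].
have [B B0 HB] : exists2 B : R, 0 < B & forall x i, (i < n)%N ->
    cmod (G`_i).[x] <= B * Num.max 1 (cmod x) ^+ (n - i).
  exists (1 + \sum_(i < n) \sum_(j < (n - i).+1) cmod (G`_i)`_j).
    rewrite ltr_pwDl // sumr_ge0 // => i _; apply: sumr_ge0 => j _; exact: cmod_ge0.
  move=> x i Hi; rewrite (horner_coef_wide _ (Gs i (ltnW Hi))).
  apply: le_trans (cmod_sum _ _ _) _.
  set X := Num.max 1 (cmod x); have X1 : 1 <= X by rewrite le_max lexx.
  apply: le_trans (_ : (\sum_(j < (n - i).+1) cmod (G`_i)`_j) * X ^+ (n - i) <= _).
    rewrite mulr_suml; apply: ler_sum => j _; rewrite cmodM cmodX ler_wpM2l ?cmod_ge0 //.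
    apply: (@le_trans _ _ (X ^+ j)).
      by rewrite lerXn2r ?nnegrE ?cmod_ge0 ?(le_trans ler01) // le_max lexx orbT.
    by rewrite ler_weXn2l // -ltnS.
  rewrite ler_wpM2r ?exprn_ge0 ?(le_trans ler01) //.
  rewrite [leRHS]addrC (bigD1 (Ordinal Hi)) //= -addrA lerDl addr_ge0 //.
  by apply: sumr_ge0 => j _; apply: sumr_ge0 => k _; exact: cmod_ge0.
exists (1 + B *+ n); first by rewrite lerDl mulrn_wge0 // ltW.
move=> x y g1; set X := Num.max 1 (cmod x).
have X1 : 1 <= X by rewrite le_max lexx.
have X0 : 0 <= X by exact: le_trans X1.
rewrite leNgt; apply/negP => yM.
have yX : X <= cmod y.
  by apply: le_trans (ltW yM); rewrite ler_peMl // lerDl mulrn_wge0 // ltW.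
have y1 : 1 <= cmod y by exact: le_trans yX.
have yn : cmod y ^+ n <= (1 + B *+ n) * X * cmod y ^+ n.-1.
  have gE : y ^+ n = eval2 G (x, y) - \sum_(i < n) (G`_i).[x] * y ^+ i.
    rewrite (@eval2_sum G n.+1) ?sG // big_ord_recr /= Gn hornerC mul1r.
    by rewrite addrAC subrr add0r.
  rewrite -cmodX gE; apply: le_trans (cmodB _ _) _.
  rewrite !mulrDl mul1r lerD //.
    apply: le_trans g1 _; rewrite -[leLHS]mulr1.
    by apply: ler_pM => //; rewrite exprn_ege1.
  apply: le_trans (cmod_sum _ _ _) _.
  have -> : B *+ n * X * cmod y ^+ n.-1 = \sum_(i < n) B * X * cmod y ^+ n.-1.
    by rewrite sumr_const card_ord !mulrnAl.
  apply: ler_sum => i _; rewrite cmodM cmodX.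
  apply: le_trans (ler_wpM2r _ (HB x i (ltn_ord i))) _; first by rewrite exprn_ge0 ?cmod_ge0.
  rewrite -!mulrA ler_wpM2l ?(ltW B0) //.
  have -> : (n - i)%N = (n - i.+1).+1 by rewrite -subSn.
  rewrite exprS -mulrA ler_wpM2l //.
  have -> : (n.-1)%N = ((n - i.+1) + i)%N by have := ltn_ord i; lia.
  rewrite exprD ler_wpM2r ?exprn_ge0 ?cmod_ge0 //.
  by rewrite lerXn2r ?nnegrE ?cmod_ge0.
have y_gt0 : 0 < cmod y ^+ n.-1 by rewrite exprn_gt0 // (lt_le_trans ltr01).
by move: yn; rewrite -{1}(prednK n0) exprS ler_pM2r // leNgt yM.
Qed.

End Branches.

(** * The exponent on a fibre *)

Section FibreExponent.
Variable R : realType.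
Local Notation C := R[i].

Lemma tdeg_monic_subC n (f : {poly {poly C}}) l : (0 < n)%N ->
  tdeg_monic n f -> tdeg_monic n (f - l%:P%:P).
Proof.
move=> n0 [sf fn fs].
have coef i : (f - l%:P%:P)`_i = f`_i - (if i == 0%N then l%:P else 0).
  by rewrite coefB coefC.
split.
- rewrite size_polyDl ?sf // size_polyN; apply: leq_ltn_trans (size_polyC_leq1 _) _.
  by rewrite ltnS.
- by rewrite coef gtn_eqF // subr0.
move=> i Hi; rewrite coef; case: eqP => [->|_]; last by rewrite subr0 fs.
apply: leq_trans (size_polyD _ _) _; rewrite geq_max fs // size_polyN.
by apply: leq_trans (size_polyC_leq1 _) _.
Qed.
Lemma eval2_subC (f : {poly {poly C}}) l z : eval2 (f - l%:P%:P) z = eval2 f z - l.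
Proof. by rewrite eval2D eval2N eval2C hornerC. Qed.

Lemma at_x_monic n (f : {poly {poly C}}) x : tdeg_monic n f ->
  at_x x f \is monic /\ size (at_x x f) = n.+1.
Proof.
move=> [sf fn fs].
have lf : lead_coef f = 1 by rewrite lead_coefE sf.
have sx : size (at_x x f) = n.+1.
  by rewrite size_map_poly_id0 ?sf // lf /horner_eval hornerC oner_neq0.
split=> //; rewrite monicE lead_coefE sx coef_map /= fn.
by rewrite /horner_eval hornerC.
Qed.

Lemma root_near (p : {poly C}) n y : (0 < n)%N -> p \is monic -> size p = n.+1 ->
  exists2 g, root p g & cmod (y - g) ^+ n <= cmod p.[y].
Proof.
move=> n0 pm sp; have [gs gsE] := closed_field_poly_normal p.
rewrite (eqP pm) scale1r in gsE.
have sgs : size gs = n by move: sp; rewrite gsE size_prod_XsubC => -[].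
have [|g g_in gmin] := @seq_argmin _ gs y; first by rewrite -size_eq0 sgs -lt0n.
exists g; first by rewrite gsE root_prod_XsubC.
rewrite gsE horner_prod_XsubC cmod_prod -sgs -prod_cst_seq !big_seq.
by apply: ler_prod => h Hh; rewrite cmod_ge0 gmin.
Qed.

Lemma fibre_near n (f : {poly {poly C}}) l x y : (0 < n)%N -> tdeg_monic n f ->
  exists2 g, eval2 f (x, g) = l & cmod (y - g) ^+ n <= cmod (eval2 f (x, y) - l).
Proof.
move=> n0 /(tdeg_monic_subC l n0) Hf.
have [pm sp] := at_x_monic x Hf; have [g rg Hg] := root_near y n0 pm sp.
exists g.
  by apply/eqP; rewrite -subr_eq0 -eval2_subC eval2_at_x.
by rewrite -eval2_subC eval2_at_x.
Qed.

Lemma fibre_bound n (f : {poly {poly C}}) l : (0 < n)%N -> tdeg_monic n f ->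
  exists2 M : R, 1 <= M & forall x y, cmod (eval2 f (x, y) - l) <= 1 ->
    cmod y <= M * Num.max 1 (cmod x).
Proof.
move=> n0 /(tdeg_monic_subC l n0) Hf.
have [M M1 HM] := root_bound n0 Hf; exists M => // x y Hy.
by apply: HM; rewrite eval2_subC.
Qed.

Lemma powR_compare (M nu : R) : 1 <= M -> exists2 A : R, 0 < A &
  forall a b : R, 0 < a -> a <= b -> b <= M * a ->
    A * b `^ nu <= a `^ nu /\ A * a `^ nu <= b `^ nu.
Proof.
move=> M1; have M0 : 0 < M by exact: lt_le_trans M1.
have MM : 1 <= M `^ `|nu| by rewrite -[leLHS](powRr0 M); exact: ler_powR.
exists (M `^ `|nu|)^-1; first by rewrite invr_gt0 (lt_le_trans ltr01).
have MM0 : 0 < M `^ `|nu| by exact: lt_le_trans MM.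
move=> a b a0 ab bM; have b0 : 0 < b by exact: lt_le_trans ab.
have [a0' b0'] : a \in Num.nneg /\ b \in Num.nneg by rewrite !nnegrE !ltW.
have Ma0 : M * a \in Num.nneg by rewrite nnegrE mulr_ge0 ?ltW.
have powM r : (M * a) `^ r = M `^ r * a `^ r by rewrite powRM ?ltW.
rewrite !ler_pdivrMl //.
have [nu0|nu0] := leP 0 nu.
  have abn : a `^ nu <= b `^ nu by rewrite ge0_ler_powR.
  split; last by apply: le_trans abn _; rewrite ler_peMl ?powR_ge0.
  by rewrite ger0_norm // -powM ge0_ler_powR.
have nuN : nu = - `|nu| by rewrite ltr0_norm ?opprK.
have nn : 0 <= `|nu| by [].
move: (`|nu|) nuN nn MM MM0 => k -> k0 MM MM0; rewrite !powRN.
have abn : a `^ k <= b `^ k by rewrite ge0_ler_powR.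
have ak : 0 < a `^ k by rewrite powR_gt0.
have bk : 0 < b `^ k by rewrite powR_gt0.
have iab : (b `^ k)^-1 <= (a `^ k)^-1 by rewrite lef_pV2 ?posrE.
split; first by apply: le_trans iab _; rewrite ler_peMl // invr_ge0 ltW.
rewrite -[leLHS]mul1r ler_pdivrMr // mulrAC ler_pdivlMr // mul1r.
by rewrite -powM ge0_ler_powR.
Qed.

(* On the fibre |y| is at most a multiple of |x|, so |z| may be replaced by |x|. *)
Lemma Nexp_fibreP n (f : {poly {poly C}}) l F nu : (0 < n)%N -> tdeg_monic n f ->
  Nexp F (fibre f l) nu <-> exists2 A : R, 0 < A &
    for_large (fun x => forall y, eval2 f (x, y) = l -> A * cmod x `^ nu <= maxnorm (F (x, y))).
Proof.
move=> n0 Hf; have [M M1 HM] := fibre_bound l n0 Hf.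
have M0 : 0 < M by exact: lt_le_trans M1.
have [k k0 Hk] := powR_compare nu M1.
have Hz x y : eval2 f (x, y) = l -> cmod y <= M * Num.max 1 (cmod x).
  by move=> Hl; apply: HM; rewrite Hl subrr cmod0.
have zx x y : 1 < cmod x -> eval2 f (x, y) = l ->
   cmod x <= maxnorm (x, y) /\ maxnorm (x, y) <= M * cmod x.
  move=> x1 /Hz Hy; rewrite (maxnorm_lel (x, y)) maxnorm_le /=; split=> //.
  rewrite max_r ?(ltW x1) // in Hy; rewrite Hy andbT ler_peMl ?cmod_ge0 //.
split=> [[A [B [A0 B0 H]]]|[A A0 [B HB]]].
  exists (A * k); first by rewrite mulr_gt0.
  apply: for_large_mono (for_large_gt (Num.max 1 B)) => x; rewrite gt_max => /andP [x1 xB] y Hy.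
  have [H1 H2] := zx x y x1 Hy.
  apply: le_trans (H _ Hy (lt_le_trans xB H1)).
  rewrite -mulrA ler_wpM2l ?(ltW A0) //.
  by have [] := Hk (cmod x) (maxnorm (x, y)) (lt_trans ltr01 x1) H1 H2.
exists (A * k), (M * Num.max 1 B); split.
- by rewrite mulr_gt0.
- by rewrite mulr_gt0 // lt_max ltr01.
move=> [x y] Hy Bz; have Hl : eval2 f (x, y) = l by [].
have xB : Num.max 1 B < cmod x.
  rewrite ltNge; apply/negP => xB.
  have : maxnorm (x, y) <= M * Num.max 1 B.
    rewrite maxnorm_le /=; apply/andP; split.
      by apply: le_trans xB _; rewrite ler_peMl // le_max ler01.
    apply: le_trans (Hz _ _ Hl) _; rewrite ler_pM2l // ge_max xB le_max lexx //.
  by rewrite leNgt Bz.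
move: xB; rewrite gt_max => /andP [x1 xB].
have [H1 H2] := zx x y x1 Hl.
apply: le_trans (HB x xB y Hl).
rewrite -mulrA ler_wpM2l ?(ltW A0) //.
by have [] := Hk (cmod x) (maxnorm (x, y)) (lt_trans ltr01 x1) H1 H2.
Qed.

Lemma branches_close n (f : {poly {poly C}}) l (K : nat) : (0 < n)%N -> tdeg_monic n f ->
  exists D (q : seq {poly C}), [/\ (0 < D)%N, size q = n,
   (forall c, c \in q ->
     isO (fun t => eval2 f (t ^+ D, branch D c t) - l) (- (K * D)%:R)) &
   exists2 A : R, 0 < A & for_large (fun t => forall y, eval2 f (t ^+ D, y) = l ->
     cmod y <= A * cmod t ^+ D /\
     exists2 c, c \in q & cmod (y - branch D c t) <= A * cmod t `^ (- (K * D)%:R))].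
Proof.
move=> n0 Hf; have [M M1 HM] := fibre_bound l n0 Hf.
(* A product of n distances that is O(|x|^-(n K)) forces one of them to be O(|x|^-K). *)
have [D [q [D0 sq HA]]] := puiseux_approx (n * K) (tdeg_monic_subC l n0 Hf).
exists D, q; split=> // [c c_in|].
  have [B HB] := @isO_branch R D c; have [A A0 HAt] := HA B.
  apply: (@isO_le _ _ (- (n * K * D)%:R)); first by rewrite lerN2 ler_nat leq_mul // leq_pmull.
  exists A; apply: for_large_mono2 HB HAt => t Bt /(_ _ Bt).
  rewrite eval2_subC (_ : \prod_(_ <- _) _ = 0) ?subr0 //.
  by rewrite (big_rem _ c_in) /= subrr mul0r.
have [A A0 HAt] := HA M.
exists (Num.max M (1 + A)); first by rewrite lt_max (lt_le_trans ltr01 M1).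
apply: for_large_mono2 HAt (for_large_gt 1) => t Ht t1 y Hy.
have tD1 : 1 <= cmod t ^+ D by rewrite exprn_ege1 // ltW.
have yM : cmod y <= M * cmod t ^+ D.
  have := HM (t ^+ D) y; rewrite Hy subrr cmod0 => /(_ ler01).
  by rewrite cmodX max_r.
split.
  by apply: le_trans yM _; rewrite ler_wpM2r ?exprn_ge0 ?cmod_ge0 // le_max lexx.
apply: contrapT => nc.
have Hc c : c \in q -> (1 + A) * cmod t `^ (- (K * D)%:R) <= cmod (y - branch D c t).
  move=> c_in; rewrite leNgt; apply/negP => /ltW H; apply: nc; exists c => //.
  by apply: le_trans H _; rewrite ler_wpM2r ?powR_ge0 // le_max lexx orbT.
have := Ht y; rewrite powR_mulrn ?cmod_ge0 // => /(_ yM).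
rewrite eval2_subC Hy subrr sub0r cmodN cmod_prod leNgt => /negP; apply.
have t0 : 0 < cmod t by exact: lt_trans t1.
have A1 : 0 <= 1 + A by rewrite addr_ge0 // ltW.
apply: (@lt_le_trans _ _ (((1 + A) * cmod t `^ (- (K * D)%:R)) ^+ n)).
  rewrite exprMn -[(_ `^ _) ^+ n]powR_mulrn ?powR_ge0 // -powRrM mulNr -natrM.
  rewrite (_ : (K * D * n)%N = (n * K * D)%N); last by lia.
  rewrite ltr_pM2r ?powR_gt0 //; apply: (@lt_le_trans _ _ (1 + A)).
    by rewrite ltrDr.
  by rewrite ler_eXnr // lerDl ltW.
rewrite -sq -prod_cst_seq !big_seq; apply: ler_prod => c c_in.
by rewrite mulr_ge0 ?powR_ge0 //= Hc.
Qed.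

(** The exponent N comes before B: it enters the precision, which is fixed before the branches and
    the bound B on them exist. *)
Lemma eval2_lip (g : {poly {poly C}}) : exists N : nat, forall (B : R),
  exists2 A : R, 0 < A & forall (r : R) x y y', 1 <= r -> cmod x <= B * r ->
    cmod y <= B * r -> cmod y' <= B * r ->
    cmod (eval2 g (x, y) - eval2 g (x, y')) <= A * r ^+ N * cmod (y - y').
Proof.
have [A [N [A0 HA]]] := polybound_eval2 g; exists N => B.
pose X := Num.max 1 B; have X1 : 1 <= X by rewrite le_max lexx.
exists (A * X ^+ N + 1); first by rewrite ltr_pwDr // mulr_ge0 ?exprn_ge0 // (le_trans _ X1).
move=> r x y y' r1 xB yB yB'; have r0 : 0 <= r by exact: le_trans r1.
have BX : B * r <= X * r by rewrite ler_wpM2r // le_max lexx orbT.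
have [|||_ H] := HA (X * r) (x, y) (x, y').
- by apply: (le_trans X1); rewrite ler_peMr // (le_trans _ X1).
- by rewrite maxnorm_le /= !(le_trans _ BX).
- by rewrite maxnorm_le /= !(le_trans _ BX).
apply: le_trans H _; rewrite /maxnorm /= subrr cmod0 max_r ?cmod_ge0 //.
rewrite ler_wpM2r ?cmod_ge0 // exprMn mulrA ler_wpM2r ?exprn_ge0 //.
by rewrite lerDl.
Qed.

Lemma branches_eval n (f : {poly {poly C}}) l (gs : seq {poly {poly C}}) (K : nat) :
  (0 < n)%N -> tdeg_monic n f ->
  exists D (q : seq {poly C}), [/\ (0 < D)%N, size q = n,
   (forall c, c \in q ->
     isO (fun t => eval2 f (t ^+ D, branch D c t) - l) (- (K * D)%:R)) &
   exists2 A : R, 0 < A & for_large (fun t => forall y, eval2 f (t ^+ D, y) = l ->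
     exists2 c, c \in q & forall g, g \in gs ->
       cmod (eval2 g (t ^+ D, y) - eval2 g (t ^+ D, branch D c t))
         <= A * cmod t `^ (- (K * D)%:R))].
Proof.
move=> n0 Hf.
have [N HN] : exists N : nat, forall B : R, exists2 A : R, 0 < A &
    forall g, g \in gs -> forall (r : R) x y y', 1 <= r -> cmod x <= B * r ->
    cmod y <= B * r -> cmod y' <= B * r ->
    cmod (eval2 g (x, y) - eval2 g (x, y')) <= A * r ^+ N * cmod (y - y').
  elim: gs => [|g gs [N IH]]; first by exists 0%N => B; exists 1.
  have [N' HN'] := eval2_lip g; exists (N + N')%N => B.
  have [A A0 HA] := IH B; have [A' A'0 HA'] := HN' B.
  exists (Num.max A A') => [|h]; first by rewrite lt_max A0.
  have mono (r a a' : R) (k m : nat) z : 1 <= r -> 0 <= z -> 0 < a -> a <= a' ->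
      (k <= m)%N -> a * r ^+ k * z <= a' * r ^+ m * z.
    move=> r1 z0 a0 aa km; rewrite ler_wpM2r //; apply: ler_pM; rewrite ?(ltW a0) //.
      by rewrite exprn_ge0 // (le_trans ler01).
    by rewrite ler_weXn2l.
  rewrite inE => /orP [/eqP ->|Hh] r x y y' r1 xB yB yB'.
    apply: le_trans (HA' r x y y' r1 xB yB yB') _.
    by apply: mono; rewrite ?cmod_ge0 ?leq_addl // le_max lexx orbT.
  apply: le_trans (HA h Hh r x y y' r1 xB yB yB') _.
  by apply: mono; rewrite ?cmod_ge0 ?leq_addr // le_max lexx.
(* The additional N orders pay for the Lipschitz constants of the polynomials in [gs], of size
   |x|^N. *)
have [D [q [D0 sq Hq [A A0 HA]]]] := branches_close l (K + N) n0 Hf.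
exists D, q; split=> // [c /Hq|].
  by apply: isO_le; rewrite lerN2 ler_nat leq_mul2r leq_addr orbT.
have [B HB] : exists B : R, for_large (fun t => forall c, c \in q ->
    cmod (branch D c t) <= B * cmod t ^+ D).
  elim: (q) => [|c s [B HB]]; first by exists 0; apply: for_large_true.
  have [B' HB'] := @isO_branch R D c; exists (Num.max B B').
  apply: for_large_mono2 HB HB' => t H1 H2 c'; rewrite inE => /orP [/eqP ->|/H1].
    rewrite -powR_mulrn ?cmod_ge0 //; apply: le_trans H2 _.
    by rewrite ler_wpM2r ?powR_ge0 // le_max lexx orbT.
  by move/le_trans; apply; rewrite ler_wpM2r ?exprn_ge0 ?cmod_ge0 // le_max lexx.
pose X := Num.max 1 (Num.max A B).
have [A' A'0 HA'] := HN X; exists (A' * A); first by rewrite mulr_gt0.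
apply: for_large_mono2 (for_large_and HA HB) (for_large_gt 1) => t [H1 H2] t1 y Hy.
have [yA [c c_in yc]] := H1 y Hy; have bB := H2 c c_in.
exists c => // g Hg.
have tD1 : 1 <= cmod t ^+ D by rewrite exprn_ege1 // ltW.
have tD0 : 0 <= cmod t ^+ D by exact: le_trans tD1.
have toX Z v : Z <= X -> v <= Z * cmod t ^+ D -> v <= X * cmod t ^+ D.
  by move=> ZX vZ; apply: le_trans vZ _; rewrite ler_wpM2r.
have xX : cmod (t ^+ D) <= X * cmod t ^+ D.
  by apply: (toX 1); rewrite ?mul1r ?cmodX // le_max lexx.
have yX : cmod y <= X * cmod t ^+ D by apply: toX yA; rewrite !le_max lexx orbT.
have bX : cmod (branch D c t) <= X * cmod t ^+ D by apply: toX bB; rewrite !le_max lexx !orbT.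
have t0 : 0 < cmod t by exact: lt_trans t1.
apply: le_trans (HA' g Hg _ _ _ _ tD1 xX yX bX) _.
rewrite -!mulrA ler_wpM2l ?(ltW A'0) // mulrC.
apply: le_trans (ler_wpM2r _ yc) _; first by rewrite exprn_ge0.
rewrite -mulrA ler_wpM2l ?(ltW A0) // -exprM -powR_mulrn ?cmod_ge0 // -powRD; last first.
  by apply/implyP => _; rewrite gt_eqF.
apply: ler_powR; first exact: ltW.
by rewrite mulnDl natrD [(D * N)%N]mulnC; lra.
Qed.

(** One family of branches serves all e' >= e, so the exponent may be improved after the branches
    are fixed. [K0] lets the caller prescribe how small f - l is on them. *)
Lemma fibre_branches n (f : {poly {poly C}}) l (e : R) (K0 : nat) :
  (0 < n)%N -> tdeg_monic n f ->
  exists D (q : seq {poly C}), [/\ (0 < D)%N, size q = n,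
    (forall c, c \in q ->
      isO (fun t => eval2 f (t ^+ D, branch D c t) - l) (- (K0 * D)%:R)) &
    forall e', e <= e' -> (forall c, c \in q ->
        isOmega (fun t => eval2 (dx f) (t ^+ D, branch D c t)) (e' * D%:R) \/
        isOmega (fun t => eval2 (dy f) (t ^+ D, branch D c t)) (e' * D%:R)) ->
      Nexp (grad f) (fibre f l) e'].
Proof.
(* K exceeds -e, so passing from a fibre point to its branch changes the gradient by less than the
   order |x|^e'. *)
move=> n0 Hf; pose K := (K0 + `|Num.floor (- e)|.+2)%N.
have [D [q [D0 sq Hq [A A0 HA]]]] := branches_eval l [:: dx f; dy f] K n0 Hf.
exists D, q; split=> // [c /Hq|e' ee' Hc].
  by apply: isO_le; rewrite lerN2 ler_nat leq_mul2r leq_addr orbT.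
have Ke : - K%:R < e'.
  apply: lt_le_trans ee'; rewrite /K natrD.
  have := floorD1_gt (- e); set z := Num.floor _ => ez.
  have : z%:~R <= `|z|%N%:R :> R by rewrite -[_%:R]/((`|z|%N%:Z)%:~R) ler_int abszE ler_norm.
  have K00 : 0 <= K0%:R :> R by [].
  by rewrite -natr1 -natr1; move: ez; rewrite rmorphD /=; lra.
apply/(Nexp_fibreP l (grad f) e' n0 Hf).
have Hgrad c : c \in q -> exists2 a : R, 0 < a & for_large (fun t =>
    a * cmod t `^ (e' * D%:R) <= maxnorm (grad f (t ^+ D, branch D c t))).
  move=> c_in; have [[a a0 Ha]|[a a0 Ha]] := Hc c c_in; exists a => //.
    by apply: for_large_mono Ha => t Ht; apply: le_trans Ht _; exact: (maxnorm_lel (grad f _)).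
  by apply: for_large_mono Ha => t Ht; apply: le_trans Ht _; exact: (maxnorm_ler (grad f _)).
have [a a0 Ha] := for_large_seq_min
  (fun c a b t _ ba H => le_trans (ler_wpM2r (powR_ge0 _ _) ba) H) Hgrad.
exists (a / 2); first by rewrite divr_gt0.
suff H : for_large (fun t => forall y, eval2 f (t ^+ D, y) = l ->
    a / 2 * cmod (t ^+ D) `^ e' <= maxnorm (grad f (t ^+ D, y))).
  by apply: for_large_mono (for_large_root D0 H) => x [t ->].
have eD : - (K * D)%:R < e' * D%:R by rewrite natrM -mulNr ltr_pM2r // ltr0n.
apply: for_large_mono2 (for_large_and HA Ha) (for_large_powR_lt A eD (divr_gt0 a0 (ltr0Sn R 1))).
move=> t [H1 H2] H3 y Hy; have [c c_in {}Hc] := H1 y Hy; have {}H2 := H2 c c_in.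
have := le_lt_trans (Hc (dx f) (ltac:(by rewrite inE eqxx))) H3; rewrite cmod_dist => ex.
have := le_lt_trans (Hc (dy f) (ltac:(by rewrite !inE eqxx orbT))) H3; rewrite cmod_dist => ey.
have -> : cmod (t ^+ D) `^ e' = cmod t `^ (e' * D%:R).
  by rewrite cmodX -powR_mulrn ?cmod_ge0 // -powRrM mulrC.
move: H2 ex ey; set u := _ `^ _; rewrite (_ : a * u = a / 2 * u + a / 2 * u); last by field.
set v := a / 2 * u; rewrite /grad !le_max /= => /orP [Hx ex _|Hx _ ey]; apply/orP; [left|right].
  by have := cmod_le_dist (eval2 (dx f) (t ^+ D, branch D c t)) (eval2 (dx f) (t ^+ D, y)); lra.
by have := cmod_le_dist (eval2 (dy f) (t ^+ D, branch D c t)) (eval2 (dy f) (t ^+ D, y)); lra.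
Qed.

Lemma loj_at_Nexp n (f : {poly {poly C}}) l (e : R) : (0 < n)%N -> tdeg_monic n f ->
  (e%:E <= loj_at f l)%E -> Nexp (grad f) (fibre f l) e.
Proof.
move=> n0 Hf eL; have [D [q [D0 sq Hq HN]]] := fibre_branches l e 1 n0 Hf.
apply: HN => // c c_in; apply: loj_at_ge eL; split=> //.
- exact: branch_mero.
- exact: isO_branch.
- by apply: isO_le (Hq c c_in); rewrite lerN2 mul1n ler1n.
Qed.

End FibreExponent.

(** * Curves near the fibre replaced by curves on it *)

Section CurvesOnFibre.
Variable R : realType.
Local Notation C := R[i].

Lemma for_large_comp (P : C -> Prop) psi (m : R) : 0 < m -> isOmega psi m -> for_large P ->
  for_large (fun t => P (psi t)).
Proof.
move=> m0 [A A0 HA] [B HB].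
apply: for_large_mono2 HA (for_large_powR_lt B m0 A0) => t H1 H2; apply: HB.
by apply: lt_le_trans H1; move: H2; rewrite powRr0 mulr1.
Qed.

Lemma powR_growth psi (m nu : R) : isO psi m -> isOmega psi m ->
  exists2 c : R, 0 < c & for_large (fun t => c * cmod t `^ (nu * m) <= cmod (psi t) `^ nu).
Proof.
move=> [A2 HA2] [A1 A10 HA1]; pose M := Num.max 1 (A2 / A1).
have M1 : 1 <= M by rewrite le_max lexx.
have [k k0 Hk] := powR_compare nu M1.
exists (k * A1 `^ nu); first by rewrite mulr_gt0 // powR_gt0.
apply: for_large_mono2 (for_large_and HA1 HA2) (for_large_gt 0) => t [H1 H2] t0.
have a0 : 0 < A1 * cmod t `^ m by rewrite mulr_gt0 // powR_gt0.
have [|_ H] := Hk _ (cmod (psi t)) a0 H1.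
  apply: le_trans H2 _; rewrite mulrA ler_wpM2r ?powR_ge0 //.
  by rewrite -ler_pdivrMr // le_max lexx orbT.
apply: le_trans H; rewrite powRM ?powR_ge0 ?(ltW A10) // -powRrM [m * nu]mulrC mulrA.
exact: lexx.
Qed.

(** Tests an exponent along a curve whose ordinate [gam] is any function, such as one obtained by
    choosing fibre points. *)
Lemma Nexp_curve n (f : {poly {poly C}}) l nu psi gam (m w : R) :
  (0 < n)%N -> tdeg_monic n f -> Nexp (grad f) (fibre f l) nu -> 0 < m ->
  isO psi m -> isOmega psi m -> for_large (fun t => eval2 f (psi t, gam t) = l) ->
  isO (fun t => eval2 (dx f) (psi t, gam t)) w ->
  isO (fun t => eval2 (dy f) (psi t, gam t)) w -> nu * m <= w.
Proof.
move=> n0 Hf /(Nexp_fibreP l (grad f) nu n0 Hf) [A A0 HA] m0 Op Omp Hl [Ax Hx] [Ay Hy].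
have [c c0 Hc] := powR_growth nu Op Omp.
rewrite leNgt; apply/negP => wnu.
have Ac : 0 < A * c by rewrite mulr_gt0.
have [t [[[H1 H2] [H3 H4]] [H5 H6]]] := for_large_ex (for_large_and
  (for_large_and (for_large_and (for_large_comp m0 Omp HA) Hl) (for_large_and Hx Hy))
  (for_large_and Hc (for_large_powR_lt (Num.max Ax Ay) wnu Ac))).
have := H1 _ H2; rewrite leNgt => /negP; apply.
apply: (@le_lt_trans _ _ (Num.max Ax Ay * cmod t `^ w)).
  rewrite maxnorm_le /grad /=; apply/andP; split.
    by apply: le_trans H3 _; rewrite ler_wpM2r ?powR_ge0 // le_max lexx.
  by apply: le_trans H4 _; rewrite ler_wpM2r ?powR_ge0 // le_max lexx orbT.
apply: lt_le_trans H6 _; rewrite -mulrA ler_wpM2l //; exact: ltW.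
Qed.

(** Near the fibre |y| is at most a multiple of max(1, |x|), so the growth of the pair is carried by
    x. *)
Lemma isOmega_abscissa n (f : {poly {poly C}}) l phi1 phi2 (m : R) :
  (0 < n)%N -> tdeg_monic n f -> 0 < m ->
  isO (fun t => eval2 f (phi1 t, phi2 t) - l) (-1) ->
  isOmega phi1 m \/ isOmega phi2 m -> isOmega phi1 m.
Proof.
move=> n0 Hf m0 Of [//|[A A0 HA]].
have [M M1 HM] := fibre_bound l n0 Hf.
have M0 : 0 < M by exact: lt_le_trans M1.
exists (A / M); first by rewrite divr_gt0.
apply: for_large_mono2 (for_large_and HA (isO_small Of (ltrN10 R) ltr01)) (for_large_powR_lt M m0 A0) => t [H1 H2].
rewrite powRr0 mulr1 => H3.
have H4 := HM _ _ (ltW H2).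
have H5 : M < M * Num.max 1 (cmod (phi1 t)) by apply: lt_le_trans H3 (le_trans H1 H4).
move: H5; rewrite -[ltLHS]mulr1 ltr_pM2l // lt_max ltxx /= => H5.
move: H4; rewrite max_r ?(ltW H5) // => H4.
by rewrite mulrAC ler_pdivrMr // [leRHS]mulrC; exact: (le_trans H1).
Qed.

Lemma isO_maxnorm (phi1 phi2 : C -> C) (m : R) : 0 <= m -> isO phi1 m -> isO phi2 m ->
  exists2 B : R, 1 <= B & for_large (fun t => 1 <= cmod t `^ m /\
    maxnorm (phi1 t, phi2 t) <= B * cmod t `^ m).
Proof.
move=> m0 [B1 H1] [B2 H2]; exists (Num.max 1 (Num.max B1 B2)).
  by rewrite le_max lexx.
apply: for_large_mono2 (for_large_and H1 H2) (for_large_gt 1) => t [h1 h2] t1; split.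
  by rewrite -[leLHS](powRr0 (cmod t)); apply: ler_powR => //; exact: ltW.
rewrite maxnorm_le /=; apply/andP; split.
  by apply: le_trans h1 _; rewrite ler_wpM2r ?powR_ge0 // !le_max lexx orbT.
by apply: le_trans h2 _; rewrite ler_wpM2r ?powR_ge0 // !le_max lexx !orbT.
Qed.

Definition lip_exponent (g : {poly {poly C}}) (N : nat) :=
  forall N' (phi1 phi2 psi1 psi2 : C -> C) (m r : R), (N <= N')%N -> 0 <= m ->
  isO phi1 m -> isO phi2 m -> isO psi1 m -> isO psi2 m ->
  isO (fun t => phi1 t - psi1 t) r -> isO (fun t => phi2 t - psi2 t) r ->
  isO (fun t => eval2 g (phi1 t, phi2 t) - eval2 g (psi1 t, psi2 t)) (N'%:R * m + r).

Lemma isO_eval2_sub (g : {poly {poly C}}) : exists N : nat, lip_exponent g N.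
Proof.
have [A [N [A0 HA]]] := polybound_eval2 g; exists N.
move=> N' phi1 phi2 psi1 psi2 m r NN m0 O1 O2 O3 O4 [E1 HE1] [E2 HE2].
apply: (@isO_le _ _ (N%:R * m + r)); first by rewrite lerD2r ler_wpM2r // ler_nat.
have [B B1 HB] := isO_maxnorm m0 O1 O2; have [B' B'1 HB'] := isO_maxnorm m0 O3 O4.
pose X := Num.max B B'; exists (A * X ^+ N * Num.max E1 E2).
apply: for_large_mono2 (for_large_and HB HB') (for_large_and (for_large_and HE1 HE2) (for_large_gt 0)) => t [[t1 h1] [_ h2]] [[h3 h4] t0].
have X1 : 1 <= X by rewrite le_max B1.
have [|||_ H] := HA (X * cmod t `^ m) (phi1 t, phi2 t) (psi1 t, psi2 t).
- by apply: mulr_ege1.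
- by apply: le_trans h1 _; rewrite ler_wpM2r ?powR_ge0 // le_max lexx.
- by apply: le_trans h2 _; rewrite ler_wpM2r ?powR_ge0 // le_max lexx orbT.
apply: le_trans H _; rewrite powRD; last by apply/implyP => _; rewrite gt_eqF.
have -> : cmod t `^ (N%:R * m) = (cmod t `^ m) ^+ N.
  by rewrite mulrC powRrM powR_mulrn ?powR_ge0.
have -> : A * X ^+ N * Num.max E1 E2 * ((cmod t `^ m) ^+ N * cmod t `^ r) =
   A * X ^+ N * (cmod t `^ m) ^+ N * (Num.max E1 E2 * cmod t `^ r) by ring.
rewrite exprMn mulrA ler_wpM2l //.
  by rewrite !mulr_ge0 ?exprn_ge0 ?powR_ge0 // (le_trans ler01).
rewrite maxnorm_le /=; apply/andP; split.
  by apply: le_trans h3 _; rewrite ler_wpM2r ?powR_ge0 // le_max lexx.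
by apply: le_trans h4 _; rewrite ler_wpM2r ?powR_ge0 // le_max lexx orbT.
Qed.

Lemma Lderiv_exprz (k : int) : exists h', Lderiv (fun t : C => t ^ k) h'.
Proof.
case: k => n; first by eexists; exact: Lderiv_exp.
eexists; apply: Lderiv_ext (Lderiv_horner 'X^(n.+1) (Lderiv_inv R)) => [t _|t _]; last by [].
by rewrite hornerXn NegzE -exprnN exprVn.
Qed.

Lemma mero_approx (h : C -> C) (L : nat) : mero h -> exists psi psi',
  Lderiv psi psi' /\ isO (fun t => h t - psi t) (- L%:R).
Proof.
move=> [k [a [g [[A [rho [A0 rho0 HA]]] H]]]].
pose N := (`|k| + L)%N; have [p1 Hp1] := Lderiv_exprz k.
pose p := \poly_(j < N) a j.
eexists; eexists; split; first exact: (Lderiv_mul Hp1 (Lderiv_horner p (Lderiv_inv R))).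
exists (A * rho ^+ N); apply: for_large_mono2 (for_large_and HA H) (for_large_gt 1) => t [Ht ->] t1.
have t0 : 0 < cmod t by exact: lt_trans t1.
rewrite -mulrBr cmodM horner_poly -cmod_powR_intz.
apply: le_trans (ler_wpM2l (powR_ge0 _ _) (Ht N)) _.
have -> : cmod t `^ k%:~R * (A * (rho / cmod t) ^+ N) =
    A * rho ^+ N * (cmod t `^ k%:~R * (cmod t)^-1 ^+ N) by rewrite exprMn; ring.
rewrite ler_wpM2l ?mulr_ge0 ?exprn_ge0 ?(ltW A0) ?(ltW rho0) //.
rewrite exprVn -powR_invn ?cmod_ge0 // -powRD; last by apply/implyP => _; rewrite gt_eqF.
apply: ler_powR; first exact: ltW.
rewrite /N natrD; have : k%:~R <= `|k|%N%:R :> R.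
  by rewrite -[_%:R]/((`|k|%N%:Z)%:~R) ler_int; lia.
lra.
Qed.

Lemma isO_nroot (h g : C -> C) n (a : R) : (0 < n)%N -> isO g a ->
  (forall t, cmod (h t) ^+ n <= cmod (g t)) -> isO h (a / n%:R).
Proof.
move=> n0 /isO_pos [A A0 HA] H; exists (A `^ n%:R^-1).
have n0' : n%:R != 0 :> R by rewrite pnatr_eq0 -lt0n.
apply: for_large_mono HA => t Ht; rewrite mulrC powRrM -powRM ?powR_ge0 ?(ltW A0) //.
  have -> : cmod (h t) = (cmod (h t) ^+ n) `^ n%:R^-1.
    by rewrite -powR_mulrn ?cmod_ge0 // -powRrM mulfV // powRr1 // cmod_ge0.
  have Hle := le_trans (H t) Ht.
  by rewrite ge0_ler_powR ?invr_ge0 ?nnegrE ?exprn_ge0 ?cmod_ge0 ?mulr_ge0 ?powR_ge0 ?(ltW A0) // mulrC.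
Qed.

(** Used in contrapositive form: if the exponent near the fibre is -oo, no exponent on the fibre
    exists. *)
Lemma Nexp_loj_at n (f : {poly {poly C}}) l nu : (0 < n)%N -> tdeg_monic n f ->
  Nexp (grad f) (fibre f l) nu -> exists al : R, (al%:E <= loj_at f l)%E.
Proof.
move=> n0 Hf HN.
have [Nf HNf] := isO_eval2_sub f; have [Nx HNx] := isO_eval2_sub (dx f).
have [Ny HNy] := isO_eval2_sub (dy f); pose N := (Nf + Nx + Ny)%N.
(* The result of solving nu m <= max(e, N m + (e + m) / n) for e, where m is the degree of the curve
   and e bounds the order of the gradient on it. *)
exists (Num.min nu (n%:R * (nu - N%:R) - 1)).
apply: loj_at_lower => phi1 phi2 mz ez mz0 M1 M2 O1 O2 Om12 Of Ox Oy.
set m : R := mz%:~R in O1 O2 Om12 *; set e : R := ez%:~R in Ox Oy *.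
have m0 : 0 < m by rewrite ltr0z.
have Om1 := isOmega_abscissa n0 Hf m0 Of Om12.
(* Truncation with this error preserves the bounds for the curve, for f - l and for the gradient. *)
pose L := `|Num.ceil (N%:R * m + 1 + `|e|)|%N.
have HL : N%:R * m + 1 + `|e| <= L%:R.
  by apply: le_trans (ceil_ge _) _; rewrite -[L%:R]/((L%:Z)%:~R) ler_int /L abszE ler_norm.
have [psi1 [psi1' [L1 A1]]] := mero_approx L M1.
have [psi2 [psi2' [L2 A2]]] := mero_approx L M2.
have eN := ler_norm e; have eN' := ler_norm (- e); rewrite normrN in eN'.
have Nm : 0 <= N%:R * m by rewrite mulr_ge0 // ltW.
have P1 : isO psi1 m.
  apply: isO_ext (isO_sub O1 (isO_le _ A1)) => [t|]; first by rewrite opprB addrC subrK.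
  by move: HL; lra.
have P2 : isO psi2 m.
  apply: isO_ext (isO_sub O2 (isO_le _ A2)) => [t|]; first by rewrite opprB addrC subrK.
  by move: HL; lra.
have Om1' : isOmega psi1 m.
  apply: isOmega_evext (isOmega_sub Om1 A1 _); last by move: HL; lra.
  by apply: for_large_true => t; rewrite opprB addrC subrK.
have transfer (g : {poly {poly C}}) Ng a : (Ng <= N)%N ->
   lip_exponent g Ng ->
   forall c, isO (fun t => eval2 g (phi1 t, phi2 t) - c) a -> N%:R * m - L%:R <= a ->
   isO (fun t => eval2 g (psi1 t, psi2 t) - c) a.
  move=> NgN H c Og Ha.
  apply: isO_ext (isO_sub Og (isO_le Ha (H _ _ _ _ _ _ _ NgN (ltW m0) O1 O2 P1 P2 A1 A2))) => t.
  by ring.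
have Of' : isO (fun t => eval2 f (psi1 t, psi2 t) - l) (-1).
  by apply: transfer HNf _ Of _; [rewrite /N -addnA leq_addr | move: HL; lra].
have Ox' : isO (fun t => eval2 (dx f) (psi1 t, psi2 t)) e.
  apply: (@isO_ext _ (fun t => eval2 (dx f) (psi1 t, psi2 t) - 0)) => [t|]; first by rewrite subr0.
  apply: transfer HNx _ _ _; [by rewrite /N addnAC leq_addl | | by move: HL; lra].
  by apply: isO_ext Ox => t; rewrite subr0.
have Oy' : isO (fun t => eval2 (dy f) (psi1 t, psi2 t)) e.
  apply: (@isO_ext _ (fun t => eval2 (dy f) (psi1 t, psi2 t) - 0)) => [t|]; first by rewrite subr0.
  apply: transfer HNy _ _ _; [by rewrite /N leq_addl | | by move: HL; lra].
  by apply: isO_ext Oy => t; rewrite subr0.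
pose g t := eval2 f (psi1 t, psi2 t) - l.
have Lg := Lderiv_add (Lderiv_eval2 f L1 L2) (Lderiv_cst (- l)).
(* The derivative of f - l along the curve has order at most e + m - 1; integrate. *)
have Og : isO g (e + m).
  have -> : e + m = (e + (m - 1)) + 1 by ring.
  apply: (isO_Ld_inv Lg Of' (ltrN10 R)).
  apply: isO_ext (isO_add (isO_mul Ox' (isO_Lderiv L1 P1)) (isO_mul Oy' (isO_Lderiv L2 P2))) => t.
  by rewrite addr0.
have /choice [gam Hg] : forall t, exists y, eval2 f (psi1 t, y) = l /\
    cmod (psi2 t - y) ^+ n <= cmod (g t).
  by move=> t; have [y Hy1 Hy2] := fibre_near l (psi1 t) (psi2 t) n0 Hf; exists y.
have Ogam : isO gam m.
  have [M M1' HM] := fibre_bound l n0 Hf.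
  apply: (@isO_dom _ psi1 gam M) => //.
  apply: for_large_mono (for_large_comp m0 Om1' (for_large_gt 1)) => t t1.
  have := HM (psi1 t) (gam t); rewrite (Hg t).1 subrr cmod0 => /(_ ler01).
  by rewrite max_r // ltW.
have Od : isO (fun t => psi2 t - gam t) ((e + m) / n%:R).
  by apply: isO_nroot n0 Og _ => t; exact: (Hg t).2.
pose w := Num.max e (N%:R * m + (e + m) / n%:R).
have Ow (h : {poly {poly C}}) Ng : (Ng <= N)%N ->
   lip_exponent h Ng ->
   isO (fun t => eval2 h (psi1 t, psi2 t)) e ->
   isO (fun t => eval2 h (psi1 t, gam t)) w.
  move=> NgN H Oh.
  have O0 : isO (fun t => psi1 t - psi1 t) ((e + m) / n%:R).
    by apply: isO_ext (isO_0 _) => t; rewrite subrr.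
  have H1 := H N psi1 psi2 psi1 gam m _ NgN (ltW m0) P1 P2 P1 Ogam O0 Od.
  apply: isO_ext (isO_sub (isO_le _ Oh) (isO_le _ H1)) => [t||].
  - by rewrite opprB addrC subrK.
  - by rewrite le_max lexx.
  - by rewrite le_max lexx orbT.
have Hw : nu * m <= w.
  apply: (Nexp_curve n0 Hf HN m0 P1 Om1' (gam := gam)).
  - by apply: for_large_true => t; exact: (Hg t).1.
  - by apply: Ow HNx Ox'; rewrite /N addnAC leq_addl.
  - by apply: Ow HNy Oy'; rewrite /N leq_addl.
move: Hw; rewrite le_max => /orP [Hw|Hw].
  by apply: le_trans Hw; rewrite ler_pM2r // ge_min lexx.
apply: (@le_trans _ _ ((n%:R * (nu - N%:R) - 1) * m)).
  by rewrite ler_pM2r // ge_min lexx orbT.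
have n0' : 0 < n%:R :> R by rewrite ltr0n.
have : (nu * m - N%:R * m) * n%:R <= e + m by rewrite -ler_pdivlMr // lerBlDl.
have -> : (n%:R * (nu - N%:R) - 1) * m = (nu * m - N%:R * m) * n%:R - m by ring.
lra.
Qed.

End CurvesOnFibre.

(** * Critical points and critical values at infinity *)

Section Critical.
Variable R : realType.
Local Notation C := R[i].

Definition noncritical (f : {poly {poly C}}) (l : C) := exists2 eps : R, 0 < eps &
  for_large (fun x => forall c, eval2 (dy f) (x, c) = 0 -> eps <= cmod (eval2 f (x, c) - l)).

Lemma dy_subC (f : {poly {poly C}}) l : dy (f - l%:P%:P) = dy f.
Proof. by rewrite /dy derivB derivC subr0. Qed.

Lemma noncritical_near n (f : {poly {poly C}}) l : (0 < n)%N -> tdeg_monic n f ->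
  noncritical f l -> exists e c A : R, [/\ 0 < e, 0 < c &
    for_large (fun x => forall y, cmod (eval2 f (x, y) - l) <= e ->
      c <= cmod (eval2 (dy f) (x, y)) /\
      exists2 g, eval2 f (x, g) = l &
        cmod (eval2 (dy f) (x, g)) <= A * cmod (eval2 (dy f) (x, y)))].
Proof.
case: n => // n _ Hf [eps eps0 Hev].
exists (eps / (8 * n.+1%:R * 2 ^+ n)), (Num.min 1 (eps / (2 * 2 ^+ n))), (2 ^+ n).
have e2 : 0 < 2 ^+ n :> R by rewrite exprn_gt0.
have n0 : 0 < n.+1%:R :> R by [].
split; first by rewrite divr_gt0 // !mulr_gt0.
  by rewrite lt_min ltr01 divr_gt0 // mulr_gt0.
apply: for_large_mono Hev => x Hx y Hy.
have Hg := tdeg_monic_subC l (ltn0Sn n) Hf.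
have [pm sp] := at_x_monic x Hg; set p := at_x x _ in pm sp.
have pE z : p.[z] = eval2 f (x, z) - l by rewrite -eval2_subC eval2_at_x.
have p'E z : p^`().[z] = eval2 (dy f) (x, z).
  by rewrite -at_x_dy dy_subC eval2_at_x.
have [||H1 [g rg H2]] := @noncritical_root _ p n eps y pm sp eps0.
- by move=> c /eqP; rewrite p'E pE; exact: Hx.
- by rewrite pE.
rewrite !p'E in H1 H2; split=> //; exists g => //.
by apply/eqP; rewrite -subr_eq0 -pE.
Qed.

(** Solve the chain rule for f_x: f_x D t^(D-1) = (f - l)' - f_y phi', where the right side has
    order at most max(b - 1, w + D - 1). *)
Lemma isO_dx_curve (f : {poly {poly C}}) l (D : nat) phi phi' (b w a : R) :
  (0 < D)%N -> Lderiv phi phi' -> isO phi D%:R ->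
  isO (fun t => eval2 f (t ^+ D, phi t) - l) b ->
  isO (fun t => eval2 (dy f) (t ^+ D, phi t)) w ->
  b - D%:R <= a -> w <= a -> isO (fun t => eval2 (dx f) (t ^+ D, phi t)) a.
Proof.
move=> D0 L O1 Of Oy ba wa.
have Lg := Lderiv_add (Lderiv_eval2 f (@Lderiv_exp R D) L) (Lderiv_cst (- l)).
have Oh := isO_Lderiv Lg Of.
have OD : isO (fun t => eval2 (dx f) (t ^+ D, phi t) * (D%:R * t ^+ D.-1)) (a + (D%:R - 1)).
  apply: (@isO_ext _ (fun t => (eval2 (dx f) (t ^+ D, phi t) * (D%:R * t ^+ D.-1) +
    eval2 (dy f) (t ^+ D, phi t) * phi' t + 0) - eval2 (dy f) (t ^+ D, phi t) * phi' t)).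
    by move=> t; rewrite addr0 addrK.
  apply: isO_sub; first by apply: isO_le Oh; move: ba; lra.
  by apply: isO_le (isO_mul Oy (isO_Lderiv L O1)); rewrite lerD2r.
have Dn0 : (D%:R : C) != 0 by rewrite pnatr_eq0 -lt0n.
have := isO_mulc D%:R^-1 (isO_div_exp D.-1 OD).
have -> : a + (D%:R - 1) - D.-1%:R = a.
  by rewrite -[in D%:R](prednK D0) -natr1; ring.
apply: isO_evext; apply: for_large_mono (for_large_gt 0) => t; rewrite cmod_gt0 => t0.
have : t ^+ D.-1 != 0 by rewrite expf_neq0.
by move: (t ^+ D.-1) => u u0; field; rewrite ?u0 ?Dn0.
Qed.

Lemma mero_isO_isOmega (h : C -> C) : mero h ->
  for_large (fun t => h t = 0) \/ exists m : int, isO h m%:~R /\ isOmega h m%:~R.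
Proof.
by move=> /mero_deg [[h0 _]|[m [_ Oh Omh]]]; [left|right; exists m].
Qed.

(* Along each branch of f = l implicit differentiation gives f_x + f_y y' = 0
   up to a negligible term, with y' bounded. *)
Lemma noncritical_dx_dy n (f : {poly {poly C}}) l : (0 < n)%N -> tdeg_monic n f ->
  noncritical f l -> exists A : R, for_large (fun x => forall y, eval2 f (x, y) = l ->
    cmod (eval2 (dx f) (x, y)) <= A * cmod (eval2 (dy f) (x, y))).
Proof.
move=> n0 Hf /(noncritical_near n0 Hf) [e [c0 [A1 [e_gt0 c0_gt0 Hev]]]].
have [D [q [D0 _ Hq [A A0 HA]]]] := branches_eval l [:: dx f; dy f] 1 n0 Hf.
have D1 : 1 <= D%:R :> R by rewrite ler1n.
have Hb c : c \in q -> exists2 a : R, 0 < a & for_large (fun t =>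
    a * cmod (eval2 (dx f) (t ^+ D, branch D c t)) <=
     cmod (eval2 (dy f) (t ^+ D, branch D c t))).
  move=> c_in; have Oc := Hq c c_in; rewrite mul1n in Oc.
  have Oc0 : isO (fun t => eval2 f (t ^+ D, branch D c t) - l) (-1).
    by apply: isO_le Oc; rewrite lerN2.
  have Omy : isOmega (fun t => eval2 (dy f) (t ^+ D, branch D c t)) 0.
    exists c0 => //; apply: for_large_mono2 (for_large_exp D0 Hev) (isO_small Oc0 (ltrN10 R) e_gt0).
    by move=> t H1 /ltW /H1 [H2 _]; rewrite powRr0 mulr1.
  have my : mero (fun t => eval2 (dy f) (t ^+ D, branch D c t)).
    by apply: mero_eval2; [exact: mero_exprz R D | exact: branch_mero].
  have [z|[m [Om1 Om2]]] := mero_isO_isOmega my.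
    have [a a0 Ha] := Omy; have [t [H1 H2]] := for_large_ex (for_large_and z Ha).
    by move: H2; rewrite H1 cmod0 powRr0 mulr1 leNgt a0.
  have m0 : 0 <= m%:~R :> R by exact: isO_isOmega Om1 Omy.
  have [h' Lh] := @branch_Lderiv R D c.
  have [B B0 HB] := isO_pos (isO_dx_curve (a := m%:~R) D0 Lh (@isO_branch R D c) Oc Om1 (ltac:(lra)) (lexx _)).
  have [a a0 Ha] := Om2.
  exists (a / B); first by rewrite divr_gt0.
  apply: for_large_mono2 HB Ha => t H1 H2; apply: le_trans H2.
  by rewrite mulrAC ler_pdivrMr // -mulrA ler_wpM2l ?(ltW a0) // mulrC.
have [a a0 Ha] := for_large_seq_min (fun i a b t _ ba H => le_trans (ler_wpM2r (cmod_ge0 _) ba) H) Hb.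
(* Passing between the fibre point and its branch costs an additive 1 in f_x and in f_y; since |f_y|
   >= c0 on the fibre, 1 <= |f_y| / c0 absorbs it. *)
exists (a^-1 * (1 + c0^-1) + c0^-1).
suff H : for_large (fun t => forall y, eval2 f (t ^+ D, y) = l ->
    cmod (eval2 (dx f) (t ^+ D, y)) <=
    (a^-1 * (1 + c0^-1) + c0^-1) * cmod (eval2 (dy f) (t ^+ D, y))).
  by apply: for_large_mono (for_large_root D0 H) => x [t ->].
have small : for_large (fun t => A * cmod t `^ (- (1 * D)%:R) < 1 * cmod t `^ 0).
  by apply: for_large_powR_lt => //; rewrite mul1n; lra.
apply: for_large_mono2 (for_large_and HA Ha) (for_large_and (for_large_exp D0 Hev) small) => t [H1 H2] [H3 H4] y Hy.
have [c c_in Hc] := H1 y Hy; rewrite powRr0 mulr1 in H4.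
have Hx := le_lt_trans (Hc (dx f) (ltac:(by rewrite inE eqxx))) H4.
have Hy' := le_lt_trans (Hc (dy f) (ltac:(by rewrite !inE eqxx orbT))) H4.
have {}H2 := H2 c c_in; have [|Hc0 _] := H3 y; first by rewrite Hy subrr cmod0 ltW.
move: (cmod_le_dist (eval2 (dx f) (t ^+ D, y)) (eval2 (dx f) (t ^+ D, branch D c t))).
move: (cmod_le_dist (eval2 (dy f) (t ^+ D, branch D c t)) (eval2 (dy f) (t ^+ D, y))).
rewrite cmod_dist.
move: Hx Hy' H2 Hc0; set u := cmod (eval2 (dx f) (_, branch _ _ _)).
set v := cmod (eval2 (dy f) (_, branch _ _ _)).
set fx := cmod (eval2 (dx f) (_, y)); set fy := cmod (eval2 (dy f) (_, y)).
move=> Hx Hy' H2 Hc0 Q1 Q2.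
have uv : u <= a^-1 * v by rewrite ler_pdivlMl.
have one : 1 <= c0^-1 * fy by rewrite ler_pdivlMl // mulr1.
have ia : 0 < a^-1 by rewrite invr_gt0.
have Q3 : a^-1 * v <= a^-1 * (fy + c0^-1 * fy) by rewrite ler_wpM2l ?(ltW ia) //; lra.
have -> : (a^-1 * (1 + c0^-1) + c0^-1) * fy = a^-1 * (fy + c0^-1 * fy) + c0^-1 * fy by ring.
lra.
Qed.

Lemma noncritical_Nexp_le n (f : {poly {poly C}}) l nu : (0 < n)%N -> tdeg_monic n f ->
  noncritical f l -> Nexp (grad f) (fibre f l) nu -> (nu%:E <= loj_at f l)%E.
Proof.
move=> n0 Hf Hnc HN.
have [e [c0 [A1 [e_gt0 c0_gt0 Hev]]]] := noncritical_near n0 Hf Hnc.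
have [A HA] := noncritical_dx_dy n0 Hf Hnc.
apply: loj_at_lower => phi1 phi2 mz ez mz0 M1 M2 O1 O2 Om12 Of _ Oy.
have m0 : 0 < mz%:~R :> R by rewrite ltr0z.
have Om1 := isOmega_abscissa n0 Hf m0 Of Om12.
(* A comparable fibre point exists only for large t; stating the comparison as an implication makes
   the choice total. *)
have /choice [gam Hg] : forall t, exists g, eval2 f (phi1 t, g) = l /\
   ((exists2 g, eval2 f (phi1 t, g) = l & cmod (eval2 (dy f) (phi1 t, g)) <=
      A1 * cmod (eval2 (dy f) (phi1 t, phi2 t))) ->
    cmod (eval2 (dy f) (phi1 t, g)) <= A1 * cmod (eval2 (dy f) (phi1 t, phi2 t))).
  move=> t; have [[g g1 g2]|ng] := pselect (exists2 g, eval2 f (phi1 t, g) = l &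
     cmod (eval2 (dy f) (phi1 t, g)) <= A1 * cmod (eval2 (dy f) (phi1 t, phi2 t))).
    by exists g.
  by have [g g1 _] := fibre_near l (phi1 t) 0 n0 Hf; exists g.
have Ogy : isO (fun t => eval2 (dy f) (phi1 t, gam t)) ez%:~R.
  apply: (isO_dom (A := A1) _ Oy).
  apply: for_large_mono2 (for_large_comp m0 Om1 Hev) (isO_small Of (ltrN10 R) e_gt0) => t H1 /ltW H2.
  by have [_ H3] := H1 _ H2; exact: (Hg t).2.
apply: (Nexp_curve n0 Hf HN m0 O1 Om1 (gam := gam)) => //.
- by apply: for_large_true => t; exact: (Hg t).1.
- apply: (isO_dom (A := A) _ Ogy).
  by apply: for_large_mono (for_large_comp m0 Om1 HA) => t H; apply: H; exact: (Hg t).1.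
Qed.

Lemma tdeg_monic_dy n (f : {poly {poly C}}) : tdeg_monic n.+1 f ->
  tdeg_monic n (n.+1%:R^-1%:P *: dy f).
Proof.
move=> [sf fn fs]; have n0 : n.+1%:R != 0 :> C by rewrite pnatr_eq0.
have coef i : (n.+1%:R^-1%:P *: dy f)`_i = (n.+1%:R^-1 * i.+1%:R)%:P * f`_i.+1.
  by rewrite coefZ coef_deriv -[_ *+ i.+1]mulr_natl mulrA -polyC_natr -polyCM.
have cn : (n.+1%:R^-1%:P *: dy f)`_n = 1 by rewrite coef fn mulVf // mulr1.
split=> //.
- apply/eqP; rewrite eqn_leq; apply/andP; split.
    by apply/leq_sizeP => j Hj; rewrite coef nth_default ?mulr0 // sf.
  by rewrite ltnNge; apply/negP => /leq_sizeP /(_ n (leqnn _)); rewrite cn => /eqP; rewrite oner_eq0.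
move=> i Hi; rewrite coef; apply: leq_trans (size_polyMleq _ _) _.
have := fs i.+1 Hi; rewrite subSS => H.
apply: leq_trans H; have := size_polyC_leq1 (n.+1%:R^-1 * i.+1%:R : C).
by case: (size (_ : {poly _})) => [|[|]] //= _; rewrite ?add0n ?leq_pred.
Qed.

Lemma eval2_scaleC (f : {poly {poly C}}) (a : C) z : eval2 (a%:P *: f) z = a * eval2 f z.
Proof. by rewrite /eval2 hornerZ hornerM hornerC. Qed.

Lemma critical_branches n (f : {poly {poly C}}) (K : nat) : tdeg_monic n.+2 f ->
  exists D (q : seq {poly C}), [/\ (0 < D)%N,
   (forall c, c \in q ->
     isO (fun t => eval2 (dy f) (t ^+ D, branch D c t)) (- (K * D)%:R)) &
   exists2 A : R, 0 < A & for_large (fun t => forall y, eval2 (dy f) (t ^+ D, y) = 0 ->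
     exists2 c, c \in q & cmod (eval2 f (t ^+ D, y) - eval2 f (t ^+ D, branch D c t))
         <= A * cmod t `^ (- (K * D)%:R))].
Proof.
move=> Hf; have n0 : n.+2%:R != 0 :> C by rewrite pnatr_eq0.
have [D [q [D0 _ Hq [A A0 HA]]]] := branches_eval 0 [:: f] K (ltn0Sn n) (tdeg_monic_dy Hf).
exists D, q; split=> // [c c_in|].
  apply: isO_ext (isO_mulc n.+2%:R (Hq c c_in)) => t.
  by rewrite subr0 eval2_scaleC mulrA mulfV // mul1r.
exists A => //; apply: for_large_mono HA => t Ht y Hy.
have [|c c_in Hc] := Ht y; first by rewrite eval2_scaleC Hy mulr0.
by exists c => //; apply: Hc; rewrite inE eqxx.
Qed.

End Critical.

(** * Values of f - l along the critical branches and their effect on the exponents *)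

Section CriticalValues.
Variable R : realType.
Local Notation C := R[i].

Lemma mero_threshold (h : C -> C) (a : R) : mero h ->
  isO h a \/ exists2 b : R, a < b & isOmega h b.
Proof.
move=> /mero_isO_isOmega [z|[m [Oh Omh]]].
  by left; apply: isO_evext (isO_0 _); apply: for_large_mono z => t ->.
have [ma|am] := leP (m%:~R : R) a; first by left; exact: isO_le ma Oh.
by right; exists m%:~R.
Qed.

Lemma mero_isO_neg (h : C -> C) (a : R) : mero h -> isO h a -> a < 0 -> isO h (-1).
Proof.
move=> /mero_isO_isOmega [z|[m [Oh Omh]]] Oa a0.
  by apply: isO_evext (isO_0 _); apply: for_large_mono z => t ->.
apply: (@isO_le _ _ m%:~R) => //; have := isO_isOmega Oa Omh => ma.
have : m%:~R < 0 :> R by exact: le_lt_trans ma a0.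
by rewrite ltrz0 => m0; rewrite -[-1]/((-1)%:~R) ler_int; lia.
Qed.

Lemma mero_branch (f : {poly {poly C}}) D c : mero (fun t => eval2 f (t ^+ D, branch D c t)).
Proof. by apply: mero_eval2; [exact: mero_exprz R D | exact: branch_mero]. Qed.

(** The branches of f_y = 0 do not depend on l, which finiteness of the critical l requires. The
    condition on w says that f_y is negligible on the branch, leaving f_x to bound the exponent; the
    second part passes from the branches to all critical points. *)
Lemma critical_data n (f : {poly {poly C}}) (K : nat) : tdeg_monic n.+2 f ->
  exists D (q : seq {poly C}), (0 < D)%N /\ forall l,
  (forall c w, c \in q -> isO (fun t => eval2 f (t ^+ D, branch D c t) - l) (-1) ->
     isO (fun t => eval2 f (t ^+ D, branch D c t) - l) w -> 1 - w / D%:R <= K%:R ->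
     (loj_at f l <= (w / D%:R - 1)%:E)%E) /\
  (forall b, - K%:R < b ->
    (forall c, c \in q -> isOmega (fun t => eval2 f (t ^+ D, branch D c t) - l) (b * D%:R)) ->
    exists2 a : R, 0 < a & for_large (fun x => forall y, eval2 (dy f) (x, y) = 0 ->
      a * cmod x `^ b <= cmod (eval2 f (x, y) - l))).
Proof.
move=> Hf; have [D [q [D0 Hq [A A0 HA]]]] := critical_branches K Hf.
exists D, q; split=> // l.
have D0' : 0 < D%:R :> R by rewrite ltr0n.
split=> [c w c_in O1 Ow wK|b bK Hb].
  have P : puiseux_curve f l D (branch D c).
    by split=> //; [exact: branch_mero | exact: isO_branch].
  have -> : w / D%:R - 1 = (w - D%:R) / D%:R by field; rewrite gt_eqF.
  have Oy : isO (fun t => eval2 (dy f) (t ^+ D, branch D c t)) (w - D%:R).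
    apply: isO_le (Hq c c_in); rewrite natrM.
    have := ler_wpM2r (ltW D0') wK; rewrite mulrBl mul1r divfK ?gt_eqF //; lra.
  apply: (loj_at_le P _ Oy).
  have [h' Lh] := @branch_Lderiv R D c.
  exact: (isO_dx_curve D0 Lh (@isO_branch R D c) Ow Oy (lexx _) (lexx _)).
have mono (c : {poly C}) (a1 a2 : R) (t : C) : 0 < a2 -> a2 <= a1 ->
    a1 * cmod t `^ (b * D%:R) <= cmod (eval2 f (t ^+ D, branch D c t) - l) ->
    a2 * cmod t `^ (b * D%:R) <= cmod (eval2 f (t ^+ D, branch D c t) - l).
  by move=> _ a12; apply: le_trans; rewrite ler_wpM2r ?powR_ge0.
have [a a0 Ha] := for_large_seq_min mono Hb.
exists (a / 2); first by rewrite divr_gt0.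
suff H : for_large (fun t => forall y, eval2 (dy f) (t ^+ D, y) = 0 ->
   a / 2 * cmod (t ^+ D) `^ b <= cmod (eval2 f (t ^+ D, y) - l)).
  by apply: for_large_mono (for_large_root D0 H) => x [t ->].
have KD : - (K * D)%:R < b * D%:R by rewrite natrM -mulNr ltr_pM2r.
apply: for_large_mono2 (for_large_and HA Ha) (for_large_powR_lt A KD (divr_gt0 a0 (ltr0Sn R 1))) => t [H1 H2] H3 y Hy.
have [c c_in Hc] := H1 y Hy; have {}H2 := H2 c c_in.
have -> : cmod (t ^+ D) `^ b = cmod t `^ (b * D%:R).
  by rewrite cmodX -powR_mulrn ?cmod_ge0 // -powRrM mulrC.
have := cmod_le_dist (eval2 f (t ^+ D, branch D c t) - l) (eval2 f (t ^+ D, y) - l).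
have -> : eval2 f (t ^+ D, branch D c t) - l - (eval2 f (t ^+ D, y) - l)
   = eval2 f (t ^+ D, branch D c t) - eval2 f (t ^+ D, y) by ring.
have := le_lt_trans Hc H3; rewrite cmod_dist; move: H2; set u := _ `^ _.
by rewrite (_ : a * u = a / 2 * u + a / 2 * u); [lra | field].
Qed.

Lemma dy_deg1 (f : {poly {poly C}}) z : tdeg_monic 1 f -> eval2 (dy f) z = 1.
Proof.
move=> /tdeg_monic_dy [s1 c1 _]; rewrite (invr1) scale1r in s1 c1.
by rewrite (size1_polyC (eq_leq s1)) c1 eval2C hornerC.
Qed.

Lemma noncritical_deg1 (f : {poly {poly C}}) l : tdeg_monic 1 f -> noncritical f l.
Proof.
move=> Hf; exists 1 => //; apply: for_large_true => x c /eqP.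
by rewrite dy_deg1 // oner_eq0.
Qed.

Lemma noncritical_of_branches n (f : {poly {poly C}}) : tdeg_monic n.+2 f ->
  exists D (q : seq {poly C}), (0 < D)%N /\ forall l,
   (forall c, c \in q -> ~ isO (fun t => eval2 f (t ^+ D, branch D c t) - l) (-1)) ->
   noncritical f l.
Proof.
move=> Hf; have [D [q [D0 H]]] := critical_data 1 Hf.
exists D, q; split=> // l Hl; have [_ H2] := H l.
have [|c c_in|a a0 Ha] := H2 0; first by rewrite ltrN10.
  rewrite mul0r.
  have [//|Om1] := @mero_dichotomy _ _ (-1) (mero_sub (mero_branch f D c) (mero_cst l)).
    by move/(Hl c c_in).
  by rewrite addNr in Om1.
exists a => //; apply: for_large_mono Ha => x Hx y Hy.
by have := Hx y Hy; rewrite powRr0 mulr1.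
Qed.

Lemma critical_finite n (f : {poly {poly C}}) : (0 < n)%N -> tdeg_monic n f ->
  finite_set [set l | ~ noncritical f l].
Proof.
case: n => [//|[|n]] _ Hf.
  apply: (@sub_finite_set _ _ set0) => // l /=; apply.
  exact: noncritical_deg1.
have [D [q [D0 H]]] := noncritical_of_branches Hf.
pose P l (c : {poly C}) := isO (fun t => eval2 f (t ^+ D, branch D c t) - l) (-1).
have Puniq l l' c : P l c -> P l' c -> l = l'.
  move=> H1 H2; apply/eqP; rewrite -subr_eq0; apply/negPn/negP => ll.
  have O1 : isO (fun=> l - l') (-1).
    by apply: isO_ext (isO_sub H2 H1) => t; ring.
  have Om1 : isOmega (fun=> l - l') 0.
    exists (cmod (l - l')); first by rewrite cmod_gt0.
    by apply: for_large_true => t; rewrite powRr0 mulr1.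
  by have := isO_isOmega O1 Om1; rewrite ler0N1.
have /choice [val Hval] : forall c, exists v, forall l, P l c -> l = v.
  move=> c; have [[l Pl]|nl] := pselect (exists l, P l c).
    by exists l => l' Pl'; exact: Puniq Pl' Pl.
  by exists 0 => l Pl; case: nl; exists l.
apply: (@sub_finite_set _ _ [set` [seq val c | c <- q]]); last exact: finite_seq.
move=> l /= nc; apply: contrapT => /negP nv; apply: nc; apply: H => c c_in Pc.
by move/negP: nv; apply; rewrite (Hval c l Pc) map_f.
Qed.

Lemma critical_loj_at n (f : {poly {poly C}}) l : (0 < n)%N -> tdeg_monic n f ->
  ~ noncritical f l -> (loj_at f l < (-1)%:E)%E.
Proof.
case: n => [//|[|n]] _ Hf; first by case; exact: noncritical_deg1.
(* Precision 2 suffices: for w = -1 the requirement is 1 + 1/D <= 2. The resulting exponent is at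
   most -1 - 1/D. *)
move=> nc; have [D [q [D0 H]]] := critical_data 2 Hf.
have D0' : 0 < D%:R :> R by rewrite ltr0n.
have D1 : 1 <= D%:R :> R by rewrite ler1n.
have [H1 H2] := H l.
have [c c_in Oc] : exists2 c, c \in q & isO (fun t => eval2 f (t ^+ D, branch D c t) - l) (-1).
  apply: contrapT => ne; apply: nc.
  have [|c c_in|a a0 Ha] := H2 0; first by rewrite oppr_lt0.
    rewrite mul0r.
    have [Oc|Om1] := @mero_dichotomy _ _ (-1) (mero_sub (mero_branch f D c) (mero_cst l)).
      by case: ne; exists c.
    by rewrite addNr in Om1.
  exists a => //; apply: for_large_mono Ha => x Hx y Hy.
  by have := Hx y Hy; rewrite powRr0 mulr1.
have iD : D%:R^-1 <= 1 :> R by rewrite invf_le1.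
have iD0 : 0 < D%:R^-1 :> R by rewrite invr_gt0.
apply: le_lt_trans (H1 c (-1) c_in Oc Oc _) _; first by rewrite mulN1r; lra.
by rewrite lte_fin mulN1r; lra.
Qed.

Lemma seq_margin (q : seq {poly C}) (e : R) (P : {poly C} -> R -> Prop) :
  (forall c b b', b' <= b -> P c b -> P c b') ->
  (forall c, c \in q -> exists2 b : R, e < b & P c b) ->
  exists2 b : R, e < b & forall c, c \in q -> P c b.
Proof.
move=> mono; elim: q => [|c q IH] H.
  by exists (e + 1) => //; rewrite ltrDl.
have [|b1 eb1 Hb1] := IH; first by move=> j Hj; apply: H; rewrite inE Hj orbT.
have [b2 eb2 Hb2] := H c (mem_head _ _).
exists (Num.min b1 b2); first by rewrite lt_min eb1.
move=> j; rewrite inE => /orP [/eqP ->|/Hb1].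
  by apply: mono Hb2; rewrite ge_min lexx orbT.
by apply: mono; rewrite ge_min lexx.
Qed.

(* If a branch of the fibre attains the exponent e < 0, the critical point
   nearest to it lies on a curve with a strictly smaller exponent. *)
Lemma loj_at_improve n (f : {poly {poly C}}) l (e : R) (D : nat) (c : {poly C}) (K0 : nat) :
  tdeg_monic n.+2 f -> e < 0 -> (0 < D)%N -> - (2 * e) <= K0%:R ->
  isO (fun t => eval2 f (t ^+ D, branch D c t) - l) (- (K0 * D)%:R) ->
  isO (fun t => eval2 (dy f) (t ^+ D, branch D c t)) (e * D%:R) ->
  (loj_at f l < e%:E)%E.
Proof.
move=> Hf e0 D0 HK Of Oy.
have D0' : 0 < D%:R :> R by rewrite ltr0n.
(* The distance to the nearest critical point is O(|x|^e'), because its power n+1 is at most |f_y|.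
   Times f_y this bounds the change of f by O(|x|^b), and b - 1 < e is the new exponent. *)
pose e' := e / n.+1%:R; pose b := e + e'.
have n0 : 0 < n.+1%:R :> R by [].
have e'0 : e' < 0 by rewrite /e' pmulr_llt0 ?invr_gt0.
have ee' : e <= e' by rewrite /e' ler_pdivlMr // -[leRHS]mulr1 ler_wnM2l ?ler1n // ltW.
pose K := `|Num.ceil (1 - b)|.+1.
have HKb : 1 - b < K%:R.
  apply: le_lt_trans (ceil_ge _) _.
  apply: (@le_lt_trans _ _ (`|Num.ceil (1 - b)|%N%:Z)%:~R).
    by rewrite ler_int abszE ler_norm.
  by rewrite /K -natr1 ltrDl.
have [D2 [q [D20 H]]] := critical_data K Hf.
have D20' : 0 < D2%:R :> R by rewrite ltr0n.
have [H1 H2] := H l.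
have [[c2 c2_in Oc2]|ne] := pselect (exists2 c2, c2 \in q &
   isO (fun t => eval2 f (t ^+ D2, branch D2 c2 t) - l) (b * D2%:R)).
  have b0 : b * D2%:R < 0 by rewrite pmulr_llt0 // /b; lra.
  have On := mero_isO_neg (mero_sub (mero_branch f D2 c2) (mero_cst l)) Oc2 b0.
  apply: le_lt_trans (H1 c2 _ c2_in On Oc2 _) _.
    by rewrite mulfK ?gt_eqF //; exact: ltW.
  by rewrite mulfK ?gt_eqF // lte_fin /b; lra.
(* Otherwise f - l has order above b, with a margin, on every branch of f_y = 0, hence at all
   critical points, including those chosen near the given branch. *)
exfalso.
have [|c2 c2_in|bb bbb Hbb] := @seq_margin q b (fun c2 be =>
   isOmega (fun t => eval2 f (t ^+ D2, branch D2 c2 t) - l) (be * D2%:R)).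
- by move=> c2 b1 b2 b12; apply: isOmega_le; rewrite ler_pM2r.
- have [Oc2|[b1 b1b Om1]] := mero_threshold (b * D2%:R) (mero_sub (mero_branch f D2 c2) (mero_cst l)).
    by case: ne; exists c2.
  exists (b1 / D2%:R); first by rewrite ltr_pdivlMr.
  by rewrite divfK ?gt_eqF.
have [|a a0 Ha] := H2 bb _ Hbb; first by move: HKb bbb; lra.
have /choice [cr Hcr] : forall t, exists y, [/\ eval2 (dy f) (t ^+ D, y) = 0,
    cmod (branch D c t - y) ^+ n.+1 <= cmod (eval2 (dy f) (t ^+ D, branch D c t)) &
    cmod (eval2 f (t ^+ D, y) - eval2 f (t ^+ D, branch D c t)) <=
    2 ^+ n.+1 * cmod ((branch D c t - y) * eval2 (dy f) (t ^+ D, branch D c t))].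
  move=> t; have [pm sp] := at_x_monic (t ^+ D) Hf.
  have [y [Y1 Y2 Y3]] := critical_near (branch D c t) pm sp.
  exists y; rewrite !eval2_at_x /= at_x_dy; split=> //; first exact/eqP.
  by rewrite cmodM mulrA [2 ^+ _ * _]mulrC.
have Od : isO (fun t => branch D c t - cr t) (e * D%:R / n.+1%:R).
  by apply: isO_nroot Oy _ => // t; have [] := Hcr t.
have bD : e * D%:R / n.+1%:R + e * D%:R = b * D%:R by rewrite /b /e'; ring.
have Ocr : isO (fun t => eval2 f (t ^+ D, cr t) - l) (b * D%:R).
  apply: (@isO_ext _ (fun t => (eval2 f (t ^+ D, cr t) - eval2 f (t ^+ D, branch D c t)) +
     (eval2 f (t ^+ D, branch D c t) - l))); first by move=> t; ring.
  apply: isO_add; last first.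
    apply: isO_le Of; rewrite natrM -mulNr ler_pM2r // /b; move: HK ee'; lra.
  rewrite -bD; apply: isO_dom (isO_mul Od Oy); apply: for_large_true => t.
  by have [_ _] := Hcr t; exact.
have Omcr : isOmega (fun t => eval2 f (t ^+ D, cr t) - l) (bb * D%:R).
  exists a => //; apply: for_large_mono (for_large_exp D0 Ha) => t Ht.
  have [Hc _ _] := Hcr t; have := Ht _ Hc.
  by rewrite cmodX -powR_mulrn ?cmod_ge0 // -powRrM [D%:R * bb]mulrC.
by have := isO_isOmega Ocr Omcr; rewrite ler_pM2r // leNgt bbb.
Qed.

Lemma Nexp_gt_loj_at n (f : {poly {poly C}}) l (e : R) : (0 < n)%N -> tdeg_monic n f ->
  loj_at f l = e%:E -> e < -1 -> exists2 b : R, e < b & Nexp (grad f) (fibre f l) b.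
Proof.
move=> n0 Hf eL e1.
have nc : ~ noncritical f l -> (1 < n)%N.
  by case: n n0 Hf => [|[|n]] // _ Hf []; exact: noncritical_deg1.
have [Hnc|/nc {nc}] := pselect (noncritical f l).
  have [e' [c0 [A1 [e'_gt0 c0_gt0 Hev]]]] := noncritical_near n0 Hf Hnc.
  exists 0; first by move: e1; lra.
  apply/(Nexp_fibreP l (grad f) 0 n0 Hf); exists c0 => //.
  apply: for_large_mono Hev => x Hx y Hy; rewrite powRr0 mulr1.
  have [|H _] := Hx y; first by rewrite Hy subrr cmod0 ltW.
  by apply: le_trans H _; exact: (maxnorm_ler (grad f _)).
case: n n0 Hf => [|[|n]] // n0 Hf _.
pose K0 := `|Num.ceil (- (2 * e))|.+1.
have HK0 : - (2 * e) <= K0%:R.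
  apply: le_trans (ceil_ge _) _; apply: (@le_trans _ _ (`|Num.ceil (- (2 * e))|%N%:R)).
    by rewrite -[leRHS]/((`|Num.ceil (- (2 * e))|%N%:Z)%:~R) ler_int abszE ler_norm.
  by rewrite ler_nat.
have [D [q [D0 sq Hq HN]]] := fibre_branches l e K0 n0 Hf.
have D0' : 0 < D%:R :> R by rewrite ltr0n.
(* Were f_y of order at most e on some branch, [loj_at_improve] would go below e. So f_y alone
   exceeds e on each of the finitely many branches. *)
have [|c c_in|b eb Hb] := @seq_margin q e (fun c be =>
    isOmega (fun t => eval2 (dx f) (t ^+ D, branch D c t)) (be * D%:R) \/
    isOmega (fun t => eval2 (dy f) (t ^+ D, branch D c t)) (be * D%:R)).
- move=> c b b' bb; have bbD : b' * D%:R <= b * D%:R by rewrite ler_pM2r.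
  by case=> /(isOmega_le bbD); [left|right].
- have [Oy|[b eb Omb]] := mero_threshold (e * D%:R) (mero_branch (dy f) D c); last first.
    by exists (b / D%:R); rewrite ?ltr_pdivlMr // divfK ?gt_eqF //; right.
  have := loj_at_improve Hf (lt_trans e1 (ltrN10 R)) D0 HK0 (Hq c c_in) Oy.
  by rewrite eL ltxx.
by exists b => //; apply: HN => //; exact: ltW.
Qed.

End CriticalValues.

(** * The Newton polygon of the resultant *)

Section ResultantRoots.
Variable R : realType.
Local Notation C := R[i].

(** Up to the factor P(0), P is the product of the 1 - X / z with |z| >= r; the induction over the
    roots avoids the division. *)
Lemma coef_le_of_roots (P : {poly C}) (r : R) k : 0 < r ->
  (forall z, root P z -> r <= cmod z) -> cmod P`_k * r ^+ k <= 2 ^+ size P * cmod P`_0.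
Proof.
move=> r0; have [s PE] := closed_field_poly_normal P.
have [->|P0] := eqVneq P 0; first by rewrite !coef0 cmod0 mul0r mulr0.
have lc0 : lead_coef P != 0 by rewrite lead_coef_eq0.
have sP : (size s <= size P)%N by rewrite PE size_scale // size_prod_XsubC.
move=> Hr; have {}Hr z : z \in s -> r <= cmod z.
  by move=> Hz; apply: Hr; rewrite PE rootZ // root_prod_XsubC.
apply: (@le_trans _ _ (2 ^+ size s * cmod P`_0)); last first.
  by rewrite ler_wpM2r ?cmod_ge0 // ler_weXn2l // ler1n.
rewrite PE !coefZ !cmodM -[leLHS]mulrA [leRHS]mulrCA ler_wpM2l ?cmod_ge0 //.
elim: s Hr k {P PE P0 lc0 sP} => [|z s IH] Hr k.
  rewrite big_nil !coef1 expr0 mul1r eqxx cmod1.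
  by case: k => [|k] /=; rewrite ?cmod0 ?mul0r ?cmod1 ?mul1r ?expr0.
have {}IH j := IH (fun z' Hz' => Hr z' (mem_behead (s := z :: s) Hz')) j.
rewrite !big_cons; set p := \prod_(_ <- _) _ in IH *.
have rz := Hr z (mem_head _ _).
rewrite !mulrBl !coefB !coefXM !coefCM /= sub0r cmodN cmodM.
have B0 : 0 <= 2 ^+ size s * cmod p`_0 by rewrite mulr_ge0 ?exprn_ge0 ?cmod_ge0.
apply: (@le_trans _ _ ((r + cmod z) * (2 ^+ size s * cmod p`_0))); last first.
  rewrite exprS -!mulrA [cmod z * _]mulrC mulrC !mulrA.
  have := ler_wpM2r B0 rz; lra.
rewrite mulrDl; apply: le_trans (ler_wpM2r _ (cmodB _ _)) _; first by rewrite exprn_ge0 // ltW.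
rewrite mulrDl lerD //.
  case: k => [|k] /=; first by rewrite cmod0 mul0r mulr_ge0 // ltW.
  by rewrite exprS mulrCA ler_wpM2l // ltW.
by rewrite cmodM -mulrA ler_wpM2l ?cmod_ge0.
Qed.

(** Each root is at least as far from a as b is, so moving from a to b at most doubles its
    distance. *)
Lemma horner_le_of_roots (P : {poly C}) a b :
  (forall z, root P z -> cmod (b - a) <= cmod (z - a)) ->
  cmod P.[b] <= 2 ^+ size P * cmod P.[a].
Proof.
have [s PE] := closed_field_poly_normal P.
have [->|P0] := eqVneq P 0; first by rewrite !horner0 cmod0 mulr0.
have lc0 : lead_coef P != 0 by rewrite lead_coef_eq0.
have sP : (size s <= size P)%N by rewrite PE size_scale // size_prod_XsubC.
move=> Hr; have {}Hr z : z \in s -> cmod (b - a) <= cmod (z - a).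
  by move=> Hz; apply: Hr; rewrite PE rootZ // root_prod_XsubC.
apply: (@le_trans _ _ (2 ^+ size s * cmod P.[a])); last first.
  by rewrite ler_wpM2r ?cmod_ge0 // ler_weXn2l // ler1n.
rewrite PE !hornerZ !cmodM mulrCA ler_wpM2l ?cmod_ge0 //.
rewrite !horner_prod_XsubC !cmod_prod -prod_cst_seq -big_split /= !big_seq.
apply: ler_prod => z Hz; rewrite cmod_ge0 /= mulr_natl mulr2n.
have -> : b - z = (b - a) + (a - z) by ring.
apply: le_trans (cmodD _ _) _; rewrite lerD2r.
by rewrite [leRHS]cmod_dist; exact: Hr.
Qed.

Lemma nonroot_near (p : {poly C}) a (eps : R) : p != 0 -> 0 < eps ->
  exists2 z, cmod (z - a) <= eps & p.[z] != 0.
Proof.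
move=> p0 eps0; apply: contrapT => H.
pose pt (i : nat) : C := a + ((eps / i.+1%:R)%:C)%C.
pose rs := [seq pt i | i <- iota 0 (size p)].
have dist i : cmod (pt i - a) <= eps.
  rewrite /pt addrC addKr cmod_real ger0_norm ?divr_ge0 ?(ltW eps0) //.
  by rewrite ler_pdivrMr // ler_peMr ?(ltW eps0) // ler1n.
have : (size rs < size p)%N.
  apply: max_poly_roots => //.
    apply/allP => _ /mapP [i _ ->]; rewrite rootE; apply: contrapT => Hi.
    by apply: H; exists (pt i) => //; exact/negP.
  rewrite map_inj_uniq ?iota_uniq // => i j /addrI /complexI.
  by move=> /(mulfI (lt0r_neq0 eps0)) /invr_inj /eqP; rewrite eqr_nat => /eqP [].
by rewrite size_map size_iota ltnn.
Qed.

Lemma resultant_eq0P (p q : {poly C}) : p != 0 ->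
  reflect (exists y, root p y /\ root q y) (resultant p q == 0).
Proof.
move=> p0; rewrite resultant_eq0; apply: (iffP idP) => [sg|[y [py qy]]].
  have /closed_rootP [y] : size (gcdp p q) != 1%N by rewrite gtn_eqF.
  by rewrite root_gcd => /andP [? ?]; exists y.
have g0 : gcdp p q != 0 by rewrite gcdp_eq0 negb_and p0.
apply: (@root_size_gt1 _ y) => //.
by rewrite root_gcd py.
Qed.

Definition Qval (f : {poly {poly C}}) (x l u : C) : C :=
  (map_poly (fun P => eval2 P (l, u)) (Qres f)).[x].

(** Specialization commutes with the resultant because both leading coefficients in y are nonzero
    constants; degree at least 2 keeps u out of the leading term of f_y. *)
Lemma Qval_resultant n (f : {poly {poly C}}) x l u : tdeg_monic n.+2 f ->
  Qval f x l u = resultant (at_x x f - l%:P) ((at_x x f)^`() - u%:P).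
Proof.
move=> Hf; pose h : {rmorphism {poly {poly C}} -> C} := horner_eval l \o horner_eval (u%:P : {poly C}).
pose phi : {rmorphism {poly {poly {poly C}}} -> C} := horner_eval x \o map_poly h.
have phi_emb (a : {poly C}) : phi (map_poly (@embC R) a) = a.[x].
  have E : map_poly h (map_poly (@embC R) a) = a.
    apply/polyP => i; rewrite coef_map_id0 ?rmorph0 // coef_map_id0 //.
    by rewrite /h /= /horner_eval /embC !hornerC.
  by rewrite -[in RHS]E.
have lift (g : {poly {poly C}}) : map_poly phi (lift_f g) = at_x x g.
  apply/polyP => i; rewrite coef_map_id0 ?rmorph0 // /lift_f coef_map_id0 ?map_poly0 //.
  by rewrite phi_emb /at_x coef_map.
have phil : phi (@lambdaV R)%:P = l.
  by rewrite /phi /= map_polyC /= /horner_eval /lambdaV !hornerC hornerX.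
have phiu : phi (@uV R)%:P = u.
  by rewrite /phi /= map_polyC /= /horner_eval /uV hornerC hornerX hornerC.
have e1 : map_poly phi (lift_f f - (@lambdaV R)%:P%:P) = at_x x f - l%:P.
  transitivity (map_poly phi (lift_f f) - map_poly phi (@lambdaV R)%:P%:P).
    exact: rmorphB.
  by rewrite lift map_polyC; congr (_ - _%:P).
have e2 : map_poly phi (lift_f (dy f) - (@uV R)%:P%:P) = (at_x x f)^`() - u%:P.
  transitivity (map_poly phi (lift_f (dy f)) - map_poly phi (@uV R)%:P%:P).
    exact: rmorphB.
  by rewrite lift at_x_dy map_polyC; congr (_ - _%:P).
have lead0 (p : {poly {poly {poly {poly C}}}}) k : (0 < k)%N -> (size p <= k.+1)%N ->
    (map_poly phi p)`_k != 0 -> phi (lead_coef p) != 0.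
  move=> k0 sp pk; rewrite lead_coefE (_ : (size p).-1 = k) -?coef_map //.
  apply/eqP; rewrite -eqSS prednK; last first.
    by rewrite size_poly_gt0; apply: contraNneq pk => ->; rewrite map_poly0 coef0.
  rewrite eqn_leq sp ltnNge; apply: contra pk => sk.
  by rewrite coef_map nth_default //; apply/eqP; exact: rmorph0.
have lsize (g : {poly {poly C}}) (c : {poly {poly {poly C}}}) k : (0 < k)%N ->
    (size g <= k.+1)%N -> (size (lift_f g - c%:P)%R <= k.+1)%N.
  move=> k0 sg; apply: leq_trans (size_polyD _ _) _; rewrite geq_max.
  rewrite (leq_trans (size_poly _ _) sg) size_polyN.
  by apply: leq_trans (size_polyC_leq1 _) _.
have [sf fn fs] := Hf.
have [sdf dn _] := tdeg_monic_dy Hf.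
have dfn : (at_x x (dy f))`_n.+1 = n.+2%:R.
  rewrite coef_map /= /dy coef_deriv fn /horner_eval hornerMn hornerC //.
have sd : (size (dy f) <= n.+2)%N.
  by rewrite -ltnS -sf lt_size_deriv // -size_poly_eq0 sf.
rewrite -e1 -e2 -[Qval f x l u]/(phi (Qres f)) /Qres map_resultant //.
- apply: (lead0 _ n.+2) => //; first by apply: lsize => //; rewrite sf.
  rewrite e1 coefB coefC subr0 coef_map fn /= /horner_eval hornerC.
  exact: oner_neq0.
- apply: (lead0 _ n.+1) => //; first exact: lsize.
  by rewrite e2 coefB coefC subr0 -at_x_dy dfn pnatr_eq0.
Qed.

Lemma Qval_eq0P n (f : {poly {poly C}}) x l u : tdeg_monic n.+2 f ->
  reflect (exists y, eval2 f (x, y) = l /\ eval2 (dy f) (x, y) = u) (Qval f x l u == 0).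
Proof.
move=> Hf; rewrite (Qval_resultant x l u Hf).
have [pm _] := at_x_monic x (tdeg_monic_subC l (ltn0Sn _) Hf).
have E : at_x x (f - l%:P%:P) = at_x x f - l%:P.
  transitivity (at_x x f - at_x x l%:P%:P); first exact: rmorphB.
  by rewrite {2}/at_x map_polyC /= /horner_eval hornerC.
rewrite E in pm.
have rE y : root (at_x x f - l%:P) y = (eval2 f (x, y) == l).
  by rewrite rootE hornerD hornerN hornerC subr_eq0 eval2_at_x.
have rE' y : root ((at_x x f)^`() - u%:P) y = (eval2 (dy f) (x, y) == u).
  by rewrite rootE hornerD hornerN hornerC subr_eq0 -at_x_dy eval2_at_x.
apply: (iffP (resultant_eq0P _ (monic_neq0 pm))) => -[y [H1 H2]]; exists y.
  by split; apply/eqP; rewrite -?rE -?rE'.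
by rewrite rE rE' H1 H2.
Qed.

End ResultantRoots.

(** * Monomials of Q and the growth of its specializations *)

Section NewtonPolygon.
Variable R : realType.
Local Notation C := R[i].

Definition qcoef (f : {poly {poly C}}) (j k : nat) : {poly C} := ((Qres f)`_j)`_k.

Definition udeg (f : {poly {poly C}}) : nat := \max_(j < size (Qres f)) size ((Qres f)`_j)%R.

Lemma leq_udeg (f : {poly {poly C}}) (j : nat) : (size ((Qres f)`_j)%R <= udeg f)%N.
Proof.
have [Hj|Hj] := ltnP j (size (Qres f)); last by rewrite nth_default ?size_poly0.
exact: (@leq_bigmax _ (fun j : 'I__ => size ((Qres f)`_j)%R) (Ordinal Hj)).
Qed.

Lemma QvalE (f : {poly {poly C}}) x l u : Qval f x l u =
  \sum_(j < size (Qres f)) \sum_(k < udeg f) (qcoef f j k).[l] * u ^+ k * x ^+ j.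
Proof.
rewrite /Qval (@horner_coef_wide _ (size (Qres f))) ?size_poly //.
apply: eq_bigr => j _; rewrite coef_map_id0; last by rewrite /eval2 !horner0.
by rewrite (eval2_sum _ _ (leq_udeg f j)) mulr_suml.
Qed.

(** Three readings of Q: in u, in x at a fixed power of u, in lambda at u = 0. The roots of the
    first and third are values of f_y and critical values of f(x, .); they control the growth of the
    second. *)
Definition upoly (f : {poly {poly C}}) x l : {poly C} :=
  \poly_(k < udeg f) \sum_(j < size (Qres f)) (qcoef f j k).[l] * x ^+ j.
Definition xpoly (f : {poly {poly C}}) l k : {poly C} :=
  \poly_(j < size (Qres f)) (qcoef f j k).[l].
Definition lpoly (f : {poly {poly C}}) x : {poly C} :=
  \sum_(j < size (Qres f)) x ^+ j *: qcoef f j 0.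

Lemma qcoef_wide_u (f : {poly {poly C}}) j k : (udeg f <= k)%N -> qcoef f j k = 0.
Proof. by move=> Hk; rewrite /qcoef nth_default // (leq_trans (leq_udeg f j)). Qed.
Lemma qcoef_wide_x (f : {poly {poly C}}) j k : (size (Qres f) <= j)%N -> qcoef f j k = 0.
Proof. by move=> Hj; rewrite /qcoef (nth_default 0 Hj) coef0. Qed.

Lemma horner_upoly f x l u : (upoly f x l).[u] = Qval f x l u.
Proof.
rewrite QvalE horner_poly exchange_big /=; apply: eq_bigr => k _.
by rewrite mulr_suml; apply: eq_bigr => j _; rewrite mulrAC.
Qed.
Lemma coef_upoly f x l k : (upoly f x l)`_k = (xpoly f l k).[x].
Proof.
rewrite coef_poly horner_poly; case: ltnP => // Hk.
by rewrite big1 // => j _; rewrite qcoef_wide_u // horner0 mul0r.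
Qed.
Lemma horner_lpoly f x l : (lpoly f x).[l] = Qval f x l 0.
Proof.
rewrite -horner_upoly horner_coef0 coef_upoly horner_poly horner_sum.
by apply: eq_bigr => j _; rewrite hornerZ mulrC.
Qed.
Lemma coef_xpoly f l k j : (xpoly f l k)`_j = (qcoef f j k).[l].
Proof.
by rewrite coef_poly; case: ltnP => // Hj; rewrite qcoef_wide_x // horner0.
Qed.

Lemma size_lpoly f : exists V, forall x, (size (lpoly f x) <= V)%N.
Proof.
exists (\max_(j < size (Qres f)) size (qcoef f j 0)) => x.
apply: leq_trans (size_sum _ _ _) _; apply/bigmax_leqP => j _.
apply: leq_trans (size_scale_leq _ _) _.
exact: (@leq_bigmax _ (fun j : 'I__ => size (qcoef f j 0)) j).
Qed.

(* All monomials x^j u^k of Q lie below the line of slope -1/d through the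
   pure power of x: for lambda near l0 the roots u of Q are at least of order
   x^d, while Q(x, lambda, 0) has the same size as Q(x, l0, 0). *)
Lemma Qres_newton n (f : {poly {poly C}}) l0 (d e c : R) : tdeg_monic n.+2 f ->
  noncritical f l0 -> 0 < e -> 0 < c ->
  for_large (fun x => forall y, cmod (eval2 f (x, y) - l0) <= e ->
    c * cmod x `^ d <= cmod (eval2 (dy f) (x, y))) ->
  exists M : nat, (qcoef f M 0).[l0] != 0 /\
    forall j k, qcoef f j k != 0 -> j%:R + k%:R * d <= M%:R.
Proof.
move=> Hf [eps eps0 Hcrit] e0 c0 Hfy.
have [V HV] := size_lpoly f.
have x0 : xpoly f l0 0 != 0.
  have [x Hx] := for_large_ex Hcrit; apply/eqP => z.
  have : Qval f x l0 0 == 0 by rewrite -horner_upoly horner_coef0 coef_upoly z horner0.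
  case/(Qval_eq0P x l0 0 Hf) => y [y1 y2]; have := Hx y y2.
  by rewrite y1 subrr cmod0 leNgt eps0.
pose M := (size (xpoly f l0 0)).-1.
have sM : size (xpoly f l0 0) = M.+1 by rewrite prednK // size_poly_gt0.
exists M; split.
  by rewrite -coef_xpoly -lead_coefE lead_coef_eq0.
move=> j k jk.
(* A coefficient may vanish at l0 itself; it is tested at a nearby l where it does not. *)
have [|l ll lk] := @nonroot_near _ _ l0 (Num.min eps e) jk; first by rewrite lt_min eps0.
move: ll; rewrite le_min => /andP [leps le].
have xk0 : xpoly f l k != 0.
  by apply: contraNneq lk => z; rewrite -coef_xpoly z coef0.
have sx : size (xpoly f l k) = (size (xpoly f l k)).-1.+1 by rewrite prednK // size_poly_gt0.
have Omx := isOmega_poly sx.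
have js : (j <= (size (xpoly f l k)).-1)%N.
  rewrite -ltnS -sx ltnNge; apply: contra lk => Hj.
  by rewrite -coef_xpoly nth_default.
have [A A0 HA] := isO_pos (isO_poly (eq_leq sM)).
have Ox : isO (fun x => (xpoly f l k).[x]) (M%:R - k%:R * d).
  exists (2 ^+ udeg f * (2 ^+ V * A) / c ^+ k).
  apply: for_large_mono2 (for_large_and (for_large_and Hcrit Hfy) HA) (for_large_gt 0) => x [[H1 H2] H3] x_gt0.
  pose r := c * cmod x `^ d; have r0 : 0 < r by rewrite mulr_gt0 ?powR_gt0.
  (* The roots u are the values of f_y on the fibre over l, all of modulus at least r. *)
  have E1 : cmod (xpoly f l k).[x] * r ^+ k <= 2 ^+ udeg f * cmod (xpoly f l 0).[x].
    rewrite -!coef_upoly.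
    apply: le_trans (coef_le_of_roots k r0 _) _.
      move=> u; rewrite rootE horner_upoly => /(Qval_eq0P x l u Hf) [y [y1 y2]].
      by rewrite -y2; apply: H2; rewrite y1.
    by rewrite ler_wpM2r ?cmod_ge0 // ler_weXn2l ?ler1n // size_poly.
  (* The roots lambda of Q(x, lambda, 0) are the critical values of f(x, .), none closer to l0 than
     l is. *)
  have E2 : cmod (xpoly f l 0).[x] <= 2 ^+ V * cmod (xpoly f l0 0).[x].
    have xl a : (xpoly f a 0).[x] = (lpoly f x).[a].
      by rewrite horner_lpoly -horner_upoly horner_coef0 coef_upoly.
    rewrite !xl; apply: le_trans (horner_le_of_roots (a := l0) _) _.
      move=> z; rewrite rootE horner_lpoly => /(Qval_eq0P x z 0 Hf) [y [y1 y2]].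
      by apply: le_trans leps _; rewrite -y1; exact: H1.
    by rewrite ler_wpM2r ?cmod_ge0 // ler_weXn2l ?ler1n.
  have E3 : cmod (xpoly f l k).[x] * r ^+ k <= 2 ^+ udeg f * (2 ^+ V * (A * cmod x `^ M%:R)).
    apply: le_trans E1 _; rewrite ler_wpM2l ?exprn_ge0 //.
    by apply: le_trans E2 _; rewrite ler_wpM2l ?exprn_ge0.
  rewrite powRB; last by apply/implyP => _; rewrite gt_eqF.
  rewrite [k%:R * d]mulrC powRrM powR_mulrn ?powR_ge0 //.
  have -> : 2 ^+ udeg f * (2 ^+ V * A) / c ^+ k * (cmod x `^ M%:R / cmod x `^ d ^+ k) =
    2 ^+ udeg f * (2 ^+ V * (A * cmod x `^ M%:R)) / r ^+ k.
    rewrite /r exprMn invfM.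
    move: (2 ^+ udeg f) (2 ^+ V) ((c ^+ k)^-1) => a1 a2 a3.
    by move: ((cmod x `^ d ^+ k)^-1) (cmod x `^ M%:R) => a4 a5; ring.
  by rewrite ler_pdivlMr // exprn_gt0.
have := isO_isOmega Ox Omx; have : j%:R <= ((size (xpoly f l k)).-1)%:R :> R by rewrite ler_nat.
lra.
Qed.

Lemma Qdeg_newton (f : {poly {poly C}}) (d : R) M l0 : 0 < d ->
  (qcoef f M 0).[l0] != 0 ->
  (forall j k, qcoef f j k != 0 -> j%:R + k%:R * d <= M%:R) -> Qdeg f = M.
Proof.
move=> d0 HM Hjk; have qM : qcoef f M 0 != 0.
  by apply: contraNneq HM => ->; rewrite horner0.
have MS : (M < size (Qres f))%N.
  by rewrite ltnNge; apply: contra qM => H; rewrite qcoef_wide_x.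
apply/eqP; rewrite eqn_leq; apply/andP; split; last first.
  by rewrite /Qdeg -ltnS prednK // (leq_ltn_trans _ MS).
have Q0 : (Qres f)`_(Qdeg f) != 0.
  by rewrite -lead_coefE lead_coef_eq0 -size_poly_gt0 (leq_ltn_trans _ MS).
have : qcoef f (Qdeg f) (size ((Qres f)`_(Qdeg f))%R).-1 != 0.
  by rewrite /qcoef -lead_coefE lead_coef_eq0.
move/Hjk => H; rewrite -(ler_nat R).
by apply: le_trans H; rewrite lerDl mulr_ge0 // ltW.
Qed.

Lemma pdeg_le (A : nzRingType) (p : {poly A}) (i : nat) (s : R) : (0 < i)%N ->
  (forall k, p`_k != 0 -> k%:R <= s * i%:R) -> (pdeg R p / (i%:R : R)%:E <= s%:E)%E.
Proof.
move=> i0 Hk; have i0' : 0 < i%:R :> R by rewrite ltr0n.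
rewrite /pdeg; have [p0|p0] := eqVneq p 0; first by rewrite edivr_Ny // leNye.
rewrite edivr_fin // lee_fin ler_pdivrMr //; apply: Hk.
by rewrite -lead_coefE lead_coef_eq0.
Qed.

Lemma pdeg_ge (A : nzRingType) (p : {poly A}) (i k : nat) (s : R) : (0 < i)%N ->
  (pdeg R p / (i%:R : R)%:E <= s%:E)%E -> p`_k != 0 -> k%:R <= s * i%:R.
Proof.
move=> i0 H pk; have i0' : 0 < i%:R :> R by rewrite ltr0n.
have p0 : p != 0 by apply: contraNneq pk => ->; rewrite coef0.
move: H; rewrite /pdeg (negPf p0) edivr_fin // lee_fin ler_pdivrMr //.
apply: le_trans; rewrite ler_nat -ltnS prednK ?size_poly_gt0 //.
by rewrite ltnNge; apply: contra pk => H; rewrite nth_default.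
Qed.

Lemma slope_le (f : {poly {poly C}}) (d : R) M l0 : 0 < d ->
  (qcoef f M 0).[l0] != 0 ->
  (forall j k, qcoef f j k != 0 -> j%:R + k%:R * d <= M%:R) ->
  (slope f <= d^-1%:E)%E.
Proof.
move=> d0 HM Hjk; have QM := Qdeg_newton d0 HM Hjk.
rewrite /slope big_seq_cond; elim/big_rec: _ => [|i x]; first exact: leNye.
rewrite mem_index_iota andbT => /andP [i1 iN] Hx; rewrite ge_max Hx andbT.
rewrite /Qcoef QM in iN *; rewrite ltnS in iN.
apply: pdeg_le => // k /(Hjk (M - i)%N k); rewrite [d^-1 * _]mulrC ler_pdivlMr //.
by rewrite natrB //; lra.
Qed.

Lemma slope_at_ge (f : {poly {poly C}}) (l0 : C) (i : nat) : (1 <= i <= Qdeg f)%N ->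
  (pdeg R (at_lambda l0 (Qcoef f i)) / (i%:R : R)%:E <= slope_at f l0)%E.
Proof.
move=> /andP [i1 iN]; rewrite /slope_at.
have : i \in index_iota 1 (Qdeg f).+1 by rewrite mem_index_iota i1.
elim: (index_iota _ _) => // j s IH; rewrite inE big_cons le_max.
by case/orP => [/eqP <-|/IH ->]; rewrite ?lexx ?orbT.
Qed.

End NewtonPolygon.

(** * Comparison of the slopes *)

Section SlopeComparison.
Variable R : realType.
Local Notation C := R[i].

(** A nonnegative real majorant of the slope, which also disposes of the value -oo. *)
Lemma real_between_slope (s : \bar R) (d : R) : 0 < d -> (s < d^-1%:E)%E ->
  exists sg, [/\ 0 <= sg, (s <= sg%:E)%E & sg * d < 1].
Proof.
move=> d0; case: s => [s| |].
- rewrite lte_fin => sd; exists (Num.max 0 s); split.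
  + by rewrite le_max lexx.
  + by rewrite lee_fin le_max lexx orbT.
  + by rewrite -ltr_pdivlMr // mul1r gt_max sd invr_gt0 d0.
- by rewrite ltNge leey.
- by move=> _; exists 0; split; rewrite ?leNye // mul0r ltr01.
Qed.

(* If the Newton polygon of Q(x, l0, u) were less steep than 1/d, then
   Q(x, l0, u) would not vanish for |u| <= |x|^d' with some d' > d. *)
Lemma slope_at_lt_Nexp n (f : {poly {poly C}}) l0 (d : R) M : (tdeg_monic n.+2 f) ->
  0 < d -> (qcoef f M 0).[l0] != 0 ->
  (forall j k, qcoef f j k != 0 -> j%:R + k%:R * d <= M%:R) ->
  (slope_at f l0 < d^-1%:E)%E ->
  exists2 d', d < d' & Nexp (grad f) (fibre f l0) d'.
Proof.
move=> Hf d0 HM Hjk /(real_between_slope d0) [sg [sg0 Hsg sgd]].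
have QM := Qdeg_newton d0 HM Hjk.
(* With it sg tau <= (1 - sg d) / 2, so eta = 1 - sg d' stays positive; the summand 2 in the
   denominator covers sg = 0. *)
pose tau := (1 - sg * d) / (2 * sg + 2).
have den : 0 < 2 * sg + 2 by lra.
have tau0 : 0 < tau by rewrite divr_gt0 // subr_gt0.
pose d' := d + tau; pose eta := 1 - sg * d'.
have eta0 : 0 < eta.
  rewrite /eta /d' mulrDr; have : sg * tau <= (1 - sg * d) / 2.
    rewrite /tau mulrA ler_pdivrMr //; have : 0 < 1 - sg * d by rewrite subr_gt0.
    nra.
  lra.
have dd' : d < d' by rewrite ltrDl.
exists d' => //; apply/(Nexp_fibreP l0 (grad f) d' (ltn0Sn _) Hf); exists 1 => //.
pose Cst := \sum_(p : 'I_(size (Qres f)) * 'I_(udeg f)) cmod (qcoef f p.1 p.2).[l0].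
have kap0 : 0 < cmod (qcoef f M 0).[l0] by rewrite cmod_gt0.
have Me : M%:R - eta < M%:R by lra.
apply: for_large_mono2 (for_large_powR_lt Cst Me kap0) (for_large_gt 1) => x Hx x1 y Hy.
have x0 : 0 < cmod x by exact: lt_trans x1.
apply: (@le_trans _ _ (cmod (eval2 (dy f) (x, y)))); last exact: (maxnorm_ler (grad f _)).
rewrite mul1r leNgt; apply/negP => Hu; set u := eval2 (dy f) (x, y) in Hu.
have Q0 : Qval f x l0 u = 0.
  by apply/eqP/(Qval_eq0P x l0 u Hf); exists y.
have qM : qcoef f M 0 != 0 by apply: contraNneq HM => ->; rewrite horner0.
have MS : (M < size (Qres f))%N.
  by rewrite ltnNge; apply: contra qM => H; rewrite qcoef_wide_x.
have US : (0 < udeg f)%N.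
  by rewrite ltnNge; apply: contra qM => H; rewrite qcoef_wide_u.
pose p0 : 'I_(size (Qres f)) * 'I_(udeg f) := (Ordinal MS, Ordinal US).
(* As Q vanishes, the x^M term balances all the others. In those with nonzero coefficient j = M - i
   with i >= 1, and k <= sg i gives d' k + j <= M - eta i <= M - eta, too small for large x. *)
move: Q0; rewrite QvalE pair_big /= (bigD1 p0) //= expr0 mulr1.
move=> /eqP; rewrite addr_eq0 => /eqP /(congr1 (@cmod R)); rewrite cmodN cmodM cmodX.
move=> E; move: Hx; rewrite powR_mulrn ?cmod_ge0 // E ltNge => /negP; apply.
apply: le_trans (cmod_sum _ _ _) _; rewrite /Cst mulr_suml.
apply: le_trans (_ : \sum_(p | p != p0) cmod (qcoef f p.1 p.2).[l0] * cmod x `^ (M%:R - eta) <= _).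
  apply: ler_sum => -[j k] jk /=; rewrite -mulrA cmodM.
  have [->|cjk] := eqVneq (qcoef f j k).[l0] 0; first by rewrite cmod0 !mul0r.
  rewrite ler_wpM2l ?cmod_ge0 //.
  have qjk : qcoef f j k != 0 by apply: contraNneq cjk => ->; rewrite horner0.
  have jM : (j < M)%N.
    have H := Hjk j k qjk; rewrite ltnNge; apply: contra jk => Mj.
    have MjR : M%:R <= j%:R :> R by rewrite ler_nat.
    have k0 : (k : nat) = 0%N.
      apply/eqP; rewrite -(pnatr_eq0 R) -(mulIr_eq0 _ (mulIf (lt0r_neq0 d0))).
      by rewrite eq_le mulr_ge0 ?(ltW d0) // andbT; move: H MjR; lra.
    apply/eqP; congr pair; apply/val_inj => //=; apply/eqP.
    by rewrite eqn_leq Mj andbT -(ler_nat R); move: H; rewrite k0 mul0r addr0.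
  pose i := (M - j)%N.
  have iM : (1 <= i <= Qdeg f)%N by rewrite QM /i subn_gt0 jM leq_subr.
  have [i1 iQ] := andP iM.
  have ki : k%:R <= sg * i%:R.
    apply: (pdeg_ge i1 (le_trans (slope_at_ge l0 iM) Hsg)).
    rewrite coef_map_id0 ?horner0 // /Qcoef QM /i subKn // ltnW //.
  have jE : j%:R = M%:R - i%:R :> R by rewrite /i natrB ?(ltnW jM) //; ring.
  have i1R : 1 <= i%:R :> R by rewrite ler1n.
  have d'0 : 0 < d' by exact: lt_trans dd'.
  rewrite cmodM !cmodX; apply: (@le_trans _ _ ((cmod x `^ d') ^+ k * cmod x ^+ j)).
    rewrite ler_wpM2r ?exprn_ge0 ?cmod_ge0 // lerXn2r ?nnegrE ?powR_ge0 ?cmod_ge0 //.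
    exact: ltW.
  rewrite -!powR_mulrn ?powR_ge0 ?cmod_ge0 // -powRrM -powRD; last first.
    by apply/implyP => _; rewrite gt_eqF.
  apply: ler_powR; first exact: ltW.
  have h1 : d' * k%:R <= d' * (sg * i%:R) by rewrite ler_wpM2l // ltW.
  have h2 : eta * 1 <= eta * i%:R by rewrite ler_wpM2l // ltW.
  have h3 : eta * i%:R = i%:R - d' * (sg * i%:R) by rewrite /eta; ring.
  by rewrite jE; lra.
by rewrite [leRHS](bigD1 p0) //= lerDr mulr_ge0 ?cmod_ge0 ?powR_ge0.
Qed.

Lemma mero_isO_ex (h : C -> C) : mero h -> exists a : R, isO h a.
Proof.
move=> /mero_isO_isOmega [z|[m [Oh _]]]; last by exists m%:~R.
by exists 0; apply: isO_evext (isO_0 _); apply: for_large_mono z => t ->.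
Qed.

Lemma loj_at_lty n (f : {poly {poly C}}) l : (0 < n)%N -> tdeg_monic n f ->
  (loj_at f l < +oo)%E.
Proof.
move=> n0 Hf; have [D [q [D0 sq Hq _]]] := fibre_branches l 0 1 n0 Hf.
case: q sq Hq => [E|c q _ Hq]; first by rewrite -E in n0.
have [a Ha] := mero_isO_ex (mero_branch (dx f) D c).
have [b Hb] := mero_isO_ex (mero_branch (dy f) D c).
have P : puiseux_curve f l D (branch D c).
  split=> //; [exact: branch_mero | exact: isO_branch |].
  by apply: isO_le (Hq c (mem_head _ _)); rewrite lerN2 mul1n ler1n.
apply: le_lt_trans (ltry (Num.max a b / D%:R)).
apply: (loj_at_le P).
  by apply: isO_le Ha; rewrite le_max lexx.
by apply: isO_le Hb; rewrite le_max lexx orbT.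
Qed.

Lemma noncritical_fy n (f : {poly {poly C}}) l (d : R) : (0 < n)%N -> tdeg_monic n f ->
  noncritical f l -> Nexp (grad f) (fibre f l) d ->
  exists2 c : R, 0 < c & for_large (fun x => forall y, eval2 f (x, y) = l ->
    c * cmod x `^ d <= cmod (eval2 (dy f) (x, y))).
Proof.
move=> n0 Hf nc /(Nexp_fibreP l (grad f) d n0 Hf) [a a0 Ha].
have [A HA] := noncritical_dx_dy n0 Hf nc.
pose B := Num.max 1 A; have B0 : 0 < B by rewrite lt_max ltr01.
exists (a / B); first by rewrite divr_gt0.
apply: for_large_mono2 Ha HA => x H1 H2 y Hy; rewrite mulrAC ler_pdivrMr //.
apply: le_trans (H1 y Hy) _; rewrite maxnorm_le /grad /=; apply/andP; split.
  apply: le_trans (H2 y Hy) _; rewrite mulrC ler_wpM2l ?cmod_ge0 //.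
  by rewrite le_max lexx orbT.
by rewrite ler_peMr ?cmod_ge0 // le_max lexx.
Qed.

(** A specialized slope below 1/d would give the fibre an exponent above d, against the equality of
    both exponents for noncritical l. *)
Lemma noncritical_slope n (f : {poly {poly C}}) l : (0 < n)%N -> tdeg_monic n f ->
  noncritical f l -> (0 < loj_at f l)%E -> (slope f <= slope_at f l)%E.
Proof.
move=> n0 Hf nc L0.
have [d dE] : exists d, loj_at f l = d%:E.
  move: L0 (loj_at_lty l n0 Hf); case: (loj_at f l) => [d| |] //; by exists d.
have d0 : 0 < d by move: L0; rewrite dE lte_fin.
have HN : Nexp (grad f) (fibre f l) d by apply: (loj_at_Nexp n0 Hf); rewrite dE.
have [c c0 Hc] := noncritical_fy n0 Hf nc HN.
case: n n0 Hf => [//|[|n]] n0 Hf.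
  exfalso; have [x [H1 H2]] := for_large_ex (for_large_and Hc (for_large_powR_lt 1 d0 c0)).
  have [y Hy _] := fibre_near l x 0 n0 Hf.
  by have := H1 y Hy; rewrite dy_deg1 // cmod1 leNgt; move: H2; rewrite powRr0 mulr1 => ->.
have [e [c1 [A [e0 _ He]]]] := noncritical_near n0 Hf nc.
pose B := Num.max 1 A; have B0 : 0 < B by rewrite lt_max ltr01.
have Hfy : for_large (fun x => forall y, cmod (eval2 f (x, y) - l) <= e ->
    c / B * cmod x `^ d <= cmod (eval2 (dy f) (x, y))).
  apply: for_large_mono2 Hc He => x H1 H2 y Hy; have [_ [g g1 g2]] := H2 y Hy.
  rewrite mulrAC ler_pdivrMr //; apply: le_trans (H1 g g1) _; apply: le_trans g2 _.
  by rewrite mulrC ler_wpM2l ?cmod_ge0 // le_max lexx orbT.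
have [M [HM Hjk]] := Qres_newton Hf nc e0 (divr_gt0 c0 B0) Hfy.
apply: le_trans (slope_le d0 HM Hjk) _; rewrite leNgt; apply/negP => Hs.
have [d' dd' HN'] := slope_at_lt_Nexp Hf d0 HM Hjk Hs.
have := noncritical_Nexp_le n0 Hf nc HN'.
by rewrite dE lee_fin leNgt dd'.
Qed.

Lemma tdeg_monic_expand n (a : nat -> {poly C}) :
  (forall i, (1 <= i <= n)%N -> (size (a i) <= i.+1)%N) ->
  tdeg_monic n ('X^n + \sum_(1 <= i < n.+1) (a i)%:P * 'X^(n - i)).
Proof.
move=> ha; have -> : \sum_(1 <= i < n.+1) (a i)%:P * 'X^(n - i) =
    \poly_(j < n) a (n - j)%N.
  rewrite big_add1 big_mkord poly_def (reindex_inj rev_ord_inj) /=.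
  apply: eq_bigr => i _; rewrite mul_polyC.
  have Hi := ltn_ord i; congr (a _ *: 'X^_); lia.
set r := \poly_(j < n) _; have sr : (size r <= n)%N by exact: size_poly.
have coef i : ('X^n + r)`_i = if i == n then 1 else r`_i.
  rewrite coefD coefXn; case: eqP => [->|_]; last by rewrite add0r.
  by rewrite nth_default // addr0.
split.
- by rewrite size_polyDl size_polyXn.
- by rewrite coef eqxx.
move=> i Hi; rewrite coef; case: eqP => [->|ni]; first by rewrite size_poly1.
have Hi' : (i < n)%N by rewrite ltn_neqAle Hi andbT; apply/eqP.
rewrite coef_poly Hi'; apply: ha; rewrite subn_gt0 Hi' /=; exact: leq_subr.
Qed.

Lemma loj_on_ge F (S : set (C * C)) nu : Nexp F S nu -> (nu%:E <= loj_on F S)%E.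
Proof. by move=> H; apply: ereal_sup_ubound; exists nu. Qed.

Lemma loj_on_le F (S : set (C * C)) (x : \bar R) :
  (forall nu, Nexp F S nu -> (nu%:E <= x)%E) -> (loj_on F S <= x)%E.
Proof. by move=> H; apply: ge_ereal_sup => _ [nu Hnu <-]; exact: H. Qed.

End SlopeComparison.

Theorem theorem4p8 (R : realType) (n : nat) (hn : (1 <= n)%N)
    (a : nat -> {poly R[i]})
    (ha : forall i : nat, (1 <= i <= n)%N -> (size (a i) <= i.+1)%N)
    (f : {poly {poly R[i]}})
    (hf : f = 'X^n + \sum_(1 <= i < n.+1) (a i)%:P * 'X^(n - i)) :
  finite_set [set l : R[i] | loj_at f l <> loj_on (grad f) (fibre f l)] /\
  (forall l : R[i], loj_at f l <> loj_on (grad f) (fibre f l) ->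
     (loj_at f l < loj_on (grad f) (fibre f l))%E) /\
  (forall l0 : R[i],
     (loj_at f l0 < loj_on (grad f) (fibre f l0))%E <->
     ((-oo < loj_at f l0)%E /\ (loj_at f l0 < (-1)%:E)%E) \/
     ((0 < loj_at f l0)%E /\ (slope_at f l0 < slope f)%E)).
Proof.
have Hf : tdeg_monic n f by rewrite hf; exact: tdeg_monic_expand.
have le_on l : (loj_at f l <= loj_on (grad f) (fibre f l))%E.
  have := loj_at_lty l hn Hf; case E: (loj_at f l) => [e| |] //; last by rewrite leNye.
  by move=> _; apply: loj_on_ge; apply: (loj_at_Nexp hn Hf); rewrite E.
have eq_on l : noncritical f l -> loj_at f l = loj_on (grad f) (fibre f l).
  move=> nc; apply/eqP; rewrite eq_le le_on /=; apply: loj_on_le => nu.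
  exact: noncritical_Nexp_le hn Hf nc.
split; last split.
- apply: sub_finite_set (critical_finite hn Hf) => l /= ne nc.
  exact: ne (eq_on l nc).
- by move=> l /eqP ne; rewrite lt_neqAle ne le_on.
move=> l; split=> [lt_l|[[lN l1]|[l0 sl]]].
- left; have nc : ~ noncritical f l by move=> /eq_on E; rewrite E ltxx in lt_l.
  split; last exact: critical_loj_at hn Hf nc.
  (* Any exponent on the fibre would bound the exponent near it from below, so the value -oo is
     shared by both and the inequality is not strict. *)
  rewrite ltNge leeNy_eq; apply/negP => /eqP E.
  have : (loj_on (grad f) (fibre f l) <= -oo)%E.
    apply: loj_on_le => nu /(Nexp_loj_at hn Hf) [al]; rewrite E leeNy_eq //.
  by rewrite -E leNgt lt_l.
- have [e E] : exists e, loj_at f l = e%:E.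
    by move: lN l1; case: (loj_at f l) => [e| |] //; exists e.
  have e1 : e < -1 by move: l1; rewrite E.
  have [b eb HN] := Nexp_gt_loj_at hn Hf E e1.
  by apply: lt_le_trans (loj_on_ge HN); rewrite E lte_fin.
exfalso; have [nc|/(critical_loj_at hn Hf) lt1] := pselect (noncritical f l).
  by move: sl; rewrite ltNge (noncritical_slope hn Hf nc l0).
by have := lt_trans l0 lt1; rewrite lte_fin ltr0N1.
Qed.
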